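(* Let $\mathbb{F}_\Theta=K/K_\Theta$ be a real flag manifold of the split real form $\mathfrak{g}_2$ (notation as in the context). (a) If $\Theta=\emptyset$, then for each metric operator $A:\mathfrak{m}_\emptyset\to\mathfrak{m}_\emptyset$ associated with an $\mathrm{Ad}(K_\emptyset)$-invariant inner product on $\mathfrak{m}_\emptyset$ there exist positive numbers $\mu_1,\dots,\mu_6$ and real numbers $a_1\in(-\sqrt{\mu_1\mu_2},\sqrt{\mu_1\mu_2})$, $a_2\in(-\sqrt{\mu_3\mu_4},\sqrt{\mu_3\mu_4})$, $a_3\in(-\sqrt{\mu_5\mu_6},\sqrt{\mu_5\mu_6})$ such that $A$ is written in the $(\cdot,\cdot)$-orthonormal basis $\mathcal{B}_\emptyset=\{W_1,Z_3,W_2,Z_2,W_3,Z_1\}$ as $$[A]_{\mathcal{B}_\emptyset}=\begin{pmatrix} \mu_1 & a_1 & 0 & 0 & 0 & 0 \\ a_1 & \mu_2 & 0 & 0 & 0 & 0 \\ 0 & 0 & \mu_3 & a_2 & 0 & 0 \\ 0 & 0 & a_2 & \mu_4 & 0 & 0 \\ 0 & 0 & 0 & 0 & \mu_5 & a_3 \\ 0 & 0 & 0 & 0 & a_3 & \mu_6 \end{pmatrix}.$$ This representation covers all metric operators associated with $\mathrm{Ad}(K_\emptyset)$-invariant inner products. (b) If $\Theta=\{\alpha_1\}$, then for each metric operator $A:\mathfrak{m}_{\{\alpha_1\}}\to\mathfrak{m}_{\{\alpha_1\}}$ associated with an $\mathrm{Ad}(K_{\{\alpha_1\}})$-invariant inner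 product on $\mathfrak{m}_{\{\alpha_1\}}$ there exist positive numbers $\mu_1,\mu_2,\mu_3$ and a real number $a\in(-\sqrt{\mu_2\mu_3},\sqrt{\mu_2\mu_3})$ such that $A$ is written in the basis $\mathcal{B}_{\{\alpha_1\}}=\{Z_3,W_2,W_3,Z_2,-Z_1\}$ as $$[A]_{\mathcal{B}_{\{\alpha_1\}}}=\begin{pmatrix} \mu_1 & 0 & 0 & 0 & 0 \\ 0 & \mu_2 & 0 & a & 0 \\ 0 & 0 & \mu_2 & 0 & a \\ 0 & a & 0 & \mu_3 & 0 \\ 0 & 0 & a & 0 & \mu_3 \end{pmatrix}.$$ This representation covers all metric operators associated with $\mathrm{Ad}(K_{\{\alpha_1\}})$-invariant inner products. (c) If $\Theta=\{\alpha_2\}$, then for each metric operator $A$ associated with an $\mathrm{Ad}(K_{\{\alpha_2\}})$-invariant inner product on $\mathfrak{m}_{\{\alpha_2\}}$ there exist positive real numbers $\mu_1,\mu_2,\mu_3$ such that $A$ is written in the basis $$\mathcal{B}_{\{\alpha_2\}}=\left\{\tfrac{\sqrt{13}W_2+2Z_2}{\sqrt{17}},\tfrac{W_1+Z_3}{\sqrt2},\tfrac{W_3+Z_1}{\sqrt2},\tfrac{W_1-Z_3}{\sqrt2},\tfrac{W_3-Z_1}{\sqrt2}\right\}$$ as $[A]_{\mathcal{B}_{\{\alpha_2\}}}=\mathrm{diag}(\mu_1,\mu_2,\mu_2,\mu_3,\mu_3)$. This representation covers all metric operators associated with $\mathrm{Ad}(K_{\{\alpha_2\}})$-invariant inner 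products.
   Context: The Lie algebra. The split real form $\mathfrak{g}_2$ is realized as $\mathfrak{sl}(3)\oplus\mathbb{R}^3\oplus(\mathbb{R}^3)^*$ (real scalars), with canonical basis $e_1,e_2,e_3$ of $\mathbb{R}^3$, dual basis $\epsilon_1,\epsilon_2,\epsilon_3$, and bracket determined by bilinearity, skew-symmetry and: $[X,Y]=XY-YX$ for $X,Y\in\mathfrak{sl}(3)$; $[X,v]=Xv$; $[X,\alpha]=-\alpha\circ X$; $[u,v]=-\frac43T(u\wedge v)$; $[\alpha,\beta]=\frac43S(\alpha\wedge\beta)$; $[v,\alpha]=(v^i\alpha^j)_{3\times3}-\frac13\alpha(v)I_3$, for $u,v\in\mathbb{R}^3$, $\alpha,\beta\in(\mathbb{R}^3)^*$. Here $T(u\wedge v)\in(\mathbb{R}^3)^*$ is given by $u\wedge v\wedge w=T(u\wedge v)(w)\,e_1\wedge e_2\wedge e_3$, and $S(\alpha\wedge\beta)\in\mathbb{R}^3$ by $\alpha\wedge\beta\wedge\gamma=\gamma(S(\alpha\wedge\beta))\,\epsilon_1\wedge\epsilon_2\wedge\epsilon_3$. Roots. $\mathfrak{h}$ is the Cartan subalgebra of diagonal traceless matrices, $\lambda_i(\mathrm{diag}(a_1,a_2,a_3))=a_i$. The roots are $\lambda_i-\lambda_j$ ($i\ne j$) and $\pm\lambda_i$, with root spaces spanned by $E_{ij}$ (the matrix unit), $e_i$ (for $\lambda_i$) and $\epsilon_i$ (for $-\lambda_i$). Positive roots: $\Pi^+=\{\lambda_i-\lambda_j:i<j\}\cup\{\lambda_1,\lambda_2,-\lambda_3\}$;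 simple roots: $\Sigma=\{\alpha_1=\lambda_1-\lambda_2,\ \alpha_2=\lambda_2\}$. Flag manifolds. $G_2$ is a connected non-compact simple Lie group with Lie algebra $\mathfrak{g}_2$. For $\Theta\subsetneq\Sigma$ let $\langle\Theta\rangle^-$ be the set of negative roots that are integer combinations of elements of $\Theta$, let $\mathfrak{p}_\Theta=\mathfrak{h}\oplus\bigoplus_{\alpha\in\Pi^+}(\mathfrak{g}_2)_\alpha\oplus\bigoplus_{\alpha\in\langle\Theta\rangle^-}(\mathfrak{g}_2)_\alpha$ and $P_\Theta=\{a\in G_2:\mathrm{Ad}(a)\mathfrak{p}_\Theta=\mathfrak{p}_\Theta\}$. The maximal compact subgroup $K\cong SO(4)$ of $G_2$ acts transitively on $\mathbb{F}_\Theta=G_2/P_\Theta$ with isotropy $K_\Theta=K\cap P_\Theta$, so $\mathbb{F}_\Theta=K/K_\Theta$. The Lie algebra $\mathfrak{k}\cong\mathfrak{so}(3)\oplus\mathfrak{so}(3)$ of $K$ is spanned by $X_1=E_{21}-E_{12}$, $X_2=E_{31}-E_{13}$, $X_3=E_{32}-E_{23}$, $Y_i=e_i-\epsilon_i$ ($i=1,2,3$). Inner product and vectors. $(\cdot,\cdot)=-B$, where $B$ is the (negative definite) Killing form of $\mathfrak{k}$. $\mathfrak{k}_\Theta$ is the Lie algebra of $K_\Theta$: $\mathfrak{k}_\emptyset=\{0\}$, $\mathfrak{k}_{\{\alpha_1\}}=\mathrm{span}\{X_1\}$, $\mathfrak{k}_{\{\alpha_2\}}=\mathrm{span}\{Y_2\}$;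 $\mathfrak{m}_\Theta$ is the $(\cdot,\cdot)$-orthogonal complement of $\mathfrak{k}_\Theta$ in $\mathfrak{k}$. The following vectors form a $(\cdot,\cdot)$-orthonormal basis of $\mathfrak{k}$: $W_i=\frac12X_i$ ($i=1,2,3$), $Z_1=\frac{3}{2\sqrt{13}}Y_1-\frac1{\sqrt{13}}X_3$, $Z_2=\frac{3}{2\sqrt{13}}Y_2+\frac1{\sqrt{13}}X_2$, $Z_3=\frac{3}{2\sqrt{13}}Y_3-\frac1{\sqrt{13}}X_1$. Metrics. $K$-invariant Riemannian metrics on $\mathbb{F}_\Theta$ correspond bijectively to $\mathrm{Ad}(K_\Theta)$-invariant inner products $\langle\cdot,\cdot\rangle$ on $\mathfrak{m}_\Theta$. The metric operator of $\langle\cdot,\cdot\rangle$ is the linear map $A:\mathfrak{m}_\Theta\to\mathfrak{m}_\Theta$ with $\langle X,Y\rangle=(AX,Y)$ for all $X,Y\in\mathfrak{m}_\Theta$.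
   Formalization: The printed coefficient 4/3 in [u,v] and [α,β] violates the Jacobi identity and is replaced by √(4/3); accordingly Z_1=(√3Y_1−X_3)/4, Z_2=(√3Y_2+X_2)/4, Z_3=(√3Y_3−X_1)/4, and the first vector of B_{α_2} becomes (2W_2+Z_2)/√5. *)

(* Defs.v *)
From HB Require Import structures.
From mathcomp Require Import all_boot all_order all_algebra.
From mathcomp Require Import all_classical all_reals all_analysis.
Set Implicit Arguments. Unset Strict Implicit. Unset Printing Implicit Defensive.
Import Order.TTheory GRing.Theory Num.Theory.
Import numFieldNormedType.Exports.
Local Open Scope classical_set_scope.
Local Open Scope ring_scope.

Definition sl3_vs (R : realType) : {vspace 'M[R]_3} :=
  lker (linfun (@mxtrace R 3 : 'M[R]_3 -> R^o)).

Definition sl3 (R : realType) : Type := subvs_of (sl3_vs R).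
HB.instance Definition _ (R : realType) :=
  Vector.copy (sl3 R) (subvs_of (sl3_vs R)).

Definition sl3_mx (R : realType) (X : sl3 R) : 'M[R]_3 := vsval X.
HB.instance Definition _ (R : realType) :=
  Topological.copy (sl3 R) (initial_topology (@sl3_mx R)).

(* The identity on traceless matrices. *)
Definition to_sl3 (R : realType) (M : 'M[R]_3) : sl3 R := vsproj (sl3_vs R) M.

(* sl(3) + R^3 + (R^3)^*, with vectors as columns and covectors as rows, so
   that X v is X *m v, alpha o X is alpha *m X, alpha(v) is the entry of
   alpha *m v, and the matrix (v^i alpha^j) is v *m alpha. *)
Definition g2 (R : realType) : Type := (sl3 R * 'cV[R]_3 * 'rV[R]_3)%type.
HB.instance Definition _ (R : realType) :=
  Vector.copy (g2 R) (sl3 R * 'cV[R]_3 * 'rV[R]_3)%type.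
HB.instance Definition _ (R : realType) :=
  Topological.copy (g2 R) (sl3 R * 'cV[R]_3 * 'rV[R]_3)%type.
HB.instance Definition _ (R : realType) := isPointed.Build (g2 R) 0.

(* u ^ v ^ w = det(u, v, w) e_1 ^ e_2 ^ e_3; the coordinates of T(u ^ v) are
   its values on the canonical basis. *)
Definition wedgeT (R : realType) (u v : 'cV[R]_3) : 'rV[R]_3 :=
  \row_(j < 3) \det (row_mx u (row_mx v (delta_mx j ord0)) : 'M[R]_3).

Definition wedgeS (R : realType) (a b : 'rV[R]_3) : 'cV[R]_3 :=
  \col_(i < 3) \det (col_mx a (col_mx b (delta_mx ord0 i)) : 'M[R]_3).

(* Structure constant: [u, v] = - kappa T(u ^ v), [a, b] = kappa S(a ^ b).
   The Jacobi identity of (e_1, e_2, epsilon_1),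
     [[e_1, e_2], epsilon_1] = - kappa^2 e_2,
     [e_1, [e_2, epsilon_1]] - [e_2, [e_1, epsilon_1]] = - (4/3) e_2,
   forces kappa^2 = 4/3. The coefficient 4/3 printed in the source violates it,
   i.e. does not define a Lie algebra, and is replaced by its square root. *)
Definition kappa (R : realType) : R := Num.sqrt (4 / 3).

Definition bracket (R : realType) (x y : g2 R) : g2 R :=
  let: (X, v, a) := x in let: (Y, w, b) := y in
  let A := sl3_mx X in let B := sl3_mx Y in
  (to_sl3 (A *m B - B *m A
     + (v *m b - (3^-1 * (b *m v) ord0 ord0)%:M)
     - (w *m a - (3^-1 * (a *m w) ord0 ord0)%:M)),
   A *m w - B *m v + kappa R *: wedgeS a b,
   - (b *m A) + a *m B - kappa R *: wedgeT v w).

Definition gl_part (R : realType) (M : 'M[R]_3) : g2 R := (to_sl3 M, 0, 0).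
Definition vec_part (R : realType) (v : 'cV[R]_3) : g2 R := (0, v, 0).
Definition cov_part (R : realType) (a : 'rV[R]_3) : g2 R := (0, 0, a).

(* Coordinates are numbered 0, 1, 2 instead of 1, 2, 3. *)
Definition i1 : 'I_3 := inord 0.
Definition i2 : 'I_3 := inord 1.
Definition i3 : 'I_3 := inord 2.

Definition cartan (R : realType) : set (g2 R) :=
  [set H | [/\ is_diag_mx (sl3_mx H.1.1), H.1.2 = 0 & H.2 = 0]].

(* Functionals on the Cartan subalgebra, extended by the diagonal entries; the
   relation lambda_1 + lambda_2 + lambda_3 = 0 still holds. *)
Definition lambda (R : realType) (i : 'I_3) : g2 R -> R :=
  fun H => sl3_mx H.1.1 i i.

Definition root_space (R : realType) (b : g2 R -> R) : set (g2 R) :=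
  [set Z | forall H, cartan H -> bracket H Z = b H *: Z].

Definition pos_roots (R : realType) : set (g2 R -> R) :=
  [set b | exists i j : 'I_3, (i < j)%N /\ b = lambda i \- lambda j]
  `|` [set lambda i1; lambda i2; \- lambda i3].

Definition alpha1 (R : realType) : g2 R -> R := lambda i1 \- lambda i2.
Definition alpha2 (R : realType) : g2 R -> R := lambda i2.

Definition neg_span (R : realType) (Theta : set (g2 R -> R)) :
    set (g2 R -> R) :=
  [set b | pos_roots (\- b) /\
    exists m n : int,
      [/\ m != 0 -> Theta (@alpha1 R), n != 0 -> Theta (@alpha2 R) &
          forall H, cartan H -> b H = m%:~R * alpha1 H + n%:~R * alpha2 H]].

Definition lin_span (R : realType) (S : set (g2 R)) : set (g2 R) :=
  [set Z | forall U : {vspace g2 R}, (forall X, S X -> X \in U) -> Z \in U].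

Definition p_Theta (R : realType) (Theta : set (g2 R -> R)) : set (g2 R) :=
  lin_span (cartan (R := R)
    `|` \bigcup_(b in pos_roots (R := R)) root_space b
    `|` \bigcup_(b in neg_span Theta) root_space b).

Definition exp_ad (R : realType) (X : g2 R) : g2 R -> g2 R :=
  fun Y => lim (series (fun n => n`!%:R^-1 *: iter n (bracket X) Y) @ \oo).

(* Since K is SO(4), and not its double cover, G_2 has trivial center, so Ad
   identifies G_2 with the group of inner automorphisms of its Lie algebra, the
   group generated by the exp(ad X). Under this identification Ad(a) is a. *)
Definition G2 (R : realType) : set (g2 R -> g2 R) :=
  [set a | exists s : seq (g2 R), a = foldr (fun X b => exp_ad X \o b) id s].

Definition is_subgroup (R : realType) (H : set (g2 R -> g2 R)) : Prop :=
  [/\ H `<=` G2 (R := R), H id,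
      forall a b, H a -> H b -> H (a \o b) &
      forall a, H a -> exists2 b, H b & b \o a = id /\ a \o b = id].

(* On linear endomorphisms of the finite-dimensional space g2, pointwise
   convergence is the usual topology. *)
Definition is_compact_subgroup (R : realType) (H : set (g2 R -> g2 R)) : Prop :=
  is_subgroup H /\ compact (H : set {ptws g2 R -> g2 R}).

Definition is_maximal_compact (R : realType) (H : set (g2 R -> g2 R)) : Prop :=
  is_compact_subgroup H /\
  forall H', is_compact_subgroup H' -> H `<=` H' -> H' = H.

Definition lie (R : realType) (H : set (g2 R -> g2 R)) : set (g2 R) :=
  [set X | forall t : R, H (exp_ad (t *: X))].

Definition X1 (R : realType) : g2 R :=
  gl_part (delta_mx i2 i1 - delta_mx i1 i2).
Definition X2 (R : realType) : g2 R :=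
  gl_part (delta_mx i3 i1 - delta_mx i1 i3).
Definition X3 (R : realType) : g2 R :=
  gl_part (delta_mx i3 i2 - delta_mx i2 i3).
Definition Yk (R : realType) (i : 'I_3) : g2 R :=
  vec_part (delta_mx i ord0) - cov_part (delta_mx ord0 i).

Definition frk (R : realType) : {vspace g2 R} :=
  <<[:: X1 R; X2 R; X3 R; Yk R i1; Yk R i2; Yk R i3]>>%VS.

Definition P_Theta (R : realType) (Theta : set (g2 R -> R)) :
    set (g2 R -> g2 R) :=
  [set a | G2 a /\ a @` p_Theta Theta = p_Theta Theta].

Definition K_Theta (R : realType) (K : set (g2 R -> g2 R))
    (Theta : set (g2 R -> R)) : set (g2 R -> g2 R) :=
  K `&` P_Theta Theta.

Definition k_trace (R : realType) (f : g2 R -> g2 R) : R :=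
  \sum_(i < \dim (frk R)) coord (vbasis (frk R)) i (f (vbasis (frk R))`_i).

Definition killing_k (R : realType) (X Y : g2 R) : R :=
  k_trace (bracket X \o bracket Y).

Definition ip (R : realType) (X Y : g2 R) : R := - killing_k X Y.

Definition m_Theta (R : realType) (K : set (g2 R -> g2 R))
    (Theta : set (g2 R -> R)) : set (g2 R) :=
  [set Y | Y \in frk R /\
    forall X, lie (K_Theta K Theta) X -> ip X Y = 0].

(* Inner products and endomorphisms of a subspace m are represented by
   functions on g2 whose values outside of m are irrelevant. *)
Definition is_inner_product (R : realType) (m : set (g2 R))
    (q : g2 R -> g2 R -> R) : Prop :=
  [/\ forall X Y, m X -> m Y -> q X Y = q Y X,
      forall (c : R) X Y Z, m X -> m Y -> m Z ->
        q (c *: X + Y) Z = c * q X Z + q Y Z &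
      forall X, m X -> X != 0 -> 0 < q X X].

Definition is_invariant (R : realType) (H : set (g2 R -> g2 R))
    (m : set (g2 R)) (q : g2 R -> g2 R -> R) : Prop :=
  forall a X Y, H a -> m X -> m Y -> q (a X) (a Y) = q X Y.

Definition is_endo (R : realType) (m : set (g2 R)) (A : g2 R -> g2 R) : Prop :=
  (forall X, m X -> m (A X)) /\
  (forall (c : R) X Y, m X -> m Y -> A (c *: X + Y) = c *: A X + A Y).

Definition is_metric_operator (R : realType) (K : set (g2 R -> g2 R))
    (Theta : set (g2 R -> R)) (A : g2 R -> g2 R) : Prop :=
  exists q : g2 R -> g2 R -> R,
    [/\ is_inner_product (m_Theta K Theta) q,
        is_invariant (K_Theta K Theta) (m_Theta K Theta) q &
        forall X Y, m_Theta K Theta X -> m_Theta K Theta Y ->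
          q X Y = ip (A X) Y].

Definition is_basis (R : realType) n (m : set (g2 R)) (B : n.-tuple (g2 R)) :
    Prop :=
  free B /\ (forall X, m X <-> X \in <<B>>%VS).

Definition is_orthonormal (R : realType) n (B : n.-tuple (g2 R)) : Prop :=
  forall i j : 'I_n, ip (tnth B i) (tnth B j) = (i == j)%:R.

Definition has_matrix (R : realType) n (A : g2 R -> g2 R)
    (B : n.-tuple (g2 R)) (M : 'M[R]_n) : Prop :=
  forall j, A (tnth B j) = \sum_i M i j *: tnth B i.

Definition mx_of_rows (R : realType) n (s : seq (seq R)) : 'M[R]_n :=
  \matrix_(i, j) nth 0 (nth [::] s i) j.

(* The Gram-Schmidt process applied to the X_i and the Y_i for a coefficient
   kappa gives W_i = X_i / 2 and Z_i = (Y_i -/+ (kappa / 2) X_j) / nu with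
   nu = sqrt (4 + kappa^2). For kappa = 4/3, nu is 2 sqrt(13) / 3 and these are
   the expressions printed in the source. *)
Definition nu (R : realType) : R := Num.sqrt (4 + kappa R ^+ 2).

Definition W1 (R : realType) : g2 R := 2^-1 *: X1 R.
Definition W2 (R : realType) : g2 R := 2^-1 *: X2 R.
Definition W3 (R : realType) : g2 R := 2^-1 *: X3 R.
Definition Z1 (R : realType) : g2 R :=
  (nu R)^-1 *: (Yk R i1 - (kappa R / 2) *: X3 R).
Definition Z2 (R : realType) : g2 R :=
  (nu R)^-1 *: (Yk R i2 + (kappa R / 2) *: X2 R).
Definition Z3 (R : realType) : g2 R :=
  (nu R)^-1 *: (Yk R i3 - (kappa R / 2) *: X1 R).

Definition basis_empty (R : realType) : 6.-tuple (g2 R) :=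
  [tuple W1 R; Z3 R; W2 R; Z2 R; W3 R; Z1 R].

Definition basis_alpha1 (R : realType) : 5.-tuple (g2 R) :=
  [tuple Z3 R; W2 R; W3 R; Z2 R; - Z1 R].

(* The first vector spans the orthogonal complement of Y_2 in span{W_2, Z_2};
   for kappa = 4/3 it is (sqrt(13) W_2 + 2 Z_2) / sqrt(17). *)
Definition basis_alpha2 (R : realType) : 5.-tuple (g2 R) :=
  [tuple (Num.sqrt (nu R ^+ 2 + kappa R ^+ 2))^-1
           *: (nu R *: W2 R + kappa R *: Z2 R);
         (Num.sqrt 2)^-1 *: (W1 R + Z3 R);
         (Num.sqrt 2)^-1 *: (W3 R + Z1 R);
         (Num.sqrt 2)^-1 *: (W1 R - Z3 R);
         (Num.sqrt 2)^-1 *: (W3 R - Z1 R)].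

(* Main.v *)
(** Conjugating exp(t ad X) by an automorphism and differentiating in t identifies the Lie algebra
    of K_Theta with the intersection of k and p_Theta, hence determines m_Theta.

    For the zero pattern of a metric operator, invariance of the inner product under a few explicit
    elements of K_Theta suffices: the half turns exp(pi ad X_1) and exp(pi ad X_2), which act by
    signs, the quarter turn exp(pi/2 ad X_1) for Theta = {alpha_1}, and exp(t ad Y_2) for
    Theta = {alpha_2}, which rotates the two planes W_1 + Z_3, W_3 + Z_1 and W_1 - Z_3, W_3 - Z_1
    with speeds in the ratio 3 : 1.

    Conversely every element a of K_Theta is an automorphism of the Lie algebra that preserves k,
    p_Theta, the Killing form of k and the form beta, a multiple of the Killing form of g2.
    For Theta = {alpha_2} this forces a Y_2 = +- Y_2, so that a commutes with (ad Y_2)^2, of which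
    the metric operators are polynomials on m_Theta. In the other cases a also preserves the
    intersection of k with the larger parabolic { Z | [Z, n] <= p_Theta }, where n is the nilradical
    of p_Theta; this determines a on X_1, Y_1 and Y_2 up to a few parameters, and the brackets
    determine it on the rest of k. *)
From HB Require Import structures.
Require Import Defs.
From mathcomp Require Import all_boot all_order all_algebra.
From mathcomp Require Import all_classical all_reals all_analysis.
From mathcomp Require Import ring lra.
Set Implicit Arguments. Unset Strict Implicit. Unset Printing Implicit Defensive.
Import Order.TTheory GRing.Theory Num.Theory.
Import numFieldNormedType.Exports.
Local Open Scope classical_set_scope.
Local Open Scope ring_scope.


(** The matrix shapes are instances of Schur's lemma. For Theta empty, [K_Theta] acts by three sign
    characters, each on one of the planes (W_1, Z_3), (W_2, Z_2), (W_3, Z_1), whence the 2x2 blocks.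
    For {alpha_1} there are the line of Z_3 and two copies of one plane, (W_2, W_3) and (Z_2, -Z_1),
    whence the scalar blocks. For {alpha_2} the line and the two planes are pairwise inequivalent,
    whence the diagonal matrix.

    The obstacle is that K_Theta is not connected, and has Lie algebra 0 for Theta empty, so
    invariance does not reduce to brackets. An element of K_Theta is only known as a product of
    exponentials that lies in K and preserves p_Theta; hence the search for subspaces and forms that
    every such element must preserve. The Killing form of k and beta are independent on k because k
    has two simple ideals.

    Exponentials are limits in a space given only with a topology, so the analysis is carried out on
    the scalar power series obtained by applying a linear functional. *)

Lemma I3P (P : 'I_3 -> Prop) : P i1 -> P i2 -> P i3 -> forall i, P i.
Proof.
move=> P1 P2 P3 i; have : i \in [:: i1; i2; i3].
  by rewrite !inE -!val_eqE /= !inordK //; case: i => [[|[|[|]]]].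
by rewrite !inE => /or3P[] /eqP->.
Qed.

Lemma i12 : (i1 == i2) = false. Proof. by rewrite -val_eqE /= !inordK. Qed.
Lemma i13 : (i1 == i3) = false. Proof. by rewrite -val_eqE /= !inordK. Qed.
Lemma i23 : (i2 == i3) = false. Proof. by rewrite -val_eqE /= !inordK. Qed.
Lemma i21 : (i2 == i1) = false. Proof. by rewrite eq_sym i12. Qed.
Lemma i31 : (i3 == i1) = false. Proof. by rewrite eq_sym i13. Qed.
Lemma i32 : (i3 == i2) = false. Proof. by rewrite eq_sym i23. Qed.
Definition i3E := (i12, i13, i23, i21, i31, i32, eqxx).

Lemma sum3 (V : nmodType) (F : 'I_3 -> V) : \sum_i F i = F i1 + (F i2 + F i3).
Proof.
rewrite !big_ord_recl big_ord0 addr0.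
by congr (F _ + (F _ + F _)); apply: val_inj; rewrite /= !inordK.
Qed.

(** * Linear coordinates on g2, and 3x3 determinants *)

Section Coordinates.
Variable R : realType.
Implicit Types x y : g2 R.

Definition ent i j x : R := sl3_mx x.1.1 i j.
Definition vec i x : R := x.1.2 i ord0.
Definition cov i x : R := x.2 ord0 i.

Fact ent_linear i j : linear (ent i j : g2 R -> R^o).
Proof.
move=> a x y; rewrite /ent /sl3_mx.
rewrite (_ : vsval (a *: x + y).1.1 = a *: vsval x.1.1 + vsval y.1.1)?mxE //.
Qed.
Fact vec_linear i : linear (vec i : g2 R -> R^o).
Proof. by move=> a x y; rewrite /vec /= !mxE. Qed.
Fact cov_linear i : linear (cov i : g2 R -> R^o).
Proof. by move=> a x y; rewrite /cov /= !mxE. Qed.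
HB.instance Definition _ i j := GRing.isLinear.Build R (g2 R) R^o *:%R (ent i j) (ent_linear i j).
HB.instance Definition _ i := GRing.isLinear.Build R (g2 R) R^o *:%R (vec i) (vec_linear i).
HB.instance Definition _ i := GRing.isLinear.Build R (g2 R) R^o *:%R (cov i) (cov_linear i).

Lemma g2P x y : (forall i j, ent i j x = ent i j y) -> (forall i, vec i x = vec i y) ->
  (forall i, cov i x = cov i y) -> x = y.
Proof.
case: x y => [[X v] a] [[Y w] b] /= he hv hc; congr (_, _, _).
- by apply: val_inj; apply/matrixP => i j; exact: he.
- by apply/colP => i; exact: hv.
- by apply/rowP => i; exact: hc.
Qed.

Lemma sl3_vsP (M : 'M[R]_3) : (M \in sl3_vs R) = (\tr M == 0).
Proof. by rewrite memv_ker lfunE. Qed.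

Lemma trmx3 (M : 'M[R]_3) : \tr M = M i1 i1 + (M i2 i2 + M i3 i3).
Proof. by rewrite /mxtrace sum3. Qed.

Lemma ent33 x : ent i3 i3 x = - ent i1 i1 x - ent i2 i2 x.
Proof.
have : sl3_mx x.1.1 \in sl3_vs R by exact: subvsP.
rewrite sl3_vsP trmx3 -/(ent _ _ x) -/(ent _ _ x) -/(ent _ _ x) => /eqP h.
by lra.
Qed.

Lemma to_sl3K (M : 'M[R]_3) : \tr M = 0 -> sl3_mx (to_sl3 M) = M.
Proof. by move=> h; rewrite /sl3_mx /to_sl3 vsprojK // sl3_vsP h. Qed.

Lemma bracketE x y : bracket x y =
  (to_sl3 (sl3_mx x.1.1 *m sl3_mx y.1.1 - sl3_mx y.1.1 *m sl3_mx x.1.1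
     + (x.1.2 *m y.2 - (3^-1 * (y.2 *m x.1.2) ord0 ord0)%:M)
     - (y.1.2 *m x.2 - (3^-1 * (x.2 *m y.1.2) ord0 ord0)%:M)),
   sl3_mx x.1.1 *m y.1.2 - sl3_mx y.1.1 *m x.1.2 + kappa R *: wedgeS x.2 y.2,
   - (y.2 *m sl3_mx x.1.1) + x.2 *m sl3_mx y.1.1 - kappa R *: wedgeT x.1.2 y.1.2).
Proof. by case: x y => [[X v] a] [[Y w] b]. Qed.

Definition dual x y : R := \sum_k cov k x * vec k y.

Lemma ent_bracket i j x y : ent i j (bracket x y) =
  \sum_k (ent i k x * ent k j y - ent i k y * ent k j x)
  + (vec i x * cov j y - 3^-1 * dual y x *+ (i == j))
  - (vec i y * cov j x - 3^-1 * dual x y *+ (i == j)).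
Proof.
have trs (u : 'cV[R]_3) (b : 'rV[R]_3) :
    \tr (u *m b - (3^-1 * (b *m u) ord0 ord0)%:M) = 0.
  rewrite raddfB /= mxtrace_mulC mxtrace_scalar [\tr (b *m u)]/mxtrace big_ord1.
  by set t := fun_of_matrix _ _ _; field.
rewrite /ent bracketE to_sl3K; last first.
  by rewrite raddfB /= mxtraceD !trs raddfB /= (mxtrace_mulC (sl3_mx x.1.1)); ring.
rewrite !mxE /= !big_ord1 sumrB /ent /dual; congr (_ - _ + (_ - _ * _ *+ _) - (_ - _ * _ *+ _)).
Qed.

Lemma det3 (M : 'M[R]_3) : \det M =
  M i1 i1 * (M i2 i2 * M i3 i3 - M i2 i3 * M i3 i2)
  - M i1 i2 * (M i2 i1 * M i3 i3 - M i2 i3 * M i3 i1)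
  + M i1 i3 * (M i2 i1 * M i3 i2 - M i2 i2 * M i3 i1).
Proof.
(* The minors are indexed by iterated lifts; as a function of natural numbers, M lets these indices
   compute. *)
pose m (a b : nat) := M (inord a) (inord b).
have mE i j : M i j = m i j by rewrite /m !inord_val.
rewrite (expand_det_row _ ord0) !big_ord_recl big_ord0 /cofactor.
rewrite !(expand_det_row _ ord0) !big_ord_recl !big_ord0 /cofactor !det_mx11 !mxE.
rewrite !mE /bump /= !inordK // !add0n ?addn0 ?add1n /=; ring.
Qed.

Lemma rmx3 (u v w : 'cV[R]_3) (i : 'I_3) :
  let M := row_mx u (row_mx v w) : 'M[R]_3 in
  (M i i1 = u i ord0) * (M i i2 = v i ord0) * (M i i3 = w i ord0).
Proof.
have h1 : i1 = lshift 2 (ord0 : 'I_1) by apply: val_inj; rewrite /= !inordK.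
have h2 : i2 = rshift 1 (lshift 1 (ord0 : 'I_1)) by apply: val_inj; rewrite /= !inordK.
have h3 : i3 = rshift 1 (rshift 1 (ord0 : 'I_1)) by apply: val_inj; rewrite /= !inordK.
rewrite /= h1 h2 h3; split; first split.
- exact: row_mxEl.
- by rewrite (@row_mxEr _ 3 1 2) (@row_mxEl _ 3 1 1).
- by rewrite (@row_mxEr _ 3 1 2) (@row_mxEr _ 3 1 1).
Qed.

Lemma cmx3 (u v w : 'rV[R]_3) (i : 'I_3) :
  let M := col_mx u (col_mx v w) : 'M[R]_3 in
  (M i1 i = u ord0 i) * (M i2 i = v ord0 i) * (M i3 i = w ord0 i).
Proof.
have h1 : i1 = lshift 2 (ord0 : 'I_1) by apply: val_inj; rewrite /= !inordK.
have h2 : i2 = rshift 1 (lshift 1 (ord0 : 'I_1)) by apply: val_inj; rewrite /= !inordK.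
have h3 : i3 = rshift 1 (rshift 1 (ord0 : 'I_1)) by apply: val_inj; rewrite /= !inordK.
rewrite /= h1 h2 h3; split; first split.
- exact: col_mxEu.
- by rewrite (@col_mxEd _ 1 2 3) (@col_mxEu _ 1 1 3).
- by rewrite (@col_mxEd _ 1 2 3) (@col_mxEd _ 1 1 3).
Qed.

Let wS (a b : 'rV[R]_3) :
  (wedgeS a b i1 ord0 = a ord0 i2 * b ord0 i3 - a ord0 i3 * b ord0 i2) *
  (wedgeS a b i2 ord0 = a ord0 i3 * b ord0 i1 - a ord0 i1 * b ord0 i3) *
  (wedgeS a b i3 ord0 = a ord0 i1 * b ord0 i2 - a ord0 i2 * b ord0 i1).
Proof.
have E i : wedgeS a b i ord0 = a ord0 i1 * (b ord0 i2 * (i == i3)%:R - b ord0 i3 * (i == i2)%:R)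
    - a ord0 i2 * (b ord0 i1 * (i == i3)%:R - b ord0 i3 * (i == i1)%:R)
    + a ord0 i3 * (b ord0 i1 * (i == i2)%:R - b ord0 i2 * (i == i1)%:R).
  by rewrite mxE det3 !cmx3 !mxE !eqxx /= !(eq_sym i).
by rewrite !E !i3E /=; split; first split; ring.
Qed.

Let wT (u v : 'cV[R]_3) :
  (wedgeT u v ord0 i1 = u i2 ord0 * v i3 ord0 - u i3 ord0 * v i2 ord0) *
  (wedgeT u v ord0 i2 = u i3 ord0 * v i1 ord0 - u i1 ord0 * v i3 ord0) *
  (wedgeT u v ord0 i3 = u i1 ord0 * v i2 ord0 - u i2 ord0 * v i1 ord0).
Proof.
have E j : wedgeT u v ord0 j = u i1 ord0 * (v i2 ord0 * (j == i3)%:R - v i3 ord0 * (j == i2)%:R)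
    - u i2 ord0 * (v i1 ord0 * (j == i3)%:R - v i3 ord0 * (j == i1)%:R)
    + u i3 ord0 * (v i1 ord0 * (j == i2)%:R - v i2 ord0 * (j == i1)%:R).
  rewrite mxE det3 !rmx3 !mxE !eqxx !andbT !(eq_sym j).
  by case: (i1 == j); case: (i2 == j); case: (i3 == j) => /=; ring.
by rewrite !E !i3E /=; split; first split; ring.
Qed.

Lemma vec_bracket i x y : vec i (bracket x y) =
  \sum_k (ent i k x * vec k y - ent i k y * vec k x)
  + kappa R * wedgeS x.2 y.2 i ord0.
Proof. by rewrite /vec bracketE !mxE sumrB. Qed.

Lemma cov_bracket j x y : cov j (bracket x y) =
  \sum_k (cov k x * ent k j y - cov k y * ent k j x)
  - kappa R * wedgeT x.1.2 y.1.2 ord0 j.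
Proof. by rewrite /cov bracketE !mxE sumrB; congr (_ - _); rewrite addrC. Qed.

Lemma dualE x y : dual x y = cov i1 x * vec i1 y + cov i2 x * vec i2 y + cov i3 x * vec i3 y.
Proof. by rewrite /dual sum3 addrA. Qed.

Lemma coord_bracket x y :
  ((ent i1 i1 (bracket x y) = (ent i1 i2 x * ent i2 i1 y - ent i1 i2 y * ent i2 i1 x)
    + (ent i1 i3 x * ent i3 i1 y - ent i1 i3 y * ent i3 i1 x)
    + vec i1 x * cov i1 y - vec i1 y * cov i1 x
    - 3^-1 * (dual y x - dual x y))
  * (ent i1 i2 (bracket x y) = (ent i1 i1 x * ent i1 i2 y - ent i1 i1 y * ent i1 i2 x)
    + (ent i1 i2 x * ent i2 i2 y - ent i1 i2 y * ent i2 i2 x)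
    + (ent i1 i3 x * ent i3 i2 y - ent i1 i3 y * ent i3 i2 x)
    + vec i1 x * cov i2 y - vec i1 y * cov i2 x)
  * (ent i1 i3 (bracket x y) = (ent i1 i1 x * ent i1 i3 y - ent i1 i1 y * ent i1 i3 x)
    + (ent i1 i2 x * ent i2 i3 y - ent i1 i2 y * ent i2 i3 x)
    + (ent i1 i3 x * ent i3 i3 y - ent i1 i3 y * ent i3 i3 x)
    + vec i1 x * cov i3 y - vec i1 y * cov i3 x)
  * (ent i2 i1 (bracket x y) = (ent i2 i1 x * ent i1 i1 y - ent i2 i1 y * ent i1 i1 x)
    + (ent i2 i2 x * ent i2 i1 y - ent i2 i2 y * ent i2 i1 x)
    + (ent i2 i3 x * ent i3 i1 y - ent i2 i3 y * ent i3 i1 x)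
    + vec i2 x * cov i1 y - vec i2 y * cov i1 x)
  * (ent i2 i2 (bracket x y) = (ent i2 i1 x * ent i1 i2 y - ent i2 i1 y * ent i1 i2 x)
    + (ent i2 i3 x * ent i3 i2 y - ent i2 i3 y * ent i3 i2 x)
    + vec i2 x * cov i2 y - vec i2 y * cov i2 x
    - 3^-1 * (dual y x - dual x y))
  * (ent i2 i3 (bracket x y) = (ent i2 i1 x * ent i1 i3 y - ent i2 i1 y * ent i1 i3 x)
    + (ent i2 i2 x * ent i2 i3 y - ent i2 i2 y * ent i2 i3 x)
    + (ent i2 i3 x * ent i3 i3 y - ent i2 i3 y * ent i3 i3 x)
    + vec i2 x * cov i3 y - vec i2 y * cov i3 x)
  * (ent i3 i1 (bracket x y) = (ent i3 i1 x * ent i1 i1 y - ent i3 i1 y * ent i1 i1 x)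
    + (ent i3 i2 x * ent i2 i1 y - ent i3 i2 y * ent i2 i1 x)
    + (ent i3 i3 x * ent i3 i1 y - ent i3 i3 y * ent i3 i1 x)
    + vec i3 x * cov i1 y - vec i3 y * cov i1 x)
  * (ent i3 i2 (bracket x y) = (ent i3 i1 x * ent i1 i2 y - ent i3 i1 y * ent i1 i2 x)
    + (ent i3 i2 x * ent i2 i2 y - ent i3 i2 y * ent i2 i2 x)
    + (ent i3 i3 x * ent i3 i2 y - ent i3 i3 y * ent i3 i2 x)
    + vec i3 x * cov i2 y - vec i3 y * cov i2 x)
  * (vec i1 (bracket x y) = (ent i1 i1 x * vec i1 y - ent i1 i1 y * vec i1 x)
    + (ent i1 i2 x * vec i2 y - ent i1 i2 y * vec i2 x)
    + (ent i1 i3 x * vec i3 y - ent i1 i3 y * vec i3 x)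
    + kappa R * (cov i2 x * cov i3 y - cov i3 x * cov i2 y))
  * (vec i2 (bracket x y) = (ent i2 i1 x * vec i1 y - ent i2 i1 y * vec i1 x)
    + (ent i2 i2 x * vec i2 y - ent i2 i2 y * vec i2 x)
    + (ent i2 i3 x * vec i3 y - ent i2 i3 y * vec i3 x)
    + kappa R * (cov i3 x * cov i1 y - cov i1 x * cov i3 y))
  * (vec i3 (bracket x y) = (ent i3 i1 x * vec i1 y - ent i3 i1 y * vec i1 x)
    + (ent i3 i2 x * vec i2 y - ent i3 i2 y * vec i2 x)
    + (ent i3 i3 x * vec i3 y - ent i3 i3 y * vec i3 x)
    + kappa R * (cov i1 x * cov i2 y - cov i2 x * cov i1 y))
  * (cov i1 (bracket x y) = (cov i1 x * ent i1 i1 y - cov i1 y * ent i1 i1 x)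
    + (cov i2 x * ent i2 i1 y - cov i2 y * ent i2 i1 x)
    + (cov i3 x * ent i3 i1 y - cov i3 y * ent i3 i1 x)
    - kappa R * (vec i2 x * vec i3 y - vec i3 x * vec i2 y))
  * (cov i2 (bracket x y) = (cov i1 x * ent i1 i2 y - cov i1 y * ent i1 i2 x)
    + (cov i2 x * ent i2 i2 y - cov i2 y * ent i2 i2 x)
    + (cov i3 x * ent i3 i2 y - cov i3 y * ent i3 i2 x)
    - kappa R * (vec i3 x * vec i1 y - vec i1 x * vec i3 y))
  * (cov i3 (bracket x y) = (cov i1 x * ent i1 i3 y - cov i1 y * ent i1 i3 x)
    + (cov i2 x * ent i2 i3 y - cov i2 y * ent i2 i3 x)
    + (cov i3 x * ent i3 i3 y - cov i3 y * ent i3 i3 x)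
    - kappa R * (vec i1 x * vec i2 y - vec i2 x * vec i1 y))).
Proof.
do !split; rewrite ?ent_bracket ?vec_bracket ?cov_bracket ?wS ?wT ?dualE !sum3 ?i3E
  ?mulr0n ?mulr1n -?/(vec _ _) -?/(cov _ _); ring.
Qed.


End Coordinates.

(** * Exponential series of an endomorphism *)

Section ExpSeries.
Variables (R : realType) (V : vectType R) (f : {linear V -> V}).
Implicit Types (l : {linear V -> R^o}) (y : V) (t : R).

(** The Taylor coefficients at 0 of the scalar function t -> l (exp (t f) y). *)
Definition exp_coord (l : V -> R) y n : R := n`!%:R^-1 * l (iter n f y).

Let b := vbasis {:V}.
Let N y : R := \sum_i `|coord b i y|.

Let expand y : y = \sum_(i < \dim {:V}) coord b i y *: b`_i.
Proof. exact/coord_vbasis/memvf. Qed.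

Let l_le l y : `|l y| <= (\sum_(i < \dim {:V}) `|l b`_i|) * N y.
Proof.
rewrite {1}(expand y) linear_sum /= mulr_sumr.
apply: le_trans (ler_norm_sum _ _ _) _; apply: ler_sum => i _.
rewrite linearZ /= normrM mulrC ler_wpM2r // (bigD1 i) //= lerDl.
exact: sumr_ge0.
Qed.

Let C : R := \sum_(i < \dim {:V}) \sum_(j < \dim {:V}) `|coord b i (f b`_j)|.

Let C_ge0 : 0 <= C. Proof. by apply: sumr_ge0 => i _; apply: sumr_ge0. Qed.

Let N_f y : N (f y) <= C * N y.
Proof.
rewrite /C mulr_suml; apply: ler_sum => i _.
exact: (l_le (coord b i \o f : {linear V -> R^o})).
Qed.

Let N_iter n y : N (iter n f y) <= C ^+ n * N y.
Proof.
elim: n => [|n IH]; first by rewrite expr0 mul1r.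
by apply: le_trans (N_f _) _; rewrite exprS -mulrA ler_wpM2l.
Qed.

(** For the l^1 norm [N] of the coordinates, f has operator norm at most [C], so the terms are
    dominated by a constant times those of exp (C |t|). *)
Lemma is_cvg_exp_coord l y t : cvgn (pseries (exp_coord l y) t).
Proof.
pose A := (\sum_(i < \dim {:V}) `|l b`_i|) * N y.
have A_ge0 : 0 <= A by rewrite mulr_ge0 // sumr_ge0.
apply: normed_cvg.
apply: (@series_le_cvg _ _ (A *: exp_coeff (C * `|t|))) => [n|n|n|].
- exact: normr_ge0.
- by rewrite /= mulr_ge0 // mulr_ge0 ?invr_ge0 // exprn_ge0 // mulr_ge0.
- rewrite /= /exp_coord !normrM normfV normr_nat normrX.
  have := le_trans (l_le l (iter n f y))
    (ler_wpM2l (sumr_ge0 _ (fun i _ => normr_ge0 _)) (N_iter n y)).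
  move=> h.
  rewrite [leRHS](_ : _ = n`!%:R^-1 * ((\sum_(i < \dim {:V}) `|l b`_i|)
      * (C ^+ n * N y)) * `|t| ^+ n); last first.
    by rewrite /A /exp_coeff /= fctE /GRing.scale /= exprMn; ring.
  by rewrite ler_wpM2r ?exprn_ge0 // ler_wpM2l ?invr_ge0.
- exact/is_cvg_seriesZ/is_cvg_series_exp_coeff.
Qed.

(** Termwise differentiation shifts the coefficients: the factor n + 1 cancels in the factorial, and
    the extra application of f moves onto y. *)
Lemma is_derive_exp_coord l y t :
  is_derive t (1 : R) (fun t => limn (pseries (exp_coord l y) t))
    (limn (pseries (exp_coord l (f y)) t)).
Proof.
have E z : pseries_diffs (exp_coord l z) = exp_coord l (f z).
  apply/funext => n; rewrite /pseries_diffs /exp_coord mulrA -iterSr.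
  by rewrite factS natrM invfM mulrA divff ?mul1r // pnatr_eq0.
rewrite -E; apply: (@pseries_snd_diffs _ _ (`|t| + 1)); rewrite ?E.
- exact: is_cvg_exp_coord.
- exact: is_cvg_exp_coord.
- exact: is_cvg_exp_coord.
- by rewrite [ltRHS]ger0_norm ?addr_ge0 // ltrDl.
Qed.

Lemma exp_coord0 l y : limn (pseries (exp_coord l y) 0) = l y.
Proof.
apply/cvg_lim => //; apply/cvg_ballP => e e0; near=> n.
(* The partial sum of index 0 is empty, so the constant term is present only from n = 1 on. *)
have n0 : (0 < n)%N by near: n; exists 1%N.
rewrite /pseries /series /= -(prednK n0) big_mkord big_ord_recl big1 => [|i _].
  by rewrite addr0 expr0 mulr1 /exp_coord fact0 invr1 mul1r; exact: ballxx.
by rewrite /= expr0n mulr0.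
Unshelve. all: by end_near.
Qed.

End ExpSeries.

(** * Coordinatewise convergence in g2 *)

Section Convergence.
Variable R : realType.

Lemma cvg_mx m n (u : nat -> 'M[R]_(m, n)) (M : 'M[R]_(m, n)) :
  (forall i j, (fun k => u k i j) @ \oo --> M i j) -> u @ \oo --> M.
Proof.
move=> h A [P MP sPA].
have : \forall k \near \oo, forall ij : 'I_m * 'I_n, P ij.1 ij.2 (u k ij.1 ij.2).
  by apply: filter_forall => -[i j]; exact: h.
by apply: filterS => k hk; apply: sPA => i j; exact: (hk (i, j)).
Qed.

Lemma cvg_sl3 (u : nat -> sl3 R) (X : sl3 R) :
  (fun k => sl3_mx (u k)) @ \oo --> sl3_mx X -> u @ \oo --> X.
Proof.
move=> h A /= [_ [[B Bop <-] BX sBA]].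
have hB : \forall k \near \oo, B (sl3_mx (u k)) := h B (open_nbhs_nbhs (conj Bop BX)).
suff : \forall k \near \oo, A (u k) by [].
by apply: filterS hB => k; exact: sBA.
Qed.

Lemma cvg_g2 (u : nat -> g2 R) (x : g2 R) :
  (forall i j, (fun k => ent i j (u k)) @ \oo --> ent i j x) ->
  (forall i, (fun k => vec i (u k)) @ \oo --> vec i x) ->
  (forall i, (fun k => cov i (u k)) @ \oo --> cov i x) -> u @ \oo --> x.
Proof.
move=> he hv hc; case: x he hv hc => [[X v] a] he hv hc.
have hX : (fun k => (u k).1.1) @ \oo --> X by apply: cvg_sl3; apply: cvg_mx.
have hV : (fun k => (u k).1.2) @ \oo --> v.
  by apply: cvg_mx => i j; rewrite (ord1 j); exact: hv.
have hA : (fun k => (u k).2) @ \oo --> a.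
  by apply: cvg_mx => i j; rewrite (ord1 i); exact: hc.
rewrite (_ : u = fun k => ((u k).1.1, (u k).1.2, (u k).2)); last first.
  by apply/funext => k; case: (u k) => [[]].
have hXV : (fun k => ((u k).1.1, (u k).1.2)) @ \oo --> (X, v).
  exact: (cvg_pair hX hV).
exact: (cvg_pair hXV hA).
Qed.

Lemma ent_cont i j : continuous (@ent R i j).
Proof.
move=> x; apply: (@continuous_comp _ _ _ (fun x : g2 R => sl3_mx x.1.1) (fun M : 'M[R]_3 => M i j));
  last exact: coord_continuous.
apply: (@continuous_comp _ _ _ (fun x : g2 R => x.1.1) (@sl3_mx R)).
  by apply: (@continuous_comp _ _ _ fst fst); [exact: cvg_fst|exact: cvg_fst].
exact: initial_continuous.
Qed.

Lemma vec_cont i : continuous (@vec R i).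
Proof.
move=> x; apply: (@continuous_comp _ _ _ (fun x : g2 R => x.1.2) (fun M : 'cV[R]_3 => M i ord0));
  last exact: coord_continuous.
by apply: (@continuous_comp _ _ _ fst snd); [exact: cvg_fst|exact: cvg_snd].
Qed.

Lemma cov_cont i : continuous (@cov R i).
Proof.
move=> x; apply: (@continuous_comp _ _ _ (fun x : g2 R => x.2) (fun M : 'rV[R]_3 => M ord0 i));
  last exact: coord_continuous.
exact: cvg_snd.
Qed.

(** [lim] picks some limit, and no separation property of g2 is at hand; uniqueness is recovered
    from the continuity of the coordinates, whose values lie in the Hausdorff space R. *)
Lemma lim_g2 (u : nat -> g2 R) (x : g2 R) :
  (forall i j, (fun k => ent i j (u k)) @ \oo --> ent i j x) ->
  (forall i, (fun k => vec i (u k)) @ \oo --> vec i x) ->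
  (forall i, (fun k => cov i (u k)) @ \oo --> cov i x) -> lim (u @ \oo) = x.
Proof.
move=> he hv hc.
have ux : u @ \oo --> lim (u @ \oo) by apply/cvg_ex; exists x; exact: cvg_g2.
apply: g2P => [i j|i|i].
- rewrite -(cvg_lim (@Rhausdorff R) (he i j)); apply/esym/cvg_lim => //.
  exact: (continuous_cvg _ (@ent_cont i j _) ux).
- rewrite -(cvg_lim (@Rhausdorff R) (hv i)); apply/esym/cvg_lim => //.
  exact: (continuous_cvg _ (@vec_cont i _) ux).
- rewrite -(cvg_lim (@Rhausdorff R) (hc i)); apply/esym/cvg_lim => //.
  exact: (continuous_cvg _ (@cov_cont i _) ux).
Qed.

End Convergence.

(** * The bracket in coordinates *)

Section Bracket.
Variable R : realType.
Implicit Types (x y z : g2 R) (t : R).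

Lemma coordD x y :
  (forall i j, ent i j (x + y) = ent i j x + ent i j y) *
  (forall i, vec i (x + y) = vec i x + vec i y) *
  (forall i, cov i (x + y) = cov i x + cov i y).
Proof. by do !split=> *; rewrite raddfD. Qed.

Lemma coordB x y :
  (forall i j, ent i j (x - y) = ent i j x - ent i j y) *
  (forall i, vec i (x - y) = vec i x - vec i y) *
  (forall i, cov i (x - y) = cov i x - cov i y).
Proof. by do !split=> *; rewrite raddfB. Qed.

Lemma coordN x :
  (forall i j, ent i j (- x) = - ent i j x) *
  (forall i, vec i (- x) = - vec i x) *
  (forall i, cov i (- x) = - cov i x).
Proof. by do !split=> *; rewrite raddfN. Qed.

Lemma coordZ (c : R) x :
  (forall i j, ent i j (c *: x) = c * ent i j x) *
  (forall i, vec i (c *: x) = c * vec i x) *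
  (forall i, cov i (c *: x) = c * cov i x).
Proof. by do !split=> *; rewrite linearZ. Qed.

Lemma coord0 :
  (forall i j, ent i j (0 : g2 R) = 0) * (forall i, vec i (0 : g2 R) = 0) *
  (forall i, cov i (0 : g2 R) = 0).
Proof. by do !split=> *; rewrite raddf0. Qed.

Definition coordL := (coordD, coordB, coordN, coordZ, coord0).
Definition coordE := (coordL, coord_bracket, ent33, dualE).

Lemma g2_eq x y :
  ent i1 i1 x = ent i1 i1 y -> ent i1 i2 x = ent i1 i2 y -> ent i1 i3 x = ent i1 i3 y ->
  ent i2 i1 x = ent i2 i1 y -> ent i2 i2 x = ent i2 i2 y -> ent i2 i3 x = ent i2 i3 y ->
  ent i3 i1 x = ent i3 i1 y -> ent i3 i2 x = ent i3 i2 y ->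
  vec i1 x = vec i1 y -> vec i2 x = vec i2 y -> vec i3 x = vec i3 y ->
  cov i1 x = cov i1 y -> cov i2 x = cov i2 y -> cov i3 x = cov i3 y -> x = y.
Proof.
move=> *; apply: g2P; [|exact: I3P|exact: I3P].
by apply: I3P; apply: I3P; rewrite // !ent33; congr (- _ - _).
Qed.

Fact bracket_linear x : linear (bracket x).
Proof.
by move=> c y z; apply: g2_eq; rewrite coordD coordZ !coord_bracket ?ent33 ?dualE !coordL; ring.
Qed.
HB.instance Definition _ x :=
  GRing.isLinear.Build R (g2 R) (g2 R) *:%R (bracket x) (bracket_linear x).

Lemma bracketC x y : bracket x y = - bracket y x.
Proof. by apply: g2_eq; rewrite !coordE; ring. Qed.

Lemma bracketDl x y z : bracket (x + y) z = bracket x z + bracket y z.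
Proof. by rewrite !(bracketC _ z) raddfD opprD. Qed.

Lemma bracketZl (c : R) x z : bracket (c *: x) z = c *: bracket x z.
Proof. by rewrite !(bracketC _ z) linearZ scalerN. Qed.

Lemma kappa2 : kappa R ^+ 2 = 4 / 3.
Proof. by rewrite /kappa sqr_sqrtr // divr_ge0. Qed.

Lemma jacobi x y z :
  bracket x (bracket y z) = bracket (bracket x y) z + bracket y (bracket x z).
Proof.
(* As a rational multiple of a square root r of 3, kappa satisfies a relation with integer
   coefficients, [r ^+ 2 = 3], modulo which [field] can normalize. The coordinates are then
   generalized to plain variables. *)
pose r := 3 / 2 * kappa R; have kE : kappa R = 2 / 3 * r by rewrite /r; field.
have r2 : r ^+ 2 = 3 by rewrite /r exprMn kappa2; field.
apply: g2_eq; rewrite coordD !coord_bracket ?ent33 ?dualE ?coord_bracket ?ent33 ?dualE ?kE;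
  move: r r2 {kE} => r r2; move:
    (ent i1 i1 x) (ent i1 i2 x) (ent i1 i3 x) (ent i2 i1 x) (ent i2 i2 x)
    (ent i2 i3 x) (ent i3 i1 x) (ent i3 i2 x) (vec i1 x) (vec i2 x)
    (vec i3 x) (cov i1 x) (cov i2 x) (cov i3 x)
    (ent i1 i1 y) (ent i1 i2 y) (ent i1 i3 y) (ent i2 i1 y) (ent i2 i2 y)
    (ent i2 i3 y) (ent i3 i1 y) (ent i3 i2 y) (vec i1 y) (vec i2 y)
    (vec i3 y) (cov i1 y) (cov i2 y) (cov i3 y)
    (ent i1 i1 z) (ent i1 i2 z) (ent i1 i3 z) (ent i2 i1 z) (ent i2 i2 z)
    (ent i2 i3 z) (ent i3 i1 z) (ent i3 i2 z) (vec i1 z) (vec i2 z)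
    (vec i3 z) (cov i1 z) (cov i2 z) (cov i3 z) => *; by field: r2.
Qed.

(** The trace form of sl(3) plus the pairing of vectors with covectors, taken in both orders. Its
    invariance is a polynomial identity in the coordinates, which spares computing traces on the
    14-dimensional algebra. *)
Definition beta x y : R :=
  \sum_i \sum_j ent i j x * ent j i y + dual x y + dual y x.

Lemma betaE x y : beta x y =
  ent i1 i1 x * ent i1 i1 y + ent i2 i2 x * ent i2 i2 y
  + (ent i1 i1 x + ent i2 i2 x) * (ent i1 i1 y + ent i2 i2 y)
  + ent i1 i2 x * ent i2 i1 y + ent i2 i1 x * ent i1 i2 y
  + ent i1 i3 x * ent i3 i1 y + ent i3 i1 x * ent i1 i3 y
  + ent i2 i3 x * ent i3 i2 y + ent i3 i2 x * ent i2 i3 y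
  + (vec i1 x * cov i1 y + vec i2 x * cov i2 y + vec i3 x * cov i3 y)
  + (cov i1 x * vec i1 y + cov i2 x * vec i2 y + cov i3 x * vec i3 y).
Proof. by rewrite /beta !sum3 !dualE !ent33; ring. Qed.

Lemma betaC x y : beta x y = beta y x.
Proof. by rewrite !betaE; ring. Qed.

Lemma beta_bracket x y z : beta (bracket x y) z + beta y (bracket x z) = 0.
Proof. by rewrite !betaE !coord_bracket !ent33 !dualE; field. Qed.

Fact beta_linear x : linear (beta x : g2 R -> R^o).
Proof. by move=> c y z; rewrite /GRing.scale /= !betaE !coordE; ring. Qed.
HB.instance Definition _ x :=
  GRing.isLinear.Build R (g2 R) R^o *:%R (beta x) (beta_linear x).

End Bracket.

(** * The one-parameter groups exp(t ad X) *)

Section ExpAd.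

(* Conversion tests that unfold the limit or the bracket do not terminate in practice. *)
#[local] Opaque exp_ad.
Variable R : realType.
Implicit Types (X x y z : g2 R) (t : R) (l : {linear g2 R -> R^o}).

Lemma iter_bracketZ X t n y : iter n (bracket (t *: X)) y = t ^+ n *: iter n (bracket X) y.
Proof.
elim: n => [|n IH]; first by rewrite expr0 scale1r.
by rewrite !iterS IH bracketZl linearZ scalerA exprS.
Qed.


Lemma lin_series X l y t n :
  l (series (fun n => n`!%:R^-1 *: iter n (bracket (t *: X)) y) n)
    = pseries (exp_coord (bracket X) l y) t n.
Proof.
rewrite /pseries /series /= linear_sum; apply: eq_bigr => i _.
rewrite iter_bracketZ !linearZ /exp_coord -mulrA; congr (_ * _); exact: mulrC.
Qed.

(** The vector [x0] is assembled from the limits of the scalar series of the basis coordinates.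
    Finite expansion shows that every functional of the partial sums converges to its value at [x0];
    applied to the matrix, vector and covector entries, this identifies [x0] with the limit in
    g2. *)
Lemma exp_adE X t l y :
  l (exp_ad (t *: X) y) = limn (pseries (exp_coord (bracket X) l y) t).
Proof.
pose b := vbasis {:g2 R}.
pose x0 := \sum_i limn (pseries (exp_coord (bracket X) (coord b i) y) t) *: b`_i.
have cvgl l' : pseries (exp_coord (bracket X) l' y) t @ \oo --> l' x0.
  rewrite linear_sum (_ : pseries _ _ = fun n => \sum_(i < \dim {:g2 R})
      pseries (exp_coord (bracket X) (coord b i) y) t n * l' b`_i); last first.
    apply/funext => n; rewrite -lin_series {1}(coord_vbasis (memvf (series _ n))) linear_sum.
    by apply: eq_bigr => i _; rewrite linearZ -lin_series.
  apply: cvg_big => [|i _]; first exact: add_continuous.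
  by rewrite linearZ; apply: cvgMr_tmp; exact: is_cvg_exp_coord.
have -> : exp_ad (t *: X) y = x0.
  apply: lim_g2 => *; under eq_fun do rewrite lin_series; exact: cvgl.
exact/esym/cvg_lim.
Qed.

Lemma lin_ext x y : (forall l, l x = l y) -> x = y.
Proof. by move=> h; apply: g2P => *; exact: h. Qed.

Lemma exp_ad0 X y : exp_ad (0 *: X) y = y.
Proof. by apply: lin_ext => l; rewrite exp_adE exp_coord0. Qed.

Fact exp_ad_linear X : linear (exp_ad X).
Proof.
move=> c y z; apply: lin_ext => l; rewrite linearP -[X]scale1r !exp_adE.
apply/cvg_lim => //.
rewrite (_ : pseries _ _ = fun n => c * pseries (exp_coord (bracket X) l y) 1 n
    + pseries (exp_coord (bracket X) l z) 1 n); last first.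
  apply/funext => n; rewrite /pseries /series /= mulr_sumr -big_split; apply: eq_bigr => i _.
  rewrite /exp_coord /=.
  have -> : iter i (bracket X) (c *: y + z) = c *: iter i (bracket X) y + iter i (bracket X) z.
    by elim: i => //= i ->; rewrite linearP.
  have E (a u v : R) : a * (c * u + v) * 1 ^+ i = c * (a * u * 1 ^+ i) + a * v * 1 ^+ i by ring.
  by rewrite linearP; exact: E.
by apply: cvgD; [apply: cvgMl_tmp|]; exact: is_cvg_exp_coord.
Qed.
HB.instance Definition _ X :=
  GRing.isLinear.Build R (g2 R) (g2 R) *:%R (exp_ad X) (exp_ad_linear X).

(** Weak derivative, tested against all linear functionals: it requires no normed structure on g2,
    and in finite dimension it is the usual one. *)
Definition is_curve_derive (z : R -> g2 R) t (dz : g2 R) : Prop :=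
  forall l, is_derive t (1 : R) (fun s => l (z s)) (l dz).

Lemma is_derive_exp_ad X y t :
  is_curve_derive (fun s => exp_ad (s *: X) y) t (exp_ad (t *: X) (bracket X y)).
Proof.
move=> l; have E1 := exp_adE X t l (bracket X y).
have E2 : (fun s => l (exp_ad (s *: X) y)) = fun s => limn (pseries (exp_coord (bracket X) l y) s).
  by apply/funext => s; exact: exp_adE.
by have := is_derive_exp_coord (bracket X) l y t; rewrite -E2 -E1.
Qed.

Lemma exp_ad_bracket X y t : exp_ad (t *: X) (bracket X y) = bracket X (exp_ad (t *: X) y).
Proof.
apply: lin_ext => l; rewrite (exp_adE X t l).
apply: etrans (esym (exp_adE X t (l \o bracket X : {linear g2 R -> R^o}) y)).
by congr (limn (pseries _ _)); apply/funext => n; rewrite /exp_coord -iterSr.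
Qed.

Lemma is_derive_mul (f g : R -> R) t (df dg : R) :
  is_derive t (1 : R) f df -> is_derive t (1 : R) g dg ->
  is_derive t (1 : R) (fun s => f s * g s) (df * g t + f t * dg).
Proof.
move=> hf hg; have h : is_derive t 1 (f * g) (f t *: dg + g t *: df) by exact: is_deriveM.
have E : df * g t + f t * dg = f t *: dg + g t *: df by rewrite addrC [df * _]mulrC.
by rewrite E; exact: h.
Qed.

Lemma is_derive_bigsum n (f : 'I_n -> R -> R) t (df : 'I_n -> R) :
  (forall i, is_derive t (1 : R) (f i) (df i)) ->
  is_derive t (1 : R) (fun s => \sum_i f i s) (\sum_i df i).
Proof.
by move=> hf; have := is_derive_sum hf; congr is_derive; apply/funext => s; rewrite fct_sumE.
Qed.

Let b := vbasis {:g2 R}.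

Let expand y : y = \sum_(i < \dim {:g2 R}) coord b i y *: b`_i.
Proof. exact/coord_vbasis/memvf. Qed.

(* The derivative of exp(- t ad X) (z t) vanishes. *)
Lemma exp_ad_curve X (z : R -> g2 R) :
  (forall t, is_curve_derive z t (bracket X (z t))) ->
  forall t, z t = exp_ad (t *: X) (z 0).
Proof.
move=> hz.
have key (w : R -> g2 R) : (forall t, is_curve_derive w t (bracket X (w t))) ->
    forall t, exp_ad ((- t) *: X) (w t) = w 0.
  move=> hw t; apply: lin_ext => l; pose g (s : R) : R := l (exp_ad ((- s) *: X) (w s)).
  suff /(@is_derive_0_is_cst R g t 0) : forall s : R, is_derive s (1 : R) g 0.
    by rewrite /g oppr0 exp_ad0.
  move=> {}t.
  (* Here s occurs both in the exponential and in its argument; expanding [w s] in a basis leaves a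
     finite sum of products of scalar functions. *)
  have -> : g = fun s =>
      \sum_(i < \dim {:g2 R}) coord b i (w s) * l (exp_ad ((- s) *: X) b`_i).
    apply/funext => s; rewrite /g [w s in LHS]expand !linear_sum.
    by apply: eq_bigr => i _; rewrite !linearZ.
  have Z : \sum_(i < \dim {:g2 R})
      (coord b i (bracket X (w t)) * l (exp_ad ((- t) *: X) b`_i)
       + coord b i (w t) * - l (exp_ad ((- t) *: X) (bracket X b`_i))) = 0.
    rewrite big_split /=.
    have -> : \sum_(i < \dim {:g2 R}) coord b i (bracket X (w t)) * l (exp_ad ((- t) *: X) b`_i)
        = l (exp_ad ((- t) *: X) (bracket X (w t))).
      rewrite [in RHS](expand (bracket X (w t))) !linear_sum.
      by apply: eq_bigr => i _; rewrite !linearZ.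
    rewrite [in X in X + _](expand (w t)) !linear_sum -big_split big1 // => i _.
    by rewrite !linearZ /= mulrN subrr.
  rewrite -[X in is_derive _ _ _ X]Z.
  apply: (@is_derive_bigsum _ (fun i s => coord b i (w s) * l (exp_ad ((- s) *: X) b`_i)) t
    (fun i => coord b i (bracket X (w t)) * l (exp_ad ((- t) *: X) b`_i)
      + coord b i (w t) * - l (exp_ad ((- t) *: X) (bracket X b`_i)))) => i.
  apply: (@is_derive_mul _ (fun s => l (exp_ad ((- s) *: X) b`_i))); first exact: hw.
  have h := is_derive_exp_ad X b`_i (- t) l.
  by have := is_derive1_comp h (is_deriveNid t 1); rewrite /GRing.scale /= mulrN1.
(* The exponential curve itself solves the equation, so [key] at - t gives the inverse. *)
have invE y t : exp_ad (t *: X) (exp_ad ((- t) *: X) y) = y.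
  have := key (fun s => exp_ad (s *: X) y) _ (- t); rewrite opprK exp_ad0; apply.
  by move=> s; rewrite -exp_ad_bracket; exact: is_derive_exp_ad.
by move=> t; rewrite -(key z hz t) invE.
Qed.

Lemma exp_adK X : cancel (exp_ad (- X)) (exp_ad X).
Proof.
(* This solution takes the value exp (- ad X) y at 0 and y at 1. *)
move=> y; pose z s := exp_ad ((s - 1) *: X) y.
have hz t : is_curve_derive z t (bracket X (z t)).
  rewrite /z -(exp_ad_bracket X y) => l.
  have h := @is_derive_exp_ad X y (t - 1) l.
  have hs : is_derive t (1 : R) (fun s => s - 1 : R) 1.
    by have := is_derive_shift t 1 (-1 : R).
  have := @is_derive1_comp R (fun r => l (exp_ad (r *: X) y)) (fun s => s - 1) t _ 1 h hs.
  by rewrite mulr1.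
have := exp_ad_curve hz 1; rewrite /z subrr exp_ad0 sub0r scaleN1r scale1r.
exact: esym.
Qed.

Lemma is_curve_derive_bilin (B : g2 R -> {linear g2 R -> R^o}) (u v : R -> g2 R) t du dv :
  (forall (c : R) x y z, B (c *: x + y) z = c * B x z + B y z) ->
  is_curve_derive u t du -> is_curve_derive v t dv ->
  is_derive t (1 : R) (fun s => B (u s) (v s)) (B du (v t) + B (u t) dv).
Proof.
move=> BP hu hv.
have E x z : B x z = \sum_(i < \dim {:g2 R}) coord b i x * B b`_i z.
  rewrite [x in LHS](expand x); elim/big_rec2 : _ => [|i u' w' _ <-].
    by have := BP (-1) 0 0 z; rewrite scaler0 addr0 mulN1r addNr.
  by rewrite BP.
have -> : (fun s => B (u s) (v s)) =
    fun s => \sum_(i < \dim {:g2 R}) coord b i (u s) * B b`_i (v s).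
  by apply/funext => s; exact: E.
rewrite (E du) (E (u t)) -big_split /=.
by apply: is_derive_bigsum => i; apply: is_derive_mul; [exact: hu|exact: hv].
Qed.

(** By the Jacobi identity the bracket of two solutions of z' = [X, z] is again a solution, hence is
    determined by its value at 0. *)
Lemma exp_ad_morph X y z : exp_ad X (bracket y z) = bracket (exp_ad X y) (exp_ad X z).
Proof.
pose w t := bracket (exp_ad (t *: X) y) (exp_ad (t *: X) z).
have h t : is_curve_derive w t (bracket X (w t)).
  rewrite /w jacobi -(exp_ad_bracket X y) -(exp_ad_bracket X z) => l; rewrite raddfD.
  apply: (@is_curve_derive_bilin (fun x => l \o bracket x : {linear g2 R -> R^o})).
  - move=> c x x' x''.
    change (l (bracket (c *: x + x') x'') = c * l (bracket x x'') + l (bracket x' x'')).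
    by rewrite bracketDl bracketZl linearP.
  - exact: is_derive_exp_ad.
  - exact: is_derive_exp_ad.
have := exp_ad_curve h 1; rewrite /w !exp_ad0 !scale1r => ->.
by [].
Qed.

Lemma exp_ad_beta X y z : beta (exp_ad X y) (exp_ad X z) = beta y z.
Proof.
pose w (t : R) : R := beta (exp_ad (t *: X) y) (exp_ad (t *: X) z).
suff /(@is_derive_0_is_cst R w 1 0) : forall s : R, is_derive s (1 : R) w 0.
  by rewrite /w !exp_ad0 !scale1r.
move=> t; rewrite -(beta_bracket X (exp_ad (t *: X) y) (exp_ad (t *: X) z)).
rewrite -(exp_ad_bracket X y) -(exp_ad_bracket X z).
apply: (@is_curve_derive_bilin (fun x => beta x : {linear g2 R -> R^o})).
- move=> c x x' x''; change (beta (c *: x + x') x'' = c * beta x x'' + beta x' x'').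
  by rewrite !(betaC _ x'') linearP.
- exact: is_derive_exp_ad.
- exact: is_derive_exp_ad.
Qed.

(** The right-hand side solves z' = [X, z] with value u at t = 0. All the explicit group elements
    below are computed this way. *)
Lemma exp_ad_rot X u v (c t : R) : bracket X u = c *: v -> bracket X v = - c *: u ->
  exp_ad (t *: X) u = cos (c * t) *: u + sin (c * t) *: v.
Proof.
move=> hu hv; pose z s := cos (c * s) *: u + sin (c * s) *: v.
have z0 : u = z 0 by rewrite /z mulr0 cos0 sin0 scale1r scale0r addr0.
have hm s : is_derive s (1 : R) (fun s => c * s) c.
  have := is_derive_mul (is_derive_cst c s 1) (is_derive_id s (1 : R)).
  by rewrite mul0r add0r mulr1.
have hc s : is_derive s (1 : R) (fun s => cos (c * s)) (- sin (c * s) * c).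
  exact: (@is_derive1_comp R cos (fun s => c * s) s _ c (is_derive_cos _) (hm s)).
have hs s : is_derive s (1 : R) (fun s => sin (c * s)) (cos (c * s) * c).
  exact: (@is_derive1_comp R sin (fun s => c * s) s _ c (is_derive_sin _) (hm s)).
have hz s : is_curve_derive z s (bracket X (z s)).
  move=> l.
  have -> : (fun s => l (z s)) = (fun s => cos (c * s) * l u) \+ (fun s => sin (c * s) * l v).
    by apply/funext => r; rewrite /z linearD !linearZ.
  have -> : l (bracket X (z s)) = (- sin (c * s) * c) * l u + cos (c * s) * 0
      + ((cos (c * s) * c) * l v + sin (c * s) * 0).
    rewrite !mulr0 !addr0 /z [bracket X _]linearD !linearZ /= hu hv !scalerA.
    rewrite linearD !linearZ /= addrC.
    by rewrite mulrN mulNr.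
  by apply: is_deriveD; apply: is_derive_mul => //; exact: is_derive_cst.
by rewrite [X in exp_ad _ X]z0 -(exp_ad_curve hz).
Qed.

End ExpAd.

(** * The compact subalgebra k and its Killing form *)

#[local] Opaque exp_ad bracket.

Section Elements.
Variable R : realType.
Implicit Types (Z : g2 R) (x y c : R).

Definition mk (e11 e12 e13 e21 e22 e23 e31 e32 a1 a2 a3 b1 b2 b3 : R) : g2 R :=
  (to_sl3 (\matrix_(i, j) nth 0 (nth [::] [:: [:: e11; e12; e13]; [:: e21; e22; e23];
      [:: e31; e32; - e11 - e22]] i) j),
   \col_i nth 0 [:: a1; a2; a3] i, \row_i nth 0 [:: b1; b2; b3] i).

Lemma coord_mk e11 e12 e13 e21 e22 e23 e31 e32 a1 a2 a3 b1 b2 b3 :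
  let x := mk e11 e12 e13 e21 e22 e23 e31 e32 a1 a2 a3 b1 b2 b3 in
  (ent i1 i1 x = e11) * (ent i1 i2 x = e12) * (ent i1 i3 x = e13) *
  (ent i2 i1 x = e21) * (ent i2 i2 x = e22) * (ent i2 i3 x = e23) *
  (ent i3 i1 x = e31) * (ent i3 i2 x = e32) *
  (vec i1 x = a1) * (vec i2 x = a2) * (vec i3 x = a3) *
  (cov i1 x = b1) * (cov i2 x = b2) * (cov i3 x = b3).
Proof.
rewrite /ent /vec /cov /mk /= to_sl3K; last first.
  by rewrite trmx3 !mxE /= !inordK //=; ring.
by do !split; rewrite !mxE /= !inordK.
Qed.

Lemma mkZ c e11 e12 e13 e21 e22 e23 e31 e32 a1 a2 a3 b1 b2 b3 :
  c *: mk e11 e12 e13 e21 e22 e23 e31 e32 a1 a2 a3 b1 b2 b3 =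
  mk (c * e11) (c * e12) (c * e13) (c * e21) (c * e22) (c * e23) (c * e31) (c * e32)
    (c * a1) (c * a2) (c * a3) (c * b1) (c * b2) (c * b3).
Proof. by apply: g2_eq; rewrite coordZ !coord_mk. Qed.

#[local] Opaque mk.

(* x1 X_1 + x2 X_2 + x3 X_3 + y1 Y_1 + y2 Y_2 + y3 Y_3 *)
Definition kvec (x1 x2 x3 y1 y2 y3 : R) : g2 R :=
  mk 0 (- x1) (- x2) x1 0 (- x3) x2 x3 y1 y2 y3 (- y1) (- y2) (- y3).

Lemma coord_kvec x1 x2 x3 y1 y2 y3 :
  let x := kvec x1 x2 x3 y1 y2 y3 in
  (ent i1 i1 x = 0) * (ent i1 i2 x = - x1) * (ent i1 i3 x = - x2) *
  (ent i2 i1 x = x1) * (ent i2 i2 x = 0) * (ent i2 i3 x = - x3) *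
  (ent i3 i1 x = x2) * (ent i3 i2 x = x3) *
  (vec i1 x = y1) * (vec i2 x = y2) * (vec i3 x = y3) *
  (cov i1 x = - y1) * (cov i2 x = - y2) * (cov i3 x = - y3).
Proof. by rewrite /kvec /= !coord_mk; do !split. Qed.

#[local] Opaque kvec.

Lemma kvecD x1 x2 x3 y1 y2 y3 x1' x2' x3' y1' y2' y3' :
  kvec x1 x2 x3 y1 y2 y3 + kvec x1' x2' x3' y1' y2' y3'
  = kvec (x1 + x1') (x2 + x2') (x3 + x3') (y1 + y1') (y2 + y2') (y3 + y3').
Proof. by apply: g2_eq; rewrite coordL !coord_kvec ?opprD ?addr0. Qed.

Lemma kvecZ c x1 x2 x3 y1 y2 y3 :
  c *: kvec x1 x2 x3 y1 y2 y3 = kvec (c * x1) (c * x2) (c * x3) (c * y1) (c * y2) (c * y3).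
Proof. by apply: g2_eq; rewrite coordL !coord_kvec ?mulrN ?mulr0. Qed.

Lemma kvecN x1 x2 x3 y1 y2 y3 :
  - kvec x1 x2 x3 y1 y2 y3 = kvec (- x1) (- x2) (- x3) (- y1) (- y2) (- y3).
Proof. by apply: g2_eq; rewrite coordL !coord_kvec ?oppr0. Qed.

Lemma bracket_kvec x1 x2 x3 y1 y2 y3 x1' x2' x3' y1' y2' y3' :
  bracket (kvec x1 x2 x3 y1 y2 y3) (kvec x1' x2' x3' y1' y2' y3') =
  kvec (x2 * x3' - x3 * x2' + (y1 * y2' - y2 * y1'))
    (- (x1 * x3' - x3 * x1') + (y1 * y3' - y3 * y1'))
    (x1 * x2' - x2 * x1' + (y2 * y3' - y3 * y2'))
    (- (x1 * y2' - y2 * x1') - (x2 * y3' - y3 * x2') + kappa R * (y2 * y3' - y3 * y2'))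
    (x1 * y1' - y1 * x1' - (x3 * y3' - y3 * x3') - kappa R * (y1 * y3' - y3 * y1'))
    (x2 * y1' - y1 * x2' + (x3 * y2' - y2 * x3') + kappa R * (y1 * y2' - y2 * y1')).
Proof.
by apply: g2_eq; rewrite coord_bracket ?ent33 ?dualE !coord_kvec; ring.
Qed.

Lemma kvec0 : kvec 0 0 0 0 0 0 = 0.
Proof. by apply: g2_eq; rewrite coord_kvec coordL ?oppr0. Qed.

Let ent_gl (M : 'M[R]_3) i j : M i1 i1 + (M i2 i2 + M i3 i3) = 0 -> ent i j (gl_part M) = M i j.
Proof. by move=> h; rewrite /ent /= to_sl3K // trmx3. Qed.
Let vec_gl (M : 'M[R]_3) i : vec i (gl_part M) = 0. Proof. by rewrite /vec mxE. Qed.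
Let cov_gl (M : 'M[R]_3) i : cov i (gl_part M) = 0. Proof. by rewrite /cov mxE. Qed.

Lemma X1E : X1 R = kvec 1 0 0 0 0 0.
Proof.
by apply: g2_eq; rewrite coord_kvec ?ent_gl ?vec_gl ?cov_gl ?mxE ?i3E /= ?mulr0n ?mulr1n
  ?subr0 ?sub0r ?oppr0 ?addr0 ?add0r.
Qed.
Lemma X2E : X2 R = kvec 0 1 0 0 0 0.
Proof.
by apply: g2_eq; rewrite coord_kvec ?ent_gl ?vec_gl ?cov_gl ?mxE ?i3E /= ?mulr0n ?mulr1n
  ?subr0 ?sub0r ?oppr0 ?addr0 ?add0r.
Qed.
Lemma X3E : X3 R = kvec 0 0 1 0 0 0.
Proof.
by apply: g2_eq; rewrite coord_kvec ?ent_gl ?vec_gl ?cov_gl ?mxE ?i3E /= ?mulr0n ?mulr1n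
  ?subr0 ?sub0r ?oppr0 ?addr0 ?add0r.
Qed.

Let ent_vp v i j : ent i j (vec_part v : g2 R) = 0.
Proof. exact: (coord0 R).1.1 i j. Qed.
Let cov_vp v i : cov i (vec_part v : g2 R) = 0. Proof. by rewrite /cov mxE. Qed.
Let vec_vp v i : vec i (vec_part v : g2 R) = v i ord0. Proof. by []. Qed.
Let ent_cp v i j : ent i j (cov_part v : g2 R) = 0.
Proof. exact: (coord0 R).1.1 i j. Qed.
Let vec_cp v i : vec i (cov_part v : g2 R) = 0. Proof. by rewrite /vec mxE. Qed.
Let cov_cp v i : cov i (cov_part v : g2 R) = v ord0 i. Proof. by []. Qed.

Lemma YE : (Yk R i1 = kvec 0 0 0 1 0 0) * (Yk R i2 = kvec 0 0 0 0 1 0) *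
  (Yk R i3 = kvec 0 0 0 0 0 1).
Proof.
by do !split; apply: g2_eq; rewrite coord_kvec /Yk !coordL ?ent_vp ?vec_vp ?cov_vp ?ent_cp ?vec_cp
  ?cov_cp ?mxE ?i3E /= ?subr0 ?sub0r ?oppr0.
Qed.

Definition kE := (X1E, X2E, X3E, YE, kvecD, kvecZ, kvecN).

Lemma kvec_frk x1 x2 x3 y1 y2 y3 : kvec x1 x2 x3 y1 y2 y3 \in frk R.
Proof.
have -> : kvec x1 x2 x3 y1 y2 y3 = x1 *: X1 R + (x2 *: X2 R + (x3 *: X3 R
    + (y1 *: Yk R i1 + (y2 *: Yk R i2 + y3 *: Yk R i3)))).
  by rewrite !kE; congr kvec; ring.
have m k : (k < 6)%N -> nth 0 [:: X1 R; X2 R; X3 R; Yk R i1; Yk R i2; Yk R i3] k \in frk R.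
  by move=> hk; apply/memv_span/mem_nth.
apply: memvD (memvZ _ (m 0 isT)) _; apply: memvD (memvZ _ (m 1 isT)) _.
apply: memvD (memvZ _ (m 2 isT)) _; apply: memvD (memvZ _ (m 3 isT)) _.
exact: memvD (memvZ _ (m 4 isT)) (memvZ _ (m 5 isT)).
Qed.

Lemma frkE Z : Z \in frk R -> Z = kvec (ent i2 i1 Z) (ent i3 i1 Z) (ent i3 i2 Z)
  (vec i1 Z) (vec i2 Z) (vec i3 Z).
Proof.
move=> hZ.
have [c ->] : exists c : 'I_6 -> R,
    Z = \sum_i c i *: [:: X1 R; X2 R; X3 R; Yk R i1; Yk R i2; Yk R i3]`_i.
  exists (fun i => coord [tuple X1 R; X2 R; X3 R; Yk R i1; Yk R i2; Yk R i3] i Z).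
  exact: coord_span.
rewrite !big_ord_recl big_ord0 addr0 /= !kE !coord_kvec.
by [].
Qed.

Lemma frk_ind (P : g2 R -> Prop) :
  (forall x1 x2 x3 y1 y2 y3, P (kvec x1 x2 x3 y1 y2 y3)) -> forall Z, Z \in frk R -> P Z.
Proof. by move=> h Z /frkE ->. Qed.

(* The trace is computed from any spanning family with a dual family of functionals. *)
Lemma k_traceE n (f : {linear g2 R -> g2 R}) (b : 'I_n -> g2 R)
    (phi : 'I_n -> {linear g2 R -> R^o}) :
  (forall i, b i \in frk R) -> (forall Z, Z \in frk R -> f Z \in frk R) ->
  (forall Z, Z \in frk R -> Z = \sum_i phi i Z *: b i) ->
  k_trace f = \sum_i phi i (f (b i)).
Proof.
move=> bk fk hb; rewrite /k_trace; set v := vbasis _.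
have vk (j : 'I_(\dim (frk R))) : v`_j \in frk R.
  by rewrite vbasis_mem // mem_nth // size_tuple.
under eq_bigr => j _.
  rewrite (hb _ (vk j)) !linear_sum.
  under eq_bigr do rewrite !linearZ.
  over.
rewrite exchange_big /=; apply: eq_bigr => i _.
rewrite [f (b i) in RHS](coord_vbasis (fk _ (bk i))) linear_sum.
by apply: eq_bigr => j _; rewrite linearZ /= mulrC.
Qed.

Definition kb : 'I_6 -> g2 R := fun i =>
  nth 0 [:: kvec 1 0 0 0 0 0; kvec 0 1 0 0 0 0; kvec 0 0 1 0 0 0;
    kvec 0 0 0 1 0 0; kvec 0 0 0 0 1 0; kvec 0 0 0 0 0 1] i.

Definition kphi : 'I_6 -> {linear g2 R -> R^o} := fun i =>
  nth (ent i1 i1 : {linear g2 R -> R^o}) [:: ent i2 i1 : {linear g2 R -> R^o};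
    ent i3 i1 : {linear g2 R -> R^o}; ent i3 i2 : {linear g2 R -> R^o};
    vec i1 : {linear g2 R -> R^o}; vec i2 : {linear g2 R -> R^o}; vec i3 : {linear g2 R -> R^o}] i.

Lemma kb_frk i : kb i \in frk R.
Proof. by case: i => -[|[|[|[|[|[|n]]]]]] hi; rewrite /kb /= ?kvec_frk. Qed.

Lemma kb_expand Z : Z \in frk R -> Z = \sum_i kphi i Z *: kb i.
Proof.
move: Z; apply: frk_ind => *; rewrite !big_ord_recl big_ord0 addr0 /kb /kphi /= !coord_kvec !kE.
by congr kvec; ring.
Qed.

Lemma bracket_frk X Y : X \in frk R -> Y \in frk R -> bracket X Y \in frk R.
Proof. by move=> /frkE -> /frkE ->; rewrite bracket_kvec kvec_frk. Qed.

Lemma kappa_sqrt3 : exists r : R, kappa R = 2 / 3 * r /\ r ^+ 2 = 3.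
Proof.
exists (3 / 2 * kappa R); split; first by field.
by rewrite exprMn kappa2; field.
Qed.

Lemma ip_kvec x1 x2 x3 y1 y2 y3 x1' x2' x3' y1' y2' y3' :
  ip (kvec x1 x2 x3 y1 y2 y3) (kvec x1' x2' x3' y1' y2' y3') =
  4 * (x1 * x1' + x2 * x2' + x3 * x3') + 20 / 3 * (y1 * y1' + y2 * y2' + y3 * y3')
  + 2 * kappa R * (x1 * y3' + y3 * x1' - x2 * y2' - y2 * x2' + x3 * y1' + y1 * x3').
Proof.
rewrite /ip /killing_k (k_traceE (f := bracket _ \o bracket _) kb_frk _ kb_expand); last first.
  by move=> Z hZ; rewrite !bracket_frk // kvec_frk.
have [r [rE r2]] := kappa_sqrt3.
rewrite !big_ord_recl big_ord0 /kb /kphi /= !bracket_kvec !coord_kvec rE.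
by field: r2.
Qed.

End Elements.

(** * Parabolic subalgebras *)

#[local] Opaque exp_ad bracket mk kvec.

Section Parabolic.
Variable R : realType.
Implicit Types (Z : g2 R) (Theta : set (g2 R -> R)) (q : bool).

(* q1 and q2 tell whether alpha_1 and alpha_2 belong to Theta. *)
Definition in_p q1 q2 Z : Prop :=
  [/\ ent i3 i1 Z = 0, ent i3 i2 Z = 0, vec i3 Z = 0, cov i1 Z = 0 &
      (~~ q1 -> ent i2 i1 Z = 0) /\ (~~ q2 -> cov i2 Z = 0)].

(** [lin_span] quantifies over subspaces, and this is the one to be inserted there to bound p_Theta
    from above. *)
Definition p_vs q1 q2 : {vspace g2 R} :=
  (lker (linfun (ent i3 i1 : g2 R -> R^o)) :&: lker (linfun (ent i3 i2 : g2 R -> R^o))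
   :&: lker (linfun (vec i3 : g2 R -> R^o)) :&: lker (linfun (cov i1 : g2 R -> R^o))
   :&: (if q1 then fullv else lker (linfun (ent i2 i1 : g2 R -> R^o)))
   :&: (if q2 then fullv else lker (linfun (cov i2 : g2 R -> R^o))))%VS.

Lemma in_pP q1 q2 Z : Z \in p_vs q1 q2 <-> in_p q1 q2 Z.
Proof.
rewrite /p_vs /in_p !memv_cap !memv_ker !lfunE /=; split.
  move=> /andP[/andP[/andP[/andP[/andP[/eqP-> /eqP->] /eqP->] /eqP->] h1] h2]; split=> //.
  split=> [/negbTE q|/negbTE q]; [move: h1|move: h2]; by rewrite q memv_ker lfunE => /eqP.
move=> [-> -> -> -> [h1 h2]]; rewrite eqxx /=; apply/andP; split.
  by case: q1 h1 => [_|/(_ isT) e]; rewrite ?memvf // memv_ker lfunE /= e.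
by case: q2 h2 => [_|/(_ isT) e]; rewrite ?memvf // memv_ker lfunE /= e.
Qed.

Definition Hd (h1 h2 : R) : g2 R := mk h1 0 0 0 h2 0 0 0 0 0 0 0 0 0.

Lemma cartanP Z : cartan Z <->
  Z = Hd (ent i1 i1 Z) (ent i2 i2 Z).
Proof.
split=> [[/is_diag_mxP hd hv hc]|->].
  have he i j : i != j -> ent i j Z = 0 by move=> ij; apply: hd.
  apply: g2_eq; rewrite coord_mk // ?he ?i3E //.
  - by rewrite /vec hv mxE.
  - by rewrite /vec hv mxE.
  - by rewrite /vec hv mxE.
  - by rewrite /cov hc mxE.
  - by rewrite /cov hc mxE.
  - by rewrite /cov hc mxE.
split.
- apply/is_diag_mxP => i j; rewrite -/(ent i j _).
  by move: i j; apply: I3P; apply: I3P; rewrite ?eqxx // => _; rewrite coord_mk.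
- by apply/colP; apply: I3P; rewrite -/(vec _ _) coord_mk mxE.
- by apply/rowP; apply: I3P; rewrite -/(cov _ _) coord_mk mxE.
Qed.

Lemma cartan_Hd h1 h2 : cartan (Hd h1 h2).
Proof. by apply/cartanP; rewrite /Hd !coord_mk. Qed.

Lemma bracket_Hd h1 h2 Z : let h3 := - h1 - h2 in bracket (Hd h1 h2) Z =
  mk 0 ((h1 - h2) * ent i1 i2 Z) ((h1 - h3) * ent i1 i3 Z)
    ((h2 - h1) * ent i2 i1 Z) 0 ((h2 - h3) * ent i2 i3 Z)
    ((h3 - h1) * ent i3 i1 Z) ((h3 - h2) * ent i3 i2 Z)
    (h1 * vec i1 Z) (h2 * vec i2 Z) (h3 * vec i3 Z)
    (- h1 * cov i1 Z) (- h2 * cov i2 Z) (- h3 * cov i3 Z).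
Proof. by rewrite /Hd; apply: g2_eq; rewrite coord_bracket ?ent33 ?dualE !coord_mk; ring. Qed.

Lemma lambda_Hd h1 h2 : (lambda i1 (Hd h1 h2) = h1) * (lambda i2 (Hd h1 h2) = h2) *
  (lambda i3 (Hd h1 h2) = - h1 - h2).
Proof. by do !split; rewrite /lambda -/(ent _ _ _) ?ent33 /Hd !coord_mk. Qed.

Lemma root_coord b Z h1 h2 : root_space b Z ->
  let B := b (Hd h1 h2) in let h3 := - h1 - h2 in
  [/\ (h3 - h1 - B) * ent i3 i1 Z = 0, (h3 - h2 - B) * ent i3 i2 Z = 0,
      (h3 - B) * vec i3 Z = 0, (- h1 - B) * cov i1 Z = 0 &
      (h2 - h1 - B) * ent i2 i1 Z = 0 /\ (- h2 - B) * cov i2 Z = 0].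
Proof.
move=> /(_ _ (cartan_Hd h1 h2)); rewrite bracket_Hd => h B h3.
have e (l : {linear g2 R -> R^o}) := congr1 l h.
by split; last split; rewrite mulrBl; apply/eqP; rewrite subr_eq0; apply/eqP;
  [have := e (ent i3 i1)|have := e (ent i3 i2)|have := e (vec i3)|have := e (cov i1)
  |have := e (ent i2 i1)|have := e (cov i2)]; rewrite /= coord_mk coordZ.
Qed.

Lemma pos_root_Hd b h1 h2 : @pos_roots R b -> 0 <= h2 -> h2 <= h1 ->
  0 <= b (Hd h1 h2) /\ (0 < h2 -> h2 < h1 -> 0 < b (Hd h1 h2)).
Proof.
case=> [[i [j [ij ->]]]|[[->|->]|->]] h20 h21; rewrite /=.
- have : [\/ i = i1 /\ j = i2, i = i1 /\ j = i3 | i = i2 /\ j = i3].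
    move: i j ij; apply: I3P; apply: I3P; rewrite /= ?inordK // => _;
    by [apply: Or31|apply: Or32|apply: Or33].
  by move=> [[-> ->]|[-> ->]|[-> ->]]; rewrite !lambda_Hd; split=> *; lra.
- by rewrite !lambda_Hd; split=> *; lra.
- by rewrite !lambda_Hd; split=> *; lra.
- by rewrite !lambda_Hd; split=> *; lra.
Qed.

(** At diag(2, 1, -3) every positive root is positive, whereas ad acts by a negative number on each
    coordinate that has to vanish. *)
Lemma pos_root_in_p b Z : pos_roots b -> root_space b Z -> in_p false false Z.
Proof.
move=> hb hZ; have [_] := pos_root_Hd hb (ltac:(lra) : 0 <= 1) (ltac:(lra) : 1 <= 2).
move=> /(_ ltac:(lra) ltac:(lra)) B0.
have [] := root_coord 2 1 hZ; move: B0; set B := b _ => B0 /= e1 e2 e3 e4 [e5 e6].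
by split; [nra|nra|nra|nra|split=> _; nra].
Qed.

Lemma in_p_le q1 q2 Z : in_p false false Z -> in_p q1 q2 Z.
Proof. by case=> ? ? ? ? [h1 h2]; split=> //; rewrite h1 ?h2. Qed.

Lemma cartan_in_p q1 q2 Z : cartan Z -> in_p q1 q2 Z.
Proof. by move/cartanP->; apply: in_p_le; rewrite /in_p /Hd !coord_mk. Qed.

Lemma root_spaceP b Z : (forall h1 h2, bracket (Hd h1 h2) Z = b (Hd h1 h2) *: Z) ->
  root_space b Z.
Proof. by move=> h H /cartanP ->. Qed.

Lemma pos_piece :
  [/\ forall a, root_space (lambda i1 \- lambda i2) (mk 0 a 0 0 0 0 0 0 0 0 0 0 0 0 : g2 R),
      forall a, root_space (lambda i1 \- lambda i3) (mk 0 0 a 0 0 0 0 0 0 0 0 0 0 0 : g2 R),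
      forall a, root_space (lambda i2 \- lambda i3) (mk 0 0 0 0 0 a 0 0 0 0 0 0 0 0 : g2 R) &
   [/\ forall a, root_space (lambda i1) (mk 0 0 0 0 0 0 0 0 a 0 0 0 0 0 : g2 R),
      forall a, root_space (lambda i2) (mk 0 0 0 0 0 0 0 0 0 a 0 0 0 0 : g2 R) &
      forall a, root_space (\- lambda i3) (mk 0 0 0 0 0 0 0 0 0 0 0 0 0 a : g2 R)]].
Proof.
by split; last split; move=> a; apply: root_spaceP => h1 h2;
  rewrite bracket_Hd !coord_mk /= ?lambda_Hd mkZ; congr mk; ring.
Qed.

Lemma neg_piece :
  (forall a, root_space (lambda i2 \- lambda i1) (mk 0 0 0 a 0 0 0 0 0 0 0 0 0 0 : g2 R)) /\
  (forall a, root_space (\- lambda i2) (mk 0 0 0 0 0 0 0 0 0 0 0 0 a 0 : g2 R)).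
Proof.
by split; move=> a; apply: root_spaceP => h1 h2;
  rewrite bracket_Hd !coord_mk /= ?lambda_Hd mkZ; congr mk; ring.
Qed.

(** Only [neg_span] depends on Theta: its roots must respect [in_p], and it must contain -alpha_1 or
    -alpha_2 when the corresponding coordinate is left free. *)
Lemma p_ThetaP Theta q1 q2 :
  (forall b Z, neg_span Theta b -> root_space b Z -> in_p q1 q2 Z) ->
  (q1 -> neg_span Theta (lambda i2 \- lambda i1)) -> (q2 -> neg_span Theta (\- lambda i2)) ->
  forall Z, p_Theta Theta Z <-> in_p q1 q2 Z.
Proof.
move=> hn hq1 hq2 Z; split.
  move=> /(_ (p_vs q1 q2)) h; apply/in_pP/h => X [[hX|[b hb hX]]|[b hb hX]]; apply/in_pP.
  - exact: cartan_in_p.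
  - by apply: in_p_le; exact: pos_root_in_p hX.
  - exact: hn hX.
move=> [z1 z2 z3 z4 [z5 z6]] U hU.
have pU b X : pos_roots b -> root_space b X -> X \in U.
  by move=> hb hX; apply: hU; left; right; exists b.
have lt (i j : 'I_3) : (i < j)%N -> @pos_roots R (lambda i \- lambda j).
  by move=> ij; left; exists i, j.
have [p1 p2 p3 [p4 p5 p6]] := pos_piece; have [n1 n2] := neg_piece.
have -> : Z = Hd (ent i1 i1 Z) (ent i2 i2 Z)
  + (mk 0 (ent i1 i2 Z) 0 0 0 0 0 0 0 0 0 0 0 0
  + (mk 0 0 (ent i1 i3 Z) 0 0 0 0 0 0 0 0 0 0 0
  + (mk 0 0 0 0 0 (ent i2 i3 Z) 0 0 0 0 0 0 0 0
  + (mk 0 0 0 0 0 0 0 0 (vec i1 Z) 0 0 0 0 0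
  + (mk 0 0 0 0 0 0 0 0 0 (vec i2 Z) 0 0 0 0
  + (mk 0 0 0 0 0 0 0 0 0 0 0 0 0 (cov i3 Z)
  + (mk 0 0 0 (ent i2 i1 Z) 0 0 0 0 0 0 0 0 0 0
  + mk 0 0 0 0 0 0 0 0 0 0 0 0 (cov i2 Z) 0))))))).
  by rewrite /Hd; apply: g2_eq; rewrite !coordD !coord_mk ?z1 ?z2 ?z3 ?z4; ring.
apply: memvD; first by apply: hU; left; left; exact: cartan_Hd.
apply: memvD; first by apply: pU (p1 _); apply: lt; rewrite /= !inordK.
apply: memvD; first by apply: pU (p2 _); apply: lt; rewrite /= !inordK.
apply: memvD; first by apply: pU (p3 _); apply: lt; rewrite /= !inordK.
apply: memvD; first by apply: pU (p4 _); right; left; left.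
apply: memvD; first by apply: pU (p5 _); right; left; right.
apply: memvD; first by apply: pU (p6 _); right; right.
apply: memvD.
  case: (boolP q1) => [/hq1 h|/z5 ->]; first by apply: hU; right; exists (lambda i2 \- lambda i1).
  rewrite (_ : mk _ _ _ _ _ _ _ _ _ _ _ _ _ _ = 0) ?mem0v //.
  by apply: g2_eq; rewrite coord_mk coord0.
case: (boolP q2) => [/hq2 h|/z6 ->]; first by apply: hU; right; exists (\- lambda i2).
rewrite (_ : mk _ _ _ _ _ _ _ _ _ _ _ _ _ _ = 0) ?mem0v //.
by apply: g2_eq; rewrite coord_mk coord0.
Qed.

Lemma neg_span_Hd Theta b : neg_span Theta b -> exists m n : int,
  [/\ m != 0 -> Theta (@alpha1 R), n != 0 -> Theta (@alpha2 R),
     forall h1 h2, b (Hd h1 h2) = m%:~R * (h1 - h2) + n%:~R * h2 & b (Hd 2 1) < 0].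
Proof.
case=> hb [m [n [hm hn hH]]]; exists m, n; split=> //.
  by move=> h1 h2; rewrite (hH _ (cartan_Hd _ _)) /alpha1 /alpha2 /= !lambda_Hd.
have [_] := pos_root_Hd hb (ltac:(lra) : 0 <= 1) (ltac:(lra) : 1 <= 2).
by move=> /(_ ltac:(lra) ltac:(lra)) /=; rewrite oppr_gt0.
Qed.

Lemma alpha_neq : @alpha1 R <> @alpha2 R.
Proof.
move=> e; have := congr1 (fun f : g2 R -> R => f (Hd 1 1)) e.
rewrite /alpha1 /alpha2 /= !lambda_Hd subrr => /eqP.
by rewrite eq_sym oner_eq0.
Qed.

Lemma p_empty Z : p_Theta set0 Z <-> in_p false false Z.
Proof.
apply: p_ThetaP => // b X /neg_span_Hd[m [n [hm hn hH]]].
have /eqP m0 : m == 0 by apply/negPn/negP => /hm.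
have /eqP n0 : n == 0 by apply/negPn/negP => /hn.
by rewrite hH m0 n0 !mul0r addr0 ltxx.
Qed.

Lemma p_alpha1 Z : p_Theta [set @alpha1 R] Z <-> in_p true false Z.
Proof.
apply: p_ThetaP => // [b X /neg_span_Hd[m [n [hm hn hH _]]] hX|_].
  have n0 : n = 0 by apply/eqP/negPn/negP => /hn /= e; exact/alpha_neq/esym.
  (* At diag(1, 1, -2) every multiple of alpha_1 vanishes, while each root whose coordinate must be
     zero does not. *)
  have [] := root_coord 1 1 hX; rewrite hH n0 subrr mulr0 mul0r addr0 => e1 e2 e3 e4 [e5 e6].
  by split; [lra|lra|lra|lra|split=> // _; lra].
split; first by left; exists i1, i2; rewrite /= !inordK //; split=> //; apply/funext => H /=; ring.
exists (-1), 0; split=> // H _; rewrite /alpha1 /alpha2 /=; ring.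
Qed.

Lemma p_alpha2 Z : p_Theta [set @alpha2 R] Z <-> in_p false true Z.
Proof.
apply: p_ThetaP => // [b X /neg_span_Hd[m [n [hm hn hH _]]] hX|_].
  have m0 : m = 0 by apply/eqP/negPn/negP => /hm /=; exact: alpha_neq.
  (* Likewise diag(1, 0, -1) annihilates alpha_2 but none of the roots whose coordinate must be
     zero. *)
  have [] := root_coord 1 0 hX; rewrite hH m0 mulr0 mul0r addr0 => e1 e2 e3 e4 [e5 e6].
  by split; [lra|lra|lra|lra|split=> // _; lra].
split.
  right; left; right; apply/funext => H /=; exact: opprK.
exists 0, (-1); split=> // H _; rewrite /alpha1 /alpha2 /=; ring.
Qed.

End Parabolic.

(** * Inner automorphisms and isotropy groups *)

Section InnerAutomorphisms.
Variable R : realType.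
Implicit Types (X Y Z : g2 R) (a b : g2 R -> g2 R).

Definition is_aut a : Prop :=
  [/\ linear a, forall X Y, a (bracket X Y) = bracket (a X) (a Y) &
      forall X Y, beta (a X) (a Y) = beta X Y].

Lemma G2_aut a : G2 a -> is_aut a.
Proof.
case=> s ->; elim: s => [|X s [l m h]]; first by split.
split=> [c Y Z|Y Z|Y Z] /=.
- by rewrite l linearP.
- by rewrite m exp_ad_morph.
- by rewrite exp_ad_beta h.
Qed.

Lemma exp_ad_eq0 X Y (l : {linear g2 R -> R^o}) :
  (forall t, l (exp_ad (t *: X) Y) = 0) -> l (bracket X Y) = 0.
Proof.
move=> h; have := is_derive_exp_ad X Y 0 l.
rewrite (_ : (fun s => _) = cst 0); last by apply/funext => t; exact: h.
by move=> D; have := @derive_val _ _ _ _ _ _ _ D; rewrite derive_cst exp_ad0 => <-.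
Qed.

Lemma exp_ad_conj a X t Y : is_aut a ->
  exp_ad (t *: a X) (a Y) = a (exp_ad (t *: X) Y).
Proof.
case=> la ma _; pose A : {linear g2 R -> g2 R} :=
  HB.pack a (GRing.isLinear.Build R (g2 R) (g2 R) *:%R a la).
apply: lin_ext => l; rewrite (exp_adE (a X) t l).
apply: etrans (esym (exp_adE X t (l \o A : {linear g2 R -> R^o}) Y)).
congr (limn (pseries _ _)); apply/funext => n; rewrite /exp_coord /=; congr (_ * l _).
by elim: n => //= n ->; rewrite ma.
Qed.

(** The trace of g is taken in the image under a of the basis [kb], with dual functionals [kphi]
    composed with b; it then has the same terms as the trace of f. *)
Lemma trace_aut (f : {linear g2 R -> g2 R}) (g : {linear g2 R -> g2 R}) a b :
  is_aut a -> is_aut b -> cancel a b -> cancel b a ->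
  (forall X, X \in frk R -> a X \in frk R) -> (forall X, X \in frk R -> b X \in frk R) ->
  (forall X, X \in frk R -> f X \in frk R) ->
  (forall X, g (a X) = a (f X)) -> k_trace g = k_trace f.
Proof.
move=> [la _ _] [lb _ _] ab ba ha hb hf hg.
pose A : {linear g2 R -> g2 R} := HB.pack a (GRing.isLinear.Build R (g2 R) (g2 R) *:%R a la).
pose B : {linear g2 R -> g2 R} := HB.pack b (GRing.isLinear.Build R (g2 R) (g2 R) *:%R b lb).
rewrite (k_traceE (@kb_frk R) hf (@kb_expand R)).
rewrite (@k_traceE _ _ g (a \o @kb R) (fun i => kphi R i \o B : {linear g2 R -> R^o})).
- by apply: eq_bigr => i _; rewrite /= hg ab.
- by move=> i; apply: ha; exact: kb_frk.
- by move=> X hX; rewrite -(ba X) hg; apply/ha/hf/hb.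
- move=> X hX; have /(congr1 A) := kb_expand (hb _ hX).
  rewrite linear_sum /= ba => {1}->; apply: eq_bigr => i _.
  by rewrite -[a _]/(A _) linearZ.
Qed.

Lemma ip_aut a b X Y :
  is_aut a -> is_aut b -> cancel a b -> cancel b a ->
  (forall X, X \in frk R -> a X \in frk R) -> (forall X, X \in frk R -> b X \in frk R) ->
  X \in frk R -> Y \in frk R -> ip (a X) (a Y) = ip X Y.
Proof.
move=> ha hb ab ba ka kb hX hY; congr (- _).
apply: (@trace_aut (bracket X \o bracket Y) (bracket (a X) \o bracket (a Y)) a b) => //.
- by move=> Z hZ; rewrite !bracket_frk.
- by move=> Z /=; case: ha => _ m _; rewrite !m.
Qed.

End InnerAutomorphisms.

Section Isotropy.
Variables (R : realType) (K : set (g2 R -> g2 R)).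
Hypothesis hK : is_subgroup K.
Hypothesis hk : forall X : g2 R, lie K X <-> X \in frk R.
Implicit Types (X Y Z : g2 R) (a b : g2 R -> g2 R).

Lemma K_aut a : K a -> is_aut a.
Proof. by case: hK => KG _ _ _ /KG; exact: G2_aut. Qed.

Lemma K_inv a : K a -> exists b, [/\ K b, cancel a b & cancel b a].
Proof.
case: hK => _ _ _ h /h[b Kb [e1 e2]]; exists b; split=> // X.
- exact: (congr1 (fun f => f X) e1).
- exact: (congr1 (fun f => f X) e2).
Qed.

(** K is stable under conjugation, and a exp (t ad X) a^-1 = exp (t ad (a X)). *)
Lemma K_frk a X : K a -> X \in frk R -> a X \in frk R.
Proof.
move=> Ka /hk hX; apply/hk => t; have [b [Kb ab ba]] := K_inv Ka.
have -> : exp_ad (t *: a X) = a \o (exp_ad (t *: X) \o b).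
  by apply/funext => Y /=; rewrite -(exp_ad_conj _ _ _ (K_aut Ka)) ba.
by case: hK => _ _ Kc _; apply: (Kc _ _ Ka); apply: Kc => //; exact: hX.
Qed.

Lemma K_ip a X Y : K a -> X \in frk R -> Y \in frk R -> ip (a X) (a Y) = ip X Y.
Proof.
move=> Ka; have [b [Kb ab ba]] := K_inv Ka.
by apply: (ip_aut (K_aut Ka) (K_aut Kb) ab ba) => Z; exact: K_frk.
Qed.

(** With both negative simple roots allowed, the bracket of epsilon_2 and E_21 would produce
    epsilon_1, which [in_p] excludes. The products [z] are exactly these terms. *)
Lemma in_p_bracket q1 q2 X Y : ~~ (q1 && q2) ->
  in_p q1 q2 X -> in_p q1 q2 Y -> in_p q1 q2 (bracket X Y).
Proof.
move=> q hX hY.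
have z (V W : g2 R) : in_p q1 q2 V -> in_p q1 q2 W -> cov i2 V * ent i2 i1 W = 0.
  move=> [_ _ _ _ [_ v]] [_ _ _ _ [w _]].
  by move: q; rewrite negb_and => /orP[/w ->|/v ->]; rewrite ?mulr0 ?mul0r.
have zXY := z _ _ hX hY; have zYX := z _ _ hY hX.
case: hX hY => x1 x2 x3 x4 [x5 x6] [y1 y2 y3 y4 [y5 y6]]; split;
  last (split=> qF); rewrite coord_bracket ?ent33 ?x1 ?x2 ?x3 ?x4 ?y1 ?y2 ?y3 ?y4 ?zXY ?zYX.
- ring.
- ring.
- ring.
- ring.
- rewrite x5 ?y5 //; ring.
- rewrite x6 ?y6 //; ring.
Qed.

Lemma exp_ad_in_p q1 q2 X t Y : ~~ (q1 && q2) -> in_p q1 q2 X -> in_p q1 q2 Y ->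
  in_p q1 q2 (exp_ad (t *: X) Y).
Proof.
move=> q hX hY.
have it n : in_p q1 q2 (iter n (bracket X) Y) by elim: n => //= n; exact: in_p_bracket.
have lim0 (l : {linear g2 R -> R^o}) : (forall n, l (iter n (bracket X) Y) = 0) ->
    l (exp_ad (t *: X) Y) = 0.
  move=> h; rewrite (exp_adE X t l).
  rewrite (_ : pseries _ _ = fun=> 0); first exact: lim_cst.
  apply/funext => n; rewrite /pseries /series /= big1 // => i _.
  by rewrite /exp_coord h mulr0 mul0r.
split; [apply: (lim0 (ent i3 i1))|apply: (lim0 (ent i3 i2))|apply: (lim0 (vec i3))
  |apply: (lim0 (cov i1))|split=> qF; [apply: (lim0 (ent i2 i1))|apply: (lim0 (cov i2))]];
  by move=> n; case: (it n) => ? ? ? ? [h1 h2]; first [exact: h1|exact: h2|by []].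
Qed.

Section Parabolic.
Variables (q1 q2 : bool) (Theta : set (g2 R -> R)).
Hypothesis q12 : ~~ (q1 && q2).
Hypothesis hTheta : forall Z, p_Theta Theta Z <-> in_p q1 q2 Z.

Lemma K_Theta_in_p a X : K_Theta K Theta a -> in_p q1 q2 X -> in_p q1 q2 (a X).
Proof. by move=> [_ [_ e]] /hTheta hX; apply/hTheta; rewrite -e; exists X. Qed.

Lemma K_Theta_inv a : K_Theta K Theta a ->
  exists b, [/\ K_Theta K Theta b, cancel a b & cancel b a].
Proof.
move=> [Ka [_ e]]; have [b [Kb ab ba]] := K_inv Ka; exists b; split=> //; split=> //; split.
  by case: hK => KG _ _ _; exact: KG.
by rewrite -{1}e image_comp (_ : b \o a = id) ?image_id //; apply/funext => X; exact: ab.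
Qed.

Lemma lieP X : lie (K_Theta K Theta) X <-> X \in frk R /\ in_p q1 q2 X.
Proof.
split=> [hX|[Xk Xp] t].
  have Xk : X \in frk R by apply/hk => t; case: (hX t).
  (* The element H = diag(2, 1, -3) lies in p_Theta, so differentiating at t = 0 kills the excluded
     coordinates of [X, H]. These are the coordinates of X multiplied, up to sign, by the values of
     negative roots at H: -5, -4, -3, -2, -1, -1, all nonzero. *)
  split=> //; have hH t : in_p q1 q2 (exp_ad (t *: X) (Hd 2 1)).
    by apply: K_Theta_in_p => //; apply: cartan_in_p; exact: cartan_Hd.
  have hc (l : {linear g2 R -> R^o}) (c : R) : c < 0 -> l (bracket (Hd 2 1) X) = c * l X :> R ->
      (forall t, l (exp_ad (t *: X) (Hd 2 1)) = 0 :> R) -> l X = 0 :> R.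
    move=> c0 hl /exp_ad_eq0; rewrite bracketC raddfN /= hl => /eqP.
    by rewrite oppr_eq0 mulf_eq0 lt_eqF // => /eqP.
  rewrite /in_p; split; last split=> qF.
  - apply: (hc (ent i3 i1) (- 5)); first by rewrite oppr_lt0 ltr0n.
      by rewrite bracket_Hd /= coord_mk; congr (_ * _); ring.
    by move=> t; case: (hH t).
  - apply: (hc (ent i3 i2) (- 4)); first by rewrite oppr_lt0 ltr0n.
      by rewrite bracket_Hd /= coord_mk; congr (_ * _); ring.
    by move=> t; case: (hH t).
  - apply: (hc (vec i3) (- 3)); first by rewrite oppr_lt0 ltr0n.
      by rewrite bracket_Hd /= coord_mk; congr (_ * _); ring.
    by move=> t; case: (hH t).
  - apply: (hc (cov i1) (- 2)); first by rewrite oppr_lt0 ltr0n.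
      by rewrite bracket_Hd /= coord_mk; congr (_ * _); ring.
    by move=> t; case: (hH t).
  - apply: (hc (ent i2 i1) (- 1)); first by rewrite oppr_lt0 ltr01.
      by rewrite bracket_Hd /= coord_mk; congr (_ * _); ring.
    by move=> t; case: (hH t) => _ _ _ _ [h _]; exact: h.
  - apply: (hc (cov i2) (- 1)); first by rewrite oppr_lt0 ltr01.
      by rewrite bracket_Hd /= coord_mk; congr (_ * _); ring.
    by move=> t; case: (hH t) => _ _ _ _ [_ h]; exact: h.
split; first by move: t; exact/hk.
split; first by exists [:: t *: X].
apply/seteqP; split=> [_ [Y /hTheta hY <-]|Y /hTheta hY]; first exact/hTheta/exp_ad_in_p.
exists (exp_ad (- (t *: X)) Y); last exact: exp_adK.
by rewrite -scaleNr; apply/hTheta/exp_ad_in_p.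
Qed.

Lemma K_Theta_m a X : K_Theta K Theta a -> m_Theta K Theta X -> m_Theta K Theta (a X).
Proof.
move=> Ta [Xk hX]; have [Ka _] := Ta; split; first exact: K_frk.
have [b [Tb ab ba]] := K_Theta_inv Ta.
move=> Y /lieP[Yk Yp]; rewrite -(ba Y) K_ip //; last by case: Tb => Kb _; exact: K_frk.
by apply: hX; apply/lieP; split; [case: Tb => Kb _; exact: K_frk|exact: K_Theta_in_p].
Qed.

End Parabolic.

End Isotropy.

(** * Inner products in an orthonormal basis *)

Section KillingInner.
Variable R : realType.
Implicit Types (X Y Z : g2 R).

Lemma ipC X Y : X \in frk R -> Y \in frk R -> ip X Y = ip Y X.
Proof. by move=> /frkE -> /frkE ->; rewrite !ip_kvec; ring. Qed.

Lemma ip_linl (c : R) X Y Z : X \in frk R -> Y \in frk R -> Z \in frk R ->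
  ip (c *: X + Y) Z = c * ip X Z + ip Y Z.
Proof. by move=> /frkE -> /frkE -> /frkE ->; rewrite !kE !ip_kvec; ring. Qed.

Lemma ip0l Z : Z \in frk R -> ip 0 Z = 0.
Proof.
move=> hZ; have := @ip_linl (-1) 0 0 Z (mem0v _) (mem0v _) hZ.
by rewrite scaler0 addr0 mulN1r addNr.
Qed.

End KillingInner.

Section InvariantForms.
Variables (R : realType) (m : set (g2 R)) (H : set (g2 R -> g2 R)) (q : g2 R -> g2 R -> R).
Hypotheses (m0 : m 0) (m_lin : forall (c : R) X Y, m X -> m Y -> m (c *: X + Y)).
Hypotheses (iq : is_inner_product m q) (inv : is_invariant H m q).

Lemma q_sym X Y : m X -> m Y -> q X Y = q Y X.
Proof. by case: iq => h _ _; exact: h. Qed.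

Lemma qD_l (c d : R) X Y Z : m X -> m Y -> m Z -> q (c *: X + d *: Y) Z = c * q X Z + d * q Y Z.
Proof.
case: iq => _ ql _ mX mY mZ.
have z0 : q 0 Z = 0 by have := ql (-1) _ _ _ m0 m0 mZ; rewrite scaler0 addr0 mulN1r addNr.
have mdY : m (d *: Y) by rewrite -[d *: Y]addr0; exact: m_lin.
by rewrite ql // -[d *: Y]addr0 ql // z0 addr0.
Qed.

Lemma qN_l X Y : m X -> m Y -> q (- X) Y = - q X Y.
Proof.
by move=> mX mY; have := qD_l (-1) 0 mX m0 mY; rewrite scaler0 addr0 scaleN1r mul0r addr0 mulN1r.
Qed.

Lemma qN_r X Y : m X -> m Y -> q X (- Y) = - q X Y.
Proof.
move=> mX mY; have mNY : m (- Y) by rewrite -[- Y]addr0 -scaleN1r; exact: m_lin.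
by rewrite q_sym // qN_l // q_sym.
Qed.

Lemma q_odd a X Y : H a -> m X -> m Y -> a X = X -> a Y = - Y -> q X Y = 0 /\ q Y X = 0.
Proof.
move=> Ha mX mY aX aY; have : q X Y = 0.
  by have := inv Ha mX mY; rewrite aX aY qN_r // => h; lra.
by split=> //; rewrite q_sym.
Qed.

End InvariantForms.

Section OrthonormalBasis.
Variables (R : realType) (m : set (g2 R)) (n : nat) (B : n.-tuple (g2 R)).
Hypotheses (hm : forall X, m X -> X \in frk R) (hB : is_basis m B) (ho : is_orthonormal B).
Implicit Types (X Y Z : g2 R) (A : g2 R -> g2 R) (q : g2 R -> g2 R -> R) (c : 'I_n -> R).

Let m_span X : m X <-> X \in <<B>>%VS. Proof. exact: hB.2. Qed.

Let mB i : m (tnth B i). Proof. by apply/m_span/memv_span/mem_tnth. Qed.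

Let m_lin (c : R) X Y : m X -> m Y -> m (c *: X + Y).
Proof. by move=> /m_span hX /m_span hY; apply/m_span/memvD => //; apply: memvZ. Qed.

Let m0 : m 0. Proof. by apply/m_span; exact: mem0v. Qed.

Let m_sum c : m (\sum_i c i *: tnth B i).
Proof. by apply/m_span/memv_suml => i _; apply/memvZ/m_span. Qed.

Lemma m_expand X : m X -> exists c, X = \sum_i c i *: tnth B i.
Proof.
move=> /m_span /coord_span ->; exists (fun i => coord B i X).
by apply: eq_bigr => i _; rewrite (tnth_nth 0).
Qed.

Lemma lin_on_sum (V : lmodType R) (f : g2 R -> V) c :
  (forall (c : R) X Y, m X -> m Y -> f (c *: X + Y) = c *: f X + f Y) ->
  f (\sum_i c i *: tnth B i) = \sum_i c i *: f (tnth B i).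
Proof.
move=> fl; have f0 : f 0 = 0.
  by have := fl (-1) _ _ m0 m0; rewrite scaler0 addr0 scaleN1r addNr.
pose P X y := m X /\ f X = y.
suff [] : P (\sum_i c i *: tnth B i) (\sum_i c i *: f (tnth B i)) by [].
apply: (big_ind2 P) => [|X x Y y [mX <-] [mY <-]|i _]; first by [].
  rewrite /P -[X in X + Y]scale1r; split; first exact: m_lin.
  by rewrite fl // scale1r.
by rewrite /P -[c i *: tnth B i]addr0; split; [exact: m_lin|rewrite fl // f0 addr0].
Qed.

Lemma ip_sum c j : ip (\sum_i c i *: tnth B i) (tnth B j) = c j.
Proof.
rewrite (@lin_on_sum R^o (fun X => ip X (tnth B j))) => [|a X Y mX mY]; last first.
  by rewrite ip_linl //; apply: hm.
rewrite (bigD1 j) //= ho eqxx /GRing.scale /= mulr1 big1 ?addr0 // => i /negbTE ij.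
by rewrite ho ij mulr0.
Qed.

Section Gram.
Variables (A : g2 R -> g2 R) (q : g2 R -> g2 R -> R).
Hypotheses (hA : is_endo m A) (hq : is_inner_product m q)
  (hqA : forall X Y, m X -> m Y -> q X Y = ip (A X) Y).

Lemma gramC i j : q (tnth B i) (tnth B j) = q (tnth B j) (tnth B i).
Proof. by case: hq => h _ _; exact: h. Qed.

Lemma gram_matrix : has_matrix A B (\matrix_(i, j) q (tnth B i) (tnth B j)).
Proof.
move=> j; have [c e] := m_expand (hA.1 _ (mB j)); rewrite e.
apply: eq_bigr => i _; rewrite mxE gramC hqA // e ip_sum //.
Qed.

Lemma gram_gt0 i : 0 < q (tnth B i) (tnth B i).
Proof.
case: hq => _ _ qp; apply: qp => //; apply/eqP => e.
by have := ho i i; rewrite eqxx e ip0l ?mem0v // => /eqP; rewrite eq_sym oner_eq0.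
Qed.

Lemma gram_lt i j : i != j -> - Num.sqrt (q (tnth B i) (tnth B i) * q (tnth B j) (tnth B j))
    < q (tnth B i) (tnth B j)
    < Num.sqrt (q (tnth B i) (tnth B i) * q (tnth B j) (tnth B j)).
Proof.
move=> ij; have qi := gram_gt0 i; have qj := gram_gt0 j.
rewrite -ltr_norml -sqrtr_sqr ltr_sqrt ?mulr_gt0 //.
set x := q _ _ in qi *; set y := q (tnth B j) _ in qj *; set z := q _ _.
(* Strict Cauchy-Schwarz: q X X = y (x y - z^2), and X is nonzero because its coefficient y is
   positive. *)
pose X := y *: tnth B i + (- z) *: tnth B j.
have mX : m X.
  by rewrite /X -[- z *: _]addr0; apply: (m_lin _ (mB i)); apply: (m_lin _ (mB j)).
have X0 : X != 0.
  apply/eqP => e; pose d k := if k == i then y else if k == j then - z else 0.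
  have dX : \sum_k d k *: tnth B k = X.
    rewrite (bigD1 i) // (bigD1 j) 1?eq_sym //= /d !eqxx [j == i]eq_sym (negbTE ij) big1 => [|k].
      by rewrite addr0.
    by move=> /andP[/negbTE -> /negbTE ->]; rewrite scale0r.
  have := ip_sum d i; rewrite dX e ip0l ?hm // /d eqxx => y0.
  by rewrite -y0 ltxx in qj.
have : 0 < q X X by case: hq => _ _; exact.
have ql Z mZ := qD_l m0 m_lin hq y (- z) (mB i) (mB j) (Z := Z) mZ.
have qs k := q_sym hq (mB k) mX.
rewrite {1}/X ql // !qs {1 2}/X !ql // (gramC j i) -/x -/y -/z.
by nra.
Qed.

End Gram.

(** The form is forced to be ip (A X) Y. Symmetry and positivity are those of M in the orthonormal
    basis; invariance holds because the elements of H preserve ip and commute with A, which needs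
    checking only on the basis. *)
Lemma metric_of_matrix (H : set (g2 R -> g2 R)) A (M : 'M[R]_n) :
  is_endo m A -> has_matrix A B M -> (forall i j, M i j = M j i) ->
  (forall x : 'I_n -> R, (exists i, x i != 0) -> 0 < \sum_i \sum_j x i * M i j * x j) ->
  (forall a, H a -> [/\ linear a, (forall X, m X -> m (a X)),
     (forall X Y, m X -> m Y -> ip (a X) (a Y) = ip X Y) &
     forall j, A (a (tnth B j)) = a (A (tnth B j))]) ->
  exists q, [/\ is_inner_product m q, is_invariant H m q &
    forall X Y, m X -> m Y -> q X Y = ip (A X) Y].
Proof.
move=> [Am Al] hAM Msym Mpos hH; exists (fun X Y => ip (A X) Y).
have ipA c d : ip (A (\sum_i c i *: tnth B i)) (\sum_i d i *: tnth B i) =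
    \sum_i \sum_j c i * M i j * d j.
  rewrite ipC; [|exact: hm (Am _ (m_sum c))|exact: hm (m_sum d)].
  rewrite (@lin_on_sum R^o (fun X => ip X _)) => [|a X Y mX mY]; last first.
    rewrite ip_linl //; [exact: hm|exact: hm|exact: hm (Am _ (m_sum c))].
  rewrite exchange_big; apply: eq_bigr => j _ /=.
  rewrite ipC; [|exact: hm (mB j)|exact: hm (Am _ (m_sum c))].
  have -> : A (\sum_i c i *: tnth B i) = \sum_k (\sum_i c i * M k i) *: tnth B k.
    rewrite (lin_on_sum (f := A)) //; under [RHS]eq_bigr do rewrite scaler_suml.
    rewrite exchange_big; apply: eq_bigr => i _; rewrite hAM scaler_sumr.
    by apply: eq_bigr => k _; rewrite scalerA.
  rewrite ip_sum /GRing.scale /= mulrC mulr_suml.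
  by apply: eq_bigr => i _; rewrite Msym.
split=> //; first split.
- move=> X Y /m_expand[c ->] /m_expand[d ->]; rewrite !ipA exchange_big.
  apply: eq_bigr => i _; apply: eq_bigr => j _; rewrite Msym; ring.
- move=> c X Y Z mX mY mZ; rewrite Al // ip_linl //; apply: hm => //; exact: Am.
- move=> X /m_expand[c ->] X0; rewrite ipA; apply: Mpos.
  apply: contrapT => h; move/eqP: X0; apply; apply: big1 => i _.
  have -> : c i = 0 by apply/eqP/negPn/negP => ci; apply: h; exists i.
  exact: scale0r.
- move=> a X Y /hH[al am aip aA] mX mY.
  suff -> : A (a X) = a (A X) by apply: aip => //; exact: Am.
  have [c ->] := m_expand mX.
  have e1 := @lin_on_sum _ (A \o a) c; have e2 := @lin_on_sum _ (a \o A) c.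
  rewrite /= in e1 e2; rewrite e1 => [|b U V mU mV]; last by rewrite al Al //; exact: am.
  rewrite e2 => [|b U V mU mV]; last by rewrite Al // al.
  by apply: eq_bigr => i _ /=; rewrite aA.
Qed.

End OrthonormalBasis.

(** * Coordinates in the orthonormal basis of k *)

Section OrthonormalCoordinates.
Variable R : realType.
Implicit Types (X Y Z : g2 R).

Lemma orthonormal_basis (m : set (g2 R)) n (B : n.-tuple (g2 R)) :
  is_orthonormal B -> (forall i, tnth B i \in frk R) ->
  (forall c : 'I_n -> R, m (\sum_i c i *: tnth B i)) ->
  (forall X, m X -> exists c : 'I_n -> R, X = \sum_i c i *: tnth B i) -> is_basis m B.
Proof.
move=> ho hB hc hm; split.
  apply/freeP => k hk j.
  have kB s : \sum_(i <- s) k i *: tnth B i \in frk R by apply: memv_suml => i _; exact: memvZ.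
  have ips (s : seq 'I_n) : ip (\sum_(i <- s) k i *: tnth B i) (tnth B j)
      = \sum_(i <- s) k i * ip (tnth B i) (tnth B j).
    elim: s => [|i s IH]; first by rewrite !big_nil ip0l.
    by rewrite !big_cons ip_linl // IH.
  have <- : ip (\sum_i k i *: tnth B i) (tnth B j) = k j.
    rewrite ips (bigD1 j) //= ho eqxx mulr1 big1 ?addr0 // => i /negbTE ij.
    by rewrite ho ij mulr0.
  rewrite (_ : \sum_i _ = 0) ?ip0l //.
  by rewrite -[RHS]hk; apply: eq_bigr => i _; rewrite (tnth_nth 0).
move=> X; split=> [/hm[c ->]|/coord_span ->].
  by apply: memv_suml => i _; apply/memvZ/memv_span/mem_tnth.
by under eq_bigr do rewrite -tnth_nth; exact: hc.
Qed.

(* w1 W_1 + z3 Z_3 + w2 W_2 + z2 Z_2 + w3 W_3 + z1 Z_1, where 1 / nu = 3 kappa / 8 *)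
Definition ovec (w1 z3 w2 z2 w3 z1 : R) : g2 R :=
  kvec (w1 / 2 - z3 / 4) (w2 / 2 + z2 / 4) (w3 / 2 - z1 / 4)
    (3 / 8 * kappa R * z1) (3 / 8 * kappa R * z2) (3 / 8 * kappa R * z3).

Lemma ovecE w1 z3 w2 z2 w3 z1 : ovec w1 z3 w2 z2 w3 z1 =
  kvec (w1 / 2 - z3 / 4) (w2 / 2 + z2 / 4) (w3 / 2 - z1 / 4)
    (3 / 8 * kappa R * z1) (3 / 8 * kappa R * z2) (3 / 8 * kappa R * z3).
Proof. by []. Qed.

Lemma kvec_ovec x1 x2 x3 y1 y2 y3 : kvec x1 x2 x3 y1 y2 y3 =
  ovec (2 * x1 + kappa R * y3) (2 * kappa R * y3) (2 * x2 - kappa R * y2) (2 * kappa R * y2)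
    (2 * x3 + kappa R * y1) (2 * kappa R * y1).
Proof.
rewrite /ovec; have k2 : kappa R * kappa R = 4 / 3 by rewrite -expr2 kappa2.
have E y : 3 / 8 * kappa R * (2 * kappa R * y) = y.
  by transitivity (3 / 4 * (kappa R * kappa R) * y); [field|rewrite k2; field].
by congr kvec; rewrite ?E //; field.
Qed.

Lemma ovecD w1 z3 w2 z2 w3 z1 w1' z3' w2' z2' w3' z1' :
  ovec w1 z3 w2 z2 w3 z1 + ovec w1' z3' w2' z2' w3' z1' =
  ovec (w1 + w1') (z3 + z3') (w2 + w2') (z2 + z2') (w3 + w3') (z1 + z1').
Proof. by rewrite /ovec kvecD; congr kvec; ring. Qed.

Lemma ovecZ c w1 z3 w2 z2 w3 z1 : c *: ovec w1 z3 w2 z2 w3 z1 =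
  ovec (c * w1) (c * z3) (c * w2) (c * z2) (c * w3) (c * z1).
Proof. by rewrite /ovec kvecZ; congr kvec; ring. Qed.

Lemma ovecN w1 z3 w2 z2 w3 z1 : - ovec w1 z3 w2 z2 w3 z1 =
  ovec (- w1) (- z3) (- w2) (- z2) (- w3) (- z1).
Proof. by rewrite /ovec kvecN; congr kvec; ring. Qed.

Lemma ovec_frk w1 z3 w2 z2 w3 z1 : ovec w1 z3 w2 z2 w3 z1 \in frk R.
Proof. exact: kvec_frk. Qed.

Lemma frk_ovec Z : Z \in frk R -> exists w1 z3 w2 z2 w3 z1, Z = ovec w1 z3 w2 z2 w3 z1.
Proof. by move=> /frkE ->; rewrite kvec_ovec; do 6 eexists. Qed.

Lemma ip_ovec w1 z3 w2 z2 w3 z1 w1' z3' w2' z2' w3' z1' :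
  ip (ovec w1 z3 w2 z2 w3 z1) (ovec w1' z3' w2' z2' w3' z1') =
  w1 * w1' + z3 * z3' + w2 * w2' + z2 * z2' + w3 * w3' + z1 * z1'.
Proof.
rewrite ip_kvec; have [r [-> r2]] := kappa_sqrt3 R.
by field: r2.
Qed.

Lemma kappa_gt0 : 0 < kappa R.
Proof. by rewrite /kappa sqrtr_gt0; lra. Qed.

(** Both squares equal 16/3. Hence the normalization of the Z_i introduces no irrationality besides
    kappa. *)
Lemma nuE : nu R = 2 * kappa R.
Proof.
rewrite /nu (_ : 4 + _ = (2 * kappa R) ^+ 2); last by rewrite exprMn kappa2; field.
by rewrite sqrtr_sqr ger0_norm // mulr_ge0 // ltW // kappa_gt0.
Qed.

Lemma nuV : (nu R)^-1 = 3 / 8 * kappa R.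
Proof.
rewrite nuE; have k0 := lt0r_neq0 kappa_gt0.
have k2 : kappa R * kappa R = 4 / 3 by rewrite -expr2 kappa2.
apply: (mulfI (x := 2 * kappa R)); first by rewrite mulf_neq0 // pnatr_eq0.
rewrite divff ?mulf_neq0 ?pnatr_eq0 //.
by transitivity (3 / 4 * (kappa R * kappa R)); [rewrite k2; field|field].
Qed.

Lemma basisE :
  (W1 R = ovec 1 0 0 0 0 0) * (Z3 R = ovec 0 1 0 0 0 0) * (W2 R = ovec 0 0 1 0 0 0) *
  (Z2 R = ovec 0 0 0 1 0 0) * (W3 R = ovec 0 0 0 0 1 0) * (Z1 R = ovec 0 0 0 0 0 1).
Proof.
have [r [rE r2]] := kappa_sqrt3 R.
rewrite /W1 /W2 /W3 /Z1 /Z2 /Z3 nuV !kE.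
by do !split; rewrite /ovec; congr kvec; rewrite ?rE; field: r2.
Qed.

End OrthonormalCoordinates.

(** * Explicit rotations *)

Section Rotations.
Variable R : realType.
Implicit Types (X u v Z : g2 R) (c t : R).

Lemma exp_ad_fix X u t : bracket X u = 0 -> exp_ad (t *: X) u = u.
Proof.
move=> h; rewrite (@exp_ad_rot _ X u 0 0 t) ?scaler0 ?addr0 ?h ?scale0r ?linear0 ?oppr0 ?scale0r //.
by rewrite mul0r cos0 scale1r.
Qed.

Lemma exp_ad_pi X u : bracket X (bracket X u) = - u -> exp_ad (pi *: X) u = - u.
Proof.
move=> h; rewrite (@exp_ad_rot _ X u (bracket X u) 1) ?scale1r ?h ?scaleN1r //.
by rewrite mul1r cospi sinpi scale0r addr0 scaleN1r.
Qed.

Lemma exp_ad_2pi X u : bracket X (bracket X u) = - (4 *: u) -> exp_ad (pi *: X) u = u.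
Proof.
move=> h; rewrite (@exp_ad_rot _ X u (2^-1 *: bracket X u) 2).
- by rewrite mulr_natl cos2pi sin2pi scale0r addr0 scale1r.
- by rewrite scalerA divff ?scale1r // pnatr_eq0.
- rewrite linearZ /= h scalerN scalerA -scaleNr; congr (- _ *: _); by field.
Qed.

Lemma bracket_X1 e11 e12 e13 e21 e22 e23 e31 e32 a1 a2 a3 b1 b2 b3 :
  bracket (X1 R) (mk e11 e12 e13 e21 e22 e23 e31 e32 a1 a2 a3 b1 b2 b3) =
  mk (- e21 - e12) (e11 - e22) (- e23) (e11 - e22) (e12 + e21) e13 (- e32) e31
    (- a2) a1 0 (- b2) b1 0.
Proof.
by rewrite X1E; apply: g2_eq; rewrite coord_bracket ?ent33 ?dualE !coord_kvec !coord_mk; ring.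
Qed.

Lemma bracket_X2 e11 e12 e13 e21 e22 e23 e31 e32 a1 a2 a3 b1 b2 b3 :
  bracket (X2 R) (mk e11 e12 e13 e21 e22 e23 e31 e32 a1 a2 a3 b1 b2 b3) =
  mk (- e31 - e13) (- e32) (2 * e11 + e22) (- e23) 0 e21 (2 * e11 + e22) e12
    (- a3) 0 a1 (- b3) 0 b1.
Proof.
by rewrite X2E; apply: g2_eq; rewrite coord_bracket ?ent33 ?dualE !coord_kvec !coord_mk; ring.
Qed.

(* Conjugation by diag(-1, -1, 1), respectively diag(-1, 1, -1). *)
Definition sign1 Z : g2 R := mk (ent i1 i1 Z) (ent i1 i2 Z) (- ent i1 i3 Z)
  (ent i2 i1 Z) (ent i2 i2 Z) (- ent i2 i3 Z) (- ent i3 i1 Z) (- ent i3 i2 Z)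
  (- vec i1 Z) (- vec i2 Z) (vec i3 Z) (- cov i1 Z) (- cov i2 Z) (cov i3 Z).

Definition sign2 Z : g2 R := mk (ent i1 i1 Z) (- ent i1 i2 Z) (ent i1 i3 Z)
  (- ent i2 i1 Z) (ent i2 i2 Z) (- ent i2 i3 Z) (ent i3 i1 Z) (- ent i3 i2 Z)
  (- vec i1 Z) (vec i2 Z) (- vec i3 Z) (- cov i1 Z) (cov i2 Z) (- cov i3 Z).

(** Z is split into [z0], [z1], [z2] in the eigenspaces of (ad X_1)^2 for 0, -1 and -4; up to time
    pi these turn by the angles 0, pi and 2 pi. *)
Lemma exp_pi_X1 Z : exp_ad (pi *: X1 R) Z = sign1 Z.
Proof.
pose a := (ent i1 i1 Z + ent i2 i2 Z) / 2; pose b := (ent i2 i1 Z - ent i1 i2 Z) / 2.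
pose d := (ent i1 i1 Z - ent i2 i2 Z) / 2; pose f := (ent i1 i2 Z + ent i2 i1 Z) / 2.
pose z0 := mk a (- b) 0 b a 0 0 0 0 0 (vec i3 Z) 0 0 (cov i3 Z).
pose z1 := mk 0 0 (ent i1 i3 Z) 0 0 (ent i2 i3 Z) (ent i3 i1 Z) (ent i3 i2 Z)
  (vec i1 Z) (vec i2 Z) 0 (cov i1 Z) (cov i2 Z) 0.
pose z2 := mk d f 0 f (- d) 0 0 0 0 0 0 0 0 0.
have e : Z = z0 + z1 + z2.
  by apply: g2_eq; rewrite !coordD !coord_mk /a /b /d /f; field.
rewrite [in LHS]e !linearD /= exp_ad_fix; last first.
  by rewrite bracket_X1; apply: g2_eq; rewrite coord0 coord_mk /a; field.
rewrite exp_ad_pi; last first.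
  by rewrite !bracket_X1; apply: g2_eq; rewrite coordN !coord_mk; ring.
rewrite exp_ad_2pi; last first.
  by rewrite !bracket_X1; apply: g2_eq; rewrite coordN coordZ !coord_mk; ring.
by apply: g2_eq; rewrite !coordL !coord_mk /a /b /d /f; field.
Qed.

Lemma exp_pi_X2 Z : exp_ad (pi *: X2 R) Z = sign2 Z.
Proof.
(* With the trace eliminated, [a] and [d] are the half sum and the half difference of the first and
   third diagonal entries. *)
pose a := - ent i2 i2 Z / 2; pose b := (ent i3 i1 Z - ent i1 i3 Z) / 2.
pose d := ent i1 i1 Z + ent i2 i2 Z / 2; pose f := (ent i1 i3 Z + ent i3 i1 Z) / 2.
pose z0 := mk a 0 (- b) 0 (ent i2 i2 Z) 0 b 0 0 (vec i2 Z) 0 0 (cov i2 Z) 0.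
pose z1 := mk 0 (ent i1 i2 Z) 0 (ent i2 i1 Z) 0 (ent i2 i3 Z) 0 (ent i3 i2 Z)
  (vec i1 Z) 0 (vec i3 Z) (cov i1 Z) 0 (cov i3 Z).
pose z2 := mk d 0 f 0 0 0 f 0 0 0 0 0 0 0.
have e : Z = z0 + z1 + z2.
  by apply: g2_eq; rewrite !coordD !coord_mk /a /b /d /f; field.
rewrite [in LHS]e !linearD /= exp_ad_fix; last first.
  by rewrite bracket_X2; apply: g2_eq; rewrite coord0 coord_mk /a; field.
rewrite exp_ad_pi; last first.
  by rewrite !bracket_X2; apply: g2_eq; rewrite coordN !coord_mk; ring.
rewrite exp_ad_2pi; last first.
  by rewrite !bracket_X2; apply: g2_eq; rewrite coordN coordZ !coord_mk; ring.
by apply: g2_eq; rewrite !coordL !coord_mk /a /b /d /f; field.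
Qed.

Lemma exp_pi_X1_kvec x1 x2 x3 y1 y2 y3 :
  exp_ad (pi *: X1 R) (kvec x1 x2 x3 y1 y2 y3) = kvec x1 (- x2) (- x3) (- y1) (- y2) y3.
Proof. by rewrite exp_pi_X1; apply: g2_eq; rewrite coord_mk !coord_kvec. Qed.

Lemma exp_pi_X2_kvec x1 x2 x3 y1 y2 y3 :
  exp_ad (pi *: X2 R) (kvec x1 x2 x3 y1 y2 y3) = kvec (- x1) x2 (- x3) (- y1) y2 (- y3).
Proof. by rewrite exp_pi_X2; apply: g2_eq; rewrite coord_mk !coord_kvec ?opprK. Qed.

Lemma exp_pi_X1_ovec w1 z3 w2 z2 w3 z1 :
  exp_ad (pi *: X1 R) (ovec w1 z3 w2 z2 w3 z1) = ovec w1 z3 (- w2) (- z2) (- w3) (- z1).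
Proof.
by rewrite !ovecE exp_pi_X1_kvec; congr kvec; ring.
Qed.

Lemma exp_pi_X2_ovec w1 z3 w2 z2 w3 z1 :
  exp_ad (pi *: X2 R) (ovec w1 z3 w2 z2 w3 z1) = ovec (- w1) (- z3) w2 z2 (- w3) (- z1).
Proof.
by rewrite !ovecE exp_pi_X2_kvec; congr kvec; ring.
Qed.

End Rotations.

Section HalfTurns.
Variables (R : realType) (K : set (g2 R -> g2 R)).
Hypothesis hk : forall X : g2 R, lie K X <-> X \in frk R.
Variables (q1 q2 : bool) (Theta : set (g2 R -> R)).
Hypothesis hTheta : forall Z, p_Theta Theta Z <-> in_p q1 q2 Z.

(** X_1 and X_2 need not lie in the Lie algebra of K_Theta, so [lieP] does not place the half turns
    in K_Theta. Instead they preserve p_Theta as sign changes, and being involutive they map it onto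
    itself. *)
Lemma K_Theta_invol X (s : g2 R -> g2 R) : X \in frk R -> exp_ad X = s ->
  involutive s -> (forall Z, in_p q1 q2 Z -> in_p q1 q2 (s Z)) -> K_Theta K Theta (exp_ad X).
Proof.
move=> Xk e ss sp; split.
  by move: Xk => /hk h; rewrite -[X]scale1r; exact: h.
split; first by exists [:: X].
rewrite e; apply/seteqP; split=> [_ [Y /hTheta hY <-]|Y /hTheta hY]; first exact/hTheta/sp.
by exists (s Y) => //; exact/hTheta/sp.
Qed.

Lemma K_Theta_X1 : K_Theta K Theta (exp_ad (pi *: X1 R)).
Proof.
apply: (@K_Theta_invol _ (@sign1 R)).
- by rewrite X1E memvZ // kvec_frk.
- by apply/funext => Z; exact: exp_pi_X1.
- by move=> Z; apply: g2_eq; rewrite !coord_mk ?opprK.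
- move=> Z [z1 z2 z3 z4 [z5 z6]]; rewrite /in_p !coord_mk z1 z2 z3 z4 oppr0; split=> //.
  by split=> [/z5|/z6 ->] //; rewrite oppr0.
Qed.

Lemma K_Theta_X2 : K_Theta K Theta (exp_ad (pi *: X2 R)).
Proof.
apply: (@K_Theta_invol _ (@sign2 R)).
- by rewrite X2E memvZ // kvec_frk.
- by apply/funext => Z; exact: exp_pi_X2.
- by move=> Z; apply: g2_eq; rewrite !coord_mk ?opprK.
- move=> Z [z1 z2 z3 z4 [z5 z6]]; rewrite /in_p !coord_mk z1 z2 z3 z4 oppr0; split=> //.
  by split=> [/z5 ->|/z6] //; rewrite oppr0.
Qed.

End HalfTurns.

#[local] Opaque ovec.

(** * Tools shared by the three cases: Gram matrices, quadratic forms, the nilradical *)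

Section Cases.
Variables (R : realType) (K : set (g2 R -> g2 R)).
Hypothesis hK : is_subgroup K.
Hypothesis hk : forall X : g2 R, lie K X <-> X \in frk R.
Implicit Types (X Y Z : g2 R) (A : g2 R -> g2 R).

Lemma has_matrix_rows n (B : n.-tuple (g2 R)) A q (s : seq (seq R)) :
  has_matrix A B (\matrix_(i, j) q (tnth B i) (tnth B j)) ->
  (forall i j : nat, (i < n)%N -> (j < n)%N -> nth 0 (nth [::] s i) j = q B`_i B`_j) ->
  has_matrix A B (mx_of_rows n s).
Proof.
move=> h e j; rewrite h; apply: eq_bigr => i _; congr (_ *: _).
by rewrite !mxE e // !(tnth_nth 0).
Qed.

Section GramNth.
Variables (m : set (g2 R)) (n : nat) (B : n.-tuple (g2 R)) (q : g2 R -> g2 R -> R).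
Hypotheses (hm : forall X, m X -> X \in frk R) (hB : is_basis m B) (ho : is_orthonormal B).
Hypothesis iq : is_inner_product m q.

Let tn k (lk : (k < n)%N) : tnth B (Ordinal lk) = B`_k. Proof. by rewrite (tnth_nth 0). Qed.

Lemma gram_nth_gt0 k : (k < n)%N -> 0 < q B`_k B`_k.
Proof. by move=> lk; rewrite -(tn lk); exact: (gram_gt0 hB ho iq). Qed.

Lemma gram_nth_lt k l : (k < n)%N -> (l < n)%N -> k != l ->
  - Num.sqrt (q B`_k B`_k * q B`_l B`_l) < q B`_k B`_l < Num.sqrt (q B`_k B`_k * q B`_l B`_l).
Proof.
by move=> lk ll kl; rewrite -(tn lk) -(tn ll); exact: (gram_lt hm hB ho iq).
Qed.

End GramNth.

Lemma in_p_kvec q1 q2 x1 x2 x3 y1 y2 y3 : in_p q1 q2 (kvec x1 x2 x3 y1 y2 y3 : g2 R) <->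
  [/\ x2 = 0, x3 = 0, y3 = 0, y1 = 0 & (~~ q1 -> x1 = 0) /\ (~~ q2 -> y2 = 0)].
Proof.
rewrite /in_p !coord_kvec; split=> -[? ? ? h4 [? h6]]; split=> //.
- by rewrite -[y1]opprK h4 oppr0.
- by split=> // /h6 h; rewrite -[y2]opprK h oppr0.
- by rewrite h4 oppr0.
- by split=> // /h6 ->; rewrite oppr0.
Qed.

Lemma m_Theta_0 Theta : m_Theta K Theta 0.
Proof.
split; first exact: mem0v.
by move=> X h; have /hk Xk : lie K X; [move=> t; case: (h t)|rewrite ipC ?mem0v // ip0l].
Qed.

Lemma m_Theta_lin Theta (c : R) X Y :
  m_Theta K Theta X -> m_Theta K Theta Y -> m_Theta K Theta (c *: X + Y).
Proof.
move=> [Xk hX] [Yk hY]; have Wk : c *: X + Y \in frk R by apply: memvD => //; exact: memvZ.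
split=> // Z h; have /hk Zk : lie K Z by move=> t; case: (h t).
by rewrite ipC // ip_linl // (ipC Xk) // (ipC Yk) // hX // hY // mulr0 addr0.
Qed.

Lemma quad_lt (m1 m2 a : R) : - Num.sqrt (m1 * m2) < a < Num.sqrt (m1 * m2) ->
  0 < m1 -> 0 < m2 -> a ^+ 2 < m1 * m2.
Proof.
rewrite -ltr_norml -sqrtr_sqr => h m10 m20.
by move: h; rewrite ltr_sqrt // mulr_gt0.
Qed.

Lemma quad_gt0 (m1 m2 a x y : R) : 0 < m1 -> a ^+ 2 < m1 * m2 -> (x != 0) || (y != 0) ->
  0 < m1 * x ^+ 2 + 2 * a * x * y + m2 * y ^+ 2.
Proof.
move=> m10 am xy; rewrite -(pmulr_rgt0 _ m10).
rewrite [ltRHS](_ : _ = (m1 * x + a * y) ^+ 2 + (m1 * m2 - a ^+ 2) * y ^+ 2); last by ring.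
have [y0|y0] := eqVneq y 0.
  move: xy; rewrite y0 eqxx orbF => x0; rewrite !mulr0 addr0 expr0n mulr0 addr0.
  by rewrite exprn_even_gt0 //= mulf_neq0 // gt_eqF.
rewrite ltr_wpDl ?sqr_ge0 // mulr_gt0 ?subr_gt0 //.
by rewrite exprn_even_gt0.
Qed.

Lemma quad_ge0 (m1 m2 a x y : R) : 0 < m1 -> a ^+ 2 < m1 * m2 ->
  0 <= m1 * x ^+ 2 + 2 * a * x * y + m2 * y ^+ 2.
Proof.
move=> m10 am; have [xy|] := boolP ((x != 0) || (y != 0)); first exact/ltW/quad_gt0.
by rewrite negb_or !negbK => /andP[/eqP-> /eqP->]; rewrite !expr0n !mulr0 !addr0.
Qed.

Lemma kvec_lin a : linear a -> forall x1 x2 x3 y1 y2 y3, a (kvec x1 x2 x3 y1 y2 y3) =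
  x1 *: a (kvec 1 0 0 0 0 0) + (x2 *: a (kvec 0 1 0 0 0 0) + (x3 *: a (kvec 0 0 1 0 0 0)
  + (y1 *: a (kvec 0 0 0 1 0 0) + (y2 *: a (kvec 0 0 0 0 1 0)
  + y3 *: a (kvec 0 0 0 0 0 1))))) :> g2 R.
Proof.
move=> la x1 x2 x3 y1 y2 y3.
have a0 : a 0 = 0 by have := la (-1) 0 0; rewrite scaler0 addr0 scaleN1r addNr.
have aZ (c : R) X : a (c *: X) = c *: a X by rewrite -[c *: X]addr0 la a0 addr0.
by rewrite -!(aZ y3) -!la; congr (a _); rewrite !kE; congr kvec; ring.
Qed.

Lemma beta_kvec x1 x2 x3 y1 y2 y3 x1' x2' x3' y1' y2' y3' :
  beta (kvec x1 x2 x3 y1 y2 y3) (kvec x1' x2' x3' y1' y2' y3') =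
  - 2 * (x1 * x1' + x2 * x2' + x3 * x3' + y1 * y1' + y2 * y2' + y3 * y3') :> R.
Proof. by rewrite betaE !coord_kvec; ring. Qed.

Section Nilradical.
Variables (q1 q2 : bool).

(* As beta is a multiple of the Killing form, the orthogonal of a parabolic subalgebra
   is its nilradical. *)
Definition in_nil (N : g2 R) : Prop := forall W, in_p q1 q2 W -> beta N W = 0.

(** Grade g2 by the sum of the coefficients of the simple roots outside Theta. Then p_Theta is the
    part of degree at least 0, its nilradical the part of degree at least 1, and this is the part of
    degree at least -1. It meets k in a larger space than p_Theta does, and is defined in terms that
    K_Theta preserves. *)
Definition in_p1 (Z : g2 R) : Prop := forall N, in_nil N -> in_p q1 q2 (bracket Z N).

Lemma K_Theta_p1 Theta a Z : (forall Z, p_Theta Theta Z <-> in_p q1 q2 Z) ->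
  K_Theta K Theta a -> in_p1 Z -> in_p1 (a Z).
Proof.
move=> hT Ta hZ N hN; have [b [Tb ab ba]] := K_Theta_inv hK Ta.
have [_ am aB] := K_aut hK Ta.1.
rewrite -(ba N) -am; apply: (K_Theta_in_p hT Ta); apply: hZ => W hW.
by rewrite -aB ba; apply: hN; exact: (K_Theta_in_p hT Ta).
Qed.

(** Under beta each root coordinate is paired with the opposite root, so N is tested against root
    vectors of p_Theta, and against two diagonal matrices for its diagonal part. *)
Lemma nil_coord N : in_nil N ->
  [/\ ent i1 i1 N = 0, ent i2 i2 N = 0, ent i2 i1 N = 0, ent i3 i1 N = 0 & ent i3 i2 N = 0] /\
  [/\ vec i3 N = 0, cov i1 N = 0, cov i2 N = 0 & q1 -> ent i1 i2 N = 0].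
Proof.
move=> h; have t W e : in_p q1 q2 W -> beta N W = e -> e = 0 by move=> /h -> ->.
have e1 : 2 * ent i1 i1 N + ent i2 i2 N = 0.
  apply: (t (Hd 1 0)); first exact/cartan_in_p/cartan_Hd.
  by rewrite betaE /Hd !coord_mk; ring.
have e2 : ent i1 i1 N + 2 * ent i2 i2 N = 0.
  apply: (t (Hd 0 1)); first exact/cartan_in_p/cartan_Hd.
  by rewrite betaE /Hd !coord_mk; ring.
split; split.
- lra.
- lra.
- by apply: (t (mk 0 1 0 0 0 0 0 0 0 0 0 0 0 0)); rewrite ?/in_p ?betaE !coord_mk; [|ring].
- by apply: (t (mk 0 0 1 0 0 0 0 0 0 0 0 0 0 0)); rewrite ?/in_p ?betaE !coord_mk; [|ring].
- by apply: (t (mk 0 0 0 0 0 1 0 0 0 0 0 0 0 0)); rewrite ?/in_p ?betaE !coord_mk; [|ring].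
- by apply: (t (mk 0 0 0 0 0 0 0 0 0 0 0 0 0 1)); rewrite ?/in_p ?betaE !coord_mk; [|ring].
- by apply: (t (mk 0 0 0 0 0 0 0 0 1 0 0 0 0 0)); rewrite ?/in_p ?betaE !coord_mk; [|ring].
- by apply: (t (mk 0 0 0 0 0 0 0 0 0 1 0 0 0 0)); rewrite ?/in_p ?betaE !coord_mk; [|ring].
- move=> q1T; apply: (t (mk 0 0 0 1 0 0 0 0 0 0 0 0 0 0));
    rewrite ?/in_p ?betaE !coord_mk; last ring.
  by rewrite q1T.
Qed.

End Nilradical.

Lemma sum6 (V : nmodType) (F : 'I_6 -> V) : \sum_i F i = F (inord 0) + (F (inord 1)
  + (F (inord 2) + (F (inord 3) + (F (inord 4) + F (inord 5))))).
Proof.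
rewrite (eq_bigr (fun i : 'I_6 => F (inord i))) => [|i _]; last by rewrite inord_val.
by rewrite !big_ord_recl big_ord0 addr0.
Qed.

Lemma sum5 (V : nmodType) (F : 'I_5 -> V) : \sum_i F i = F (inord 0) + (F (inord 1)
  + (F (inord 2) + (F (inord 3) + F (inord 4)))).
Proof.
rewrite (eq_bigr (fun i : 'I_5 => F (inord i))) => [|i _]; last by rewrite inord_val.
by rewrite !big_ord_recl big_ord0 addr0.
Qed.

(** * The case Theta = empty *)

Section Empty.

Lemma m_empty X : m_Theta K set0 X <-> X \in frk R.
Proof.
split=> [[]//|Xk]; split=> // Y /(@lieP _ _ hk false false _ isT (@p_empty R))[/frkE -> /in_p_kvec].
by move=> [-> -> -> -> [-> // -> //]]; rewrite kvec0 ip0l.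
Qed.

Lemma tnth_empty i : tnth (basis_empty R) i = ovec (i == 0 :> nat)%:R (i == 1 :> nat)%:R
  (i == 2 :> nat)%:R (i == 3 :> nat)%:R (i == 4 :> nat)%:R (i == 5 :> nat)%:R.
Proof. by rewrite (tnth_nth 0); case: i => -[|[|[|[|[|[|n]]]]]] //= hi; rewrite basisE. Qed.

Lemma orthonormal_empty : is_orthonormal (basis_empty R).
Proof.
move=> i j; rewrite !tnth_empty ip_ovec -val_eqE.
by case: i j => -[|[|[|[|[|[|n]]]]]] // hi [[|[|[|[|[|[|n]]]]]] // hj] /=; ring.
Qed.

Lemma sum_empty (c : 'I_6 -> R) : \sum_i c i *: tnth (basis_empty R) i =
  ovec (c (inord 0)) (c (inord 1)) (c (inord 2)) (c (inord 3)) (c (inord 4)) (c (inord 5)).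
Proof.
rewrite sum6 !(tnth_nth 0) !inordK //= !basisE !ovecZ !ovecD; congr ovec; ring.
Qed.

Lemma basis_empty_m : is_basis (m_Theta K set0) (basis_empty R).
Proof.
apply: orthonormal_basis.
- exact: orthonormal_empty.
- by move=> i; rewrite tnth_empty ovec_frk.
- by move=> c; apply/m_empty; rewrite sum_empty ovec_frk.
- move=> X /m_empty /frk_ovec[w1 [z3 [w2 [z2 [w3 [z1 ->]]]]]].
  exists (fun i => nth 0 [:: w1; z3; w2; z2; w3; z1] i).
  by rewrite sum_empty !inordK.
Qed.

Lemma matrix_empty A (M : 'M[R]_6) : is_endo (m_Theta K set0) A ->
  has_matrix A (basis_empty R) M -> forall w1 z3 w2 z2 w3 z1,
  let c i := M (inord i) (inord 0) * w1 + M (inord i) (inord 1) * z3 + M (inord i) (inord 2) * w2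
    + M (inord i) (inord 3) * z2 + M (inord i) (inord 4) * w3 + M (inord i) (inord 5) * z1 in
  A (ovec w1 z3 w2 z2 w3 z1) = ovec (c 0) (c 1) (c 2) (c 3) (c 4) (c 5).
Proof.
move=> [Am Al] hM w1 z3 w2 z2 w3 z1 c.
have -> : ovec w1 z3 w2 z2 w3 z1 =
    \sum_(i < 6) nth 0 [:: w1; z3; w2; z2; w3; z1] i *: tnth (basis_empty R) i.
  by rewrite sum_empty !inordK.
rewrite (lin_on_sum basis_empty_m) //.
by rewrite sum6 !hM !sum_empty !inordK //= !ovecZ !ovecD /c; congr ovec; ring.
Qed.

Lemma p1_empty Z : Z \in frk R -> in_p1 false false Z <->
  exists x y, Z = kvec x 0 0 0 y 0.
Proof.
move=> /frkE hZ; split=> [|[x [y ->]] N /nil_coord[[n1 n2 n3 n4 n5] [n6 n7 n8 _]]]; last first.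
  by rewrite /in_p !coord_bracket ?ent33 !coord_kvec n1 n2 n3 n4 n5 n6 n7 n8;
    split; last split=> _; ring.
rewrite hZ; move: (ent i2 i1 Z) (ent i3 i1 Z) (ent i3 i2 Z) (vec i1 Z) (vec i2 Z) (vec i3 Z).
move=> x1 x2 x3 y1 y2 y3 h; exists x1, y2.
(* The simple root vectors E_12 and e_2 generate the nilradical, and testing against them is
   enough. *)
have nE : in_nil false false (mk 0 1 0 0 0 0 0 0 0 0 0 0 0 0 : g2 R).
  by move=> W [_ _ _ _ [w _]]; rewrite betaE !coord_mk w //; ring.
have ne : in_nil false false (mk 0 0 0 0 0 0 0 0 0 1 0 0 0 0 : g2 R).
  by move=> W [_ _ _ _ [_ w]]; rewrite betaE !coord_mk w //; ring.
case: (h _ nE) => _ + _ _ [_ /(_ isT)]; case: (h _ ne) => _ _ + + _.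
rewrite !coord_bracket ?ent33 !coord_kvec !coord_mk => hx3 hy3 hx2 hy1.
have -> : x2 = 0 by move: hx2; lra.
have -> : x3 = 0 by move: hx3; lra.
have -> : y1 = 0 by move: hy1; lra.
have -> // : y3 = 0.
by apply: (mulfI (lt0r_neq0 (kappa_gt0 R))); move: hy3; lra.
Qed.

(** The plane of X_1 and Y_2 is preserved, and the two invariant forms force a X_1 = e X_1 and a Y_2
    = d Y_2 with e^2 = d^2 = 1; brackets carry this to all of k. Being scalar on each of the three
    coordinate planes, a commutes with every matrix made of the corresponding blocks. *)
Lemma aut_empty a : K_Theta K set0 a -> exists e d : R, forall w1 z3 w2 z2 w3 z1,
  a (ovec w1 z3 w2 z2 w3 z1) = ovec (e * w1) (e * z3) (d * w2) (d * z2) (e * d * w3) (e * d * z1).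
Proof.
move=> Ta; have [Ka _] := Ta; have [la am aB] := K_aut hK Ka.
have sp x y : exists x' y', a (kvec x 0 0 0 y 0) = kvec x' 0 0 0 y' 0.
  apply/p1_empty; first exact/(K_frk hK hk Ka)/kvec_frk.
  by apply: (K_Theta_p1 (@p_empty R) Ta); apply/p1_empty; [exact: kvec_frk|exists x, y].
(* On the plane spanned by X_1 and Y_2 the invariant forms ip and beta are not proportional. *)
have [e [e' hX1]] := sp 1 0; have [d' [d hY2]] := sp 0 1.
have be := aB (kvec 1 0 0 0 0 0) (kvec 1 0 0 0 0 0).
have bd := aB (kvec 0 0 0 0 1 0) (kvec 0 0 0 0 1 0).
have ie := K_ip hK hk Ka (kvec_frk 1 0 0 0 0 0) (kvec_frk 1 0 0 0 0 0).
have id := K_ip hK hk Ka (kvec_frk 0 0 0 0 1 0) (kvec_frk 0 0 0 0 1 0).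
rewrite hX1 !beta_kvec in be; rewrite hX1 !ip_kvec in ie.
rewrite hY2 !beta_kvec in bd; rewrite hY2 !ip_kvec in id.
have e'0 : e' = 0 by apply/eqP; rewrite -sqrf_eq0 expr2; apply/eqP; lra.
have d'0 : d' = 0 by apply/eqP; rewrite -sqrf_eq0 expr2; apply/eqP; lra.
have ee : e * e = 1 by move: be; rewrite e'0; lra.
have dd : d * d = 1 by move: bd; rewrite d'0; lra.
rewrite e'0 in hX1; rewrite d'0 in hY2.
have k0 := lt0r_neq0 (kappa_gt0 R).
have hY1 : a (kvec 0 0 0 1 0 0) = kvec 0 0 0 (e * d) 0 0.
  have -> : kvec 0 0 0 1 0 0 = bracket (kvec 0 0 0 0 1 0) (kvec 1 0 0 0 0 0) :> g2 R.
    by rewrite bracket_kvec; congr kvec; ring.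
  by rewrite am hX1 hY2 bracket_kvec; congr kvec; ring.
(* The remaining images follow from [Y_1, Y_2] = X_1 + kappa Y_3, [Y_1, Y_3] = X_2 - kappa Y_2 and
   [X_1, X_2] = X_3. *)
have hY3 : a (kvec 0 0 0 0 0 1) = kvec 0 0 0 0 0 e.
  have : a (kvec 1 0 0 0 0 (kappa R)) = kvec e 0 0 0 0 (kappa R * e).
    have -> : kvec 1 0 0 0 0 (kappa R) = bracket (kvec 0 0 0 1 0 0) (kvec 0 0 0 0 1 0) :> g2 R.
      by rewrite bracket_kvec; congr kvec; ring.
    by rewrite am hY1 hY2 bracket_kvec; congr kvec; ring: dd.
  rewrite (kvec_lin la) hX1 !scale0r !add0r scale1r => h.
  have {}h : kappa R *: a (kvec 0 0 0 0 0 1) = kappa R *: kvec 0 0 0 0 0 e.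
    apply: (addrI (kvec e 0 0 0 0 0)); rewrite h !kE; congr kvec; ring.
  by apply: (scalerI k0).
have hX2 : a (kvec 0 1 0 0 0 0) = kvec 0 d 0 0 0 0.
  have -> : kvec 0 1 0 0 0 0 = bracket (kvec 0 0 0 1 0 0) (kvec 0 0 0 0 0 1)
      + kappa R *: kvec 0 0 0 0 1 0 :> g2 R.
    by rewrite bracket_kvec !kE; congr kvec; ring.
  rewrite addrC la am hY1 hY2 hY3 bracket_kvec !kE; congr kvec; ring: ee.
have hX3 : a (kvec 0 0 1 0 0 0) = kvec 0 0 (e * d) 0 0 0.
  have -> : kvec 0 0 1 0 0 0 = bracket (kvec 1 0 0 0 0 0) (kvec 0 1 0 0 0 0) :> g2 R.
    by rewrite bracket_kvec; congr kvec; ring.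
  by rewrite am hX1 hX2 bracket_kvec; congr kvec; ring.
exists e, d => w1 z3 w2 z2 w3 z1.
by rewrite !ovecE (kvec_lin la) hX1 hX2 hX3 hY1 hY2 hY3 !kE; congr kvec; ring.
Qed.

Lemma metric_empty A : is_endo (m_Theta K set0) A ->
  (is_metric_operator K set0 A <->
   exists mu1 mu2 mu3 mu4 mu5 mu6 a1 a2 a3 : R,
     [/\ [/\ 0 < mu1, 0 < mu2 & 0 < mu3],
         [/\ 0 < mu4, 0 < mu5 & 0 < mu6],
         [/\ - Num.sqrt (mu1 * mu2) < a1 < Num.sqrt (mu1 * mu2),
             - Num.sqrt (mu3 * mu4) < a2 < Num.sqrt (mu3 * mu4) &
             - Num.sqrt (mu5 * mu6) < a3 < Num.sqrt (mu5 * mu6)] &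
         has_matrix A (basis_empty R) (mx_of_rows 6
           [:: [:: mu1; a1; 0; 0; 0; 0];
               [:: a1; mu2; 0; 0; 0; 0];
               [:: 0; 0; mu3; a2; 0; 0];
               [:: 0; 0; a2; mu4; 0; 0];
               [:: 0; 0; 0; 0; mu5; a3];
               [:: 0; 0; 0; 0; a3; mu6]])]).
Proof.
have mk X : m_Theta K set0 X -> X \in frk R by case.
have ho := orthonormal_empty; have hB := basis_empty_m.
move=> hA; split=> [[q [iq inv e]]|].
  have pos k := gram_nth_gt0 (k := k) hB ho iq.
  have lt k l := gram_nth_lt (k := k) (l := l) mk hB ho iq.
  have gsym := q_sym iq.
  exists (q (W1 R) (W1 R)), (q (Z3 R) (Z3 R)), (q (W2 R) (W2 R)), (q (Z2 R) (Z2 R)),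
    (q (W3 R) (W3 R)), (q (Z1 R) (Z1 R)), (q (W1 R) (Z3 R)), (q (W2 R) (Z2 R)), (q (W3 R) (Z1 R)).
  split.
  - by split; [exact: (pos 0%N isT)|exact: (pos 1%N isT)|exact: (pos 2%N isT)].
  - by split; [exact: (pos 3%N isT)|exact: (pos 4%N isT)|exact: (pos 5%N isT)].
  - by split; [exact: (lt 0%N 1%N)|exact: (lt 2%N 3%N)|exact: (lt 4%N 5%N)].
  have mB w1 z3 w2 z2 w3 z1 : m_Theta K set0 (ovec w1 z3 w2 z2 w3 z1).
    by apply/m_empty/ovec_frk.
  have odd := q_odd (m_Theta_0 set0) (@m_Theta_lin set0) iq inv.
  have KX1 := K_Theta_X1 hk (@p_empty R); have KX2 := K_Theta_X2 hk (@p_empty R).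
  (* The half turn of X_1 fixes the plane (W_1, Z_3) and negates the other two; that of X_2 then
     separates (W_2, Z_2) from (W_3, Z_1). *)
  have o1 (x y : R) w2 z2 w3 z1 : q (ovec x y 0 0 0 0) (ovec 0 0 w2 z2 w3 z1) = 0 /\
      q (ovec 0 0 w2 z2 w3 z1) (ovec x y 0 0 0 0) = 0.
    apply: (odd _ _ _ KX1 (mB _ _ _ _ _ _) (mB _ _ _ _ _ _));
      by rewrite exp_pi_X1_ovec ?ovecN ?oppr0.
  have o2 (x y : R) w3 z1 : q (ovec 0 0 x y 0 0) (ovec 0 0 0 0 w3 z1) = 0 /\
      q (ovec 0 0 0 0 w3 z1) (ovec 0 0 x y 0 0) = 0.
    apply: (odd _ _ _ KX2 (mB _ _ _ _ _ _) (mB _ _ _ _ _ _));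
      by rewrite exp_pi_X2_ovec ?ovecN ?oppr0.
  have gm := gram_matrix mk hB ho hA iq e.
  apply: (has_matrix_rows gm) => -[|[|[|[|[|[|i]]]]]] [|[|[|[|[|[|j]]]]]] // _ _ /=;
    rewrite !basisE; first [by [] | by rewrite (o1 _ _ _ _ _ _).1 | by rewrite (o1 _ _ _ _ _ _).2
      | by rewrite (o2 _ _ _ _).1 | by rewrite (o2 _ _ _ _).2 | exact: gsym].
move=> [mu1 [mu2 [mu3 [mu4 [mu5 [mu6 [a1 [a2 [a3 [[p1 p2 p3] [p4 p5 p6] [l1 l2 l3] hM]]]]]]]]]].
apply: (metric_of_matrix mk hB ho hA hM).
- by move=> -[[|[|[|[|[|[|i]]]]]] // hi] [[|[|[|[|[|[|j]]]]]] // hj]; rewrite !mxE.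
- move=> x [i xi].
  have xE k : x k = x (inord k) by rewrite inord_val.
  (* Each block is nonnegative, and the one containing the nonzero coordinate is positive. *)
  have : 0 < (mu1 * x (inord 0) ^+ 2 + 2 * a1 * x (inord 0) * x (inord 1) + mu2 * x (inord 1) ^+ 2)
    + (mu3 * x (inord 2) ^+ 2 + 2 * a2 * x (inord 2) * x (inord 3) + mu4 * x (inord 3) ^+ 2)
    + (mu5 * x (inord 4) ^+ 2 + 2 * a3 * x (inord 4) * x (inord 5) + mu6 * x (inord 5) ^+ 2).
    have Q1 := quad_ge0 (x (inord 0)) (x (inord 1)) p1 (quad_lt l1 p1 p2).
    have Q2 := quad_ge0 (x (inord 2)) (x (inord 3)) p3 (quad_lt l2 p3 p4).
    have Q3 := quad_ge0 (x (inord 4)) (x (inord 5)) p5 (quad_lt l3 p5 p6).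
    have P1 := @quad_gt0 _ _ _ (x (inord 0)) (x (inord 1)) p1 (quad_lt l1 p1 p2).
    have P2 := @quad_gt0 _ _ _ (x (inord 2)) (x (inord 3)) p3 (quad_lt l2 p3 p4).
    have P3 := @quad_gt0 _ _ _ (x (inord 4)) (x (inord 5)) p5 (quad_lt l3 p5 p6).
    move: xi; rewrite xE; case: i => -[|[|[|[|[|[|i]]]]]] // hi /= xi.
    + by have := P1; rewrite xi => /(_ isT) P; lra.
    + by have := P1; rewrite xi orbT => /(_ isT) P; lra.
    + by have := P2; rewrite xi => /(_ isT) P; lra.
    + by have := P2; rewrite xi orbT => /(_ isT) P; lra.
    + by have := P3; rewrite xi => /(_ isT) P; lra.
    + by have := P3; rewrite xi orbT => /(_ isT) P; lra.
  set Q := (X in 0 < X -> _) => Q0; rewrite [ltRHS](_ : _ = Q) //.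
  by rewrite sum6 !sum6 !mxE !inordK //= /Q; ring.
- move=> a Ta; have [Ka _] := Ta; have [la _ _] := K_aut hK Ka; split=> //.
  + by move=> X; apply: (@K_Theta_m _ _ hK hk false false _ isT (@p_empty R)).
  + by move=> X Y [Xk _] [Yk _]; exact: (K_ip hK hk Ka Xk Yk).
  have [u [v aE]] := aut_empty Ta.
  have AB := matrix_empty hA hM; move=> j; rewrite !tnth_empty aE !AB aE.
  by rewrite !mxE !inordK //=; congr ovec; ring.
Qed.

End Empty.
End Cases.

(** * The case Theta = {alpha_1} *)

Section CaseAlpha1.
Variables (R : realType) (K : set (g2 R -> g2 R)).
Hypothesis hK : is_subgroup K.
Hypothesis hk : forall X : g2 R, lie K X <-> X \in frk R.
Implicit Types (X Y Z : g2 R) (A : g2 R -> g2 R).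
Let m := m_Theta K [set @alpha1 R].
Let lie1 := @lieP _ _ hk true false _ isT (@p_alpha1 R).

Lemma m_alpha1 X : m X <-> exists z3 w2 z2 w3 z1, X = ovec 0 z3 w2 z2 w3 z1.
Proof.
have X1o x : kvec x 0 0 0 0 0 = ovec (2 * x) 0 0 0 0 0 :> g2 R.
  by rewrite kvec_ovec; congr ovec; ring.
split=> [[/frk_ovec[w1 [z3 [w2 [z2 [w3 [z1 ->]]]]]] h]|[z3 [w2 [z2 [w3 [z1 ->]]]]]].
  have : lie (K_Theta K [set @alpha1 R]) (kvec 1 0 0 0 0 0).
    by apply/lie1; split; [exact: kvec_frk|apply/in_p_kvec].
  move=> /h; rewrite X1o ip_ovec => e; have -> : w1 = 0 by lra.
  by do 5 eexists.
split=> [|Y /lie1[/frkE -> /in_p_kvec[-> -> -> -> [_ -> //]]]]; first exact: ovec_frk.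
by rewrite X1o ip_ovec; ring.
Qed.

Lemma tnth_alpha1 i : tnth (basis_alpha1 R) i = ovec 0 (i == 0 :> nat)%:R
  (i == 1 :> nat)%:R (i == 3 :> nat)%:R (i == 2 :> nat)%:R (- (i == 4 :> nat)%:R).
Proof.
by rewrite (tnth_nth 0); case: i => -[|[|[|[|[|n]]]]] //= hi; rewrite basisE ?ovecN ?oppr0.
Qed.

Lemma orthonormal_alpha1 : is_orthonormal (basis_alpha1 R).
Proof.
move=> i j; rewrite !tnth_alpha1 ip_ovec -val_eqE.
by case: i j => -[|[|[|[|[|n]]]]] // hi [[|[|[|[|[|n]]]]] // hj] /=; ring.
Qed.

Lemma sum_alpha1 (c : 'I_5 -> R) : \sum_i c i *: tnth (basis_alpha1 R) i =
  ovec 0 (c (inord 0)) (c (inord 1)) (c (inord 3)) (c (inord 2)) (- c (inord 4)).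
Proof.
by rewrite sum5 !(tnth_nth 0) !inordK //= !basisE !ovecN !ovecZ !ovecD; congr ovec; ring.
Qed.

Lemma basis_alpha1_m : is_basis m (basis_alpha1 R).
Proof.
apply: orthonormal_basis.
- exact: orthonormal_alpha1.
- by move=> i; rewrite tnth_alpha1 ovec_frk.
- by move=> c; apply/m_alpha1; rewrite sum_alpha1; do 5 eexists.
- move=> X /m_alpha1[z3 [w2 [z2 [w3 [z1 ->]]]]].
  exists (fun i => nth 0 [:: z3; w2; w3; z2; - z1] i).
  by rewrite sum_alpha1 !inordK //= opprK.
Qed.

Lemma matrix_alpha1 A (M : 'M[R]_5) : is_endo m A -> has_matrix A (basis_alpha1 R) M ->
  forall z3 w2 z2 w3 z1,
  let c i := M (inord i) (inord 0) * z3 + M (inord i) (inord 1) * w2 + M (inord i) (inord 2) * w3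
    + M (inord i) (inord 3) * z2 - M (inord i) (inord 4) * z1 in
  A (ovec 0 z3 w2 z2 w3 z1) = ovec 0 (c 0) (c 1) (c 3) (c 2) (- c 4).
Proof.
move=> [Am Al] hM z3 w2 z2 w3 z1 c.
have -> : ovec 0 z3 w2 z2 w3 z1 =
    \sum_(i < 5) nth 0 [:: z3; w2; w3; z2; - z1] i *: tnth (basis_alpha1 R) i.
  by rewrite sum_alpha1 !inordK //= opprK.
rewrite (lin_on_sum basis_alpha1_m) //.
by rewrite sum5 !hM !sum_alpha1 !inordK //= !ovecZ !ovecD /c; congr ovec; ring.
Qed.

Lemma p1_alpha1 Z : Z \in frk R -> in_p1 true false Z <->
  exists x y y', Z = kvec x 0 0 y y' 0.
Proof.
move=> /frkE hZ; split=> [|[x [y [y' ->]]] N]; last first.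
  move=> /nil_coord[[n1 n2 n3 n4 n5] [n6 n7 n8 n9]].
  by rewrite /in_p !coord_bracket ?ent33 !coord_kvec n1 n2 n3 n4 n5 n6 n7 n8 n9 //;
    split; last (split=> // _); ring.
rewrite hZ; move: (ent i2 i1 Z) (ent i3 i1 Z) (ent i3 i2 Z) (vec i1 Z) (vec i2 Z) (vec i3 Z).
move=> x1 x2 x3 y1 y2 y3 h; exists x1, y1, y2.
(* The vectors e_1 and e_2 span the part of degree 1 of the nilradical. *)
have n1 : in_nil true false (mk 0 0 0 0 0 0 0 0 1 0 0 0 0 0 : g2 R).
  by move=> W [_ _ _ w _]; rewrite betaE !coord_mk w //; ring.
have n2 : in_nil true false (mk 0 0 0 0 0 0 0 0 0 1 0 0 0 0 : g2 R).
  by move=> W [_ _ _ _ [_ w]]; rewrite betaE !coord_mk w //; ring.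
case: (h _ n1) => _ _ + _ _; case: (h _ n2) => _ _ + + _.
rewrite !coord_bracket ?ent33 !coord_kvec !coord_mk => hx3 hy3 hx2.
have -> : x2 = 0 by move: hx2; lra.
have -> : x3 = 0 by move: hx3; lra.
have -> // : y3 = 0.
by apply: (mulfI (lt0r_neq0 (kappa_gt0 R))); move: hy3; lra.
Qed.

(** Here a X_1 = e X_1 since X_1 spans the intersection of k and p_Theta, and a Y_1 = c Y_1 + s Y_2
    by the larger subspace and beta-orthogonality to X_1. The matrix of a on (W_2, W_3) is also its
    matrix on (Z_2, -Z_1), which accounts for the sign of Z_1 in the basis and for the commutation
    with the scalar blocks. *)
Lemma aut_alpha1 a : K_Theta K [set @alpha1 R] a -> exists e c s : R,
  e * e = 1 /\ forall z3 w2 z2 w3 z1, a (ovec 0 z3 w2 z2 w3 z1) =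
  ovec 0 (e * z3) (e * c * w2 - s * w3) (e * c * z2 + s * z1) (e * s * w2 + c * w3)
    (c * z1 - e * s * z2).
Proof.
move=> Ta; have [Ka _] := Ta; have [la am aB] := K_aut hK Ka.
have [e hX1] : exists e, a (kvec 1 0 0 0 0 0) = kvec e 0 0 0 0 0.
  have /frkE h : a (kvec 1 0 0 0 0 0) \in frk R by apply/(K_frk hK hk Ka)/kvec_frk.
  have : in_p true false (a (kvec 1 0 0 0 0 0)).
    by apply: (K_Theta_in_p (@p_alpha1 R) Ta); apply/in_p_kvec.
  by rewrite h => /in_p_kvec[-> -> -> -> [_ -> //]]; eexists.
have [x [c [s hY1]]] : exists x c s, a (kvec 0 0 0 1 0 0) = kvec x 0 0 c s 0.
  apply/p1_alpha1; first exact/(K_frk hK hk Ka)/kvec_frk.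
  by apply: (K_Theta_p1 hK (@p_alpha1 R) Ta); apply/p1_alpha1; [exact: kvec_frk|do 3 eexists].
have ee : e * e = 1.
  by have := aB (kvec 1 0 0 0 0 0) (kvec 1 0 0 0 0 0); rewrite hX1 !beta_kvec; lra.
have x0 : x = 0.
  have := aB (kvec 1 0 0 0 0 0) (kvec 0 0 0 1 0 0); rewrite hX1 hY1 !beta_kvec => h.
  have ex : e * x = 0 by lra.
  by rewrite -[x]mul1r -ee -mulrA ex mulr0.
rewrite x0 in hY1.
have cs : c * c = 1 - s * s.
  by have := aB (kvec 0 0 0 1 0 0) (kvec 0 0 0 1 0 0); rewrite hY1 !beta_kvec; lra.
have k0 := lt0r_neq0 (kappa_gt0 R).
have hY2 : a (kvec 0 0 0 0 1 0) = kvec 0 0 0 (- (e * s)) (e * c) 0.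
  have -> : kvec 0 0 0 0 1 0 = bracket (kvec 1 0 0 0 0 0) (kvec 0 0 0 1 0 0) :> g2 R.
    by rewrite bracket_kvec; congr kvec; ring.
  by rewrite am hX1 hY1 bracket_kvec; congr kvec; ring.
have hY3 : a (kvec 0 0 0 0 0 1) = kvec 0 0 0 0 0 e.
  have : a (kvec 1 0 0 0 0 (kappa R)) = kvec e 0 0 0 0 (kappa R * e).
    have -> : kvec 1 0 0 0 0 (kappa R) = bracket (kvec 0 0 0 1 0 0) (kvec 0 0 0 0 1 0) :> g2 R.
      by rewrite bracket_kvec; congr kvec; ring.
    by rewrite am hY1 hY2 bracket_kvec; congr kvec; ring: cs.
  rewrite (kvec_lin la) hX1 !scale0r !add0r scale1r => h.
  have {}h : kappa R *: a (kvec 0 0 0 0 0 1) = kappa R *: kvec 0 0 0 0 0 e.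
    apply: (addrI (kvec e 0 0 0 0 0)); rewrite h !kE; congr kvec; ring.
  by apply: (scalerI k0).
have hX2 : a (kvec 0 1 0 0 0 0) = kvec 0 (e * c) (e * s) 0 0 0.
  have -> : kvec 0 1 0 0 0 0 = bracket (kvec 0 0 0 1 0 0) (kvec 0 0 0 0 0 1)
      + kappa R *: kvec 0 0 0 0 1 0 :> g2 R.
    by rewrite bracket_kvec !kE; congr kvec; ring.
  by rewrite addrC la am hY1 hY2 hY3 bracket_kvec !kE; congr kvec; ring.
have hX3 : a (kvec 0 0 1 0 0 0) = kvec 0 (- s) c 0 0 0.
  have -> : kvec 0 0 1 0 0 0 = bracket (kvec 1 0 0 0 0 0) (kvec 0 1 0 0 0 0) :> g2 R.
    by rewrite bracket_kvec; congr kvec; ring.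
  by rewrite am hX1 hX2 bracket_kvec; congr kvec; ring: ee.
exists e, c, s; split=> // z3 w2 z2 w3 z1.
by rewrite !ovecE (kvec_lin la) hX1 hX2 hX3 hY1 hY2 hY3 !kE; congr kvec; ring.
Qed.

Lemma exp_X1_ovec w2 z2 w3 z1 :
  exp_ad ((pi / 2) *: X1 R) (ovec 0 0 w2 z2 w3 z1) = ovec 0 0 (- w3) z1 w2 (- z2).
Proof.
have br w2' z2' w3' z1' : bracket (X1 R) (ovec 0 0 w2' z2' w3' z1')
    = ovec 0 0 (- w3') z1' w2' (- z2').
  by rewrite X1E !ovecE bracket_kvec; congr kvec; ring.
rewrite (@exp_ad_rot _ _ _ (ovec 0 0 (- w3) z1 w2 (- z2)) 1) ?br ?scale1r ?scaleN1r //.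
- by rewrite mul1r cos_pihalf sin_pihalf scale0r add0r scale1r.
- by rewrite ovecN; congr ovec; ring.
Qed.

Lemma metric_alpha1 A : is_endo m A ->
  (is_metric_operator K [set @alpha1 R] A <->
   exists mu1 mu2 mu3 a : R,
     [/\ [/\ 0 < mu1, 0 < mu2 & 0 < mu3],
         - Num.sqrt (mu2 * mu3) < a < Num.sqrt (mu2 * mu3) &
         has_matrix A (basis_alpha1 R) (mx_of_rows 5
           [:: [:: mu1; 0; 0; 0; 0];
               [:: 0; mu2; 0; a; 0];
               [:: 0; 0; mu2; 0; a];
               [:: 0; a; 0; mu3; 0];
               [:: 0; 0; a; 0; mu3]])]).
Proof.
have mk X : m X -> X \in frk R by case.
have ho := orthonormal_alpha1; have hB := basis_alpha1_m.
move=> hA; split=> [[q [iq inv e]]|].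
  have pos k := gram_nth_gt0 (k := k) hB ho iq.
  have lt k l := gram_nth_lt (k := k) (l := l) mk hB ho iq.
  exists (q (Z3 R) (Z3 R)), (q (W2 R) (W2 R)), (q (Z2 R) (Z2 R)), (q (W2 R) (Z2 R)).
  split.
  - by split; [exact: (pos 0%N isT)|exact: (pos 1%N isT)|exact: (pos 3%N isT)].
  - exact: (lt 1%N 3%N).
  have mB z3 w2 z2 w3 z1 : m (ovec 0 z3 w2 z2 w3 z1) by apply/m_alpha1; do 5 eexists.
  have gsym z3 w2 z2 w3 z1 z3' w2' z2' w3' z1' :
    q (ovec 0 z3 w2 z2 w3 z1) (ovec 0 z3' w2' z2' w3' z1') = _ :=
    q_sym iq (mB z3 w2 z2 w3 z1) (mB z3' w2' z2' w3' z1').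
  have odd := q_odd (m_Theta_0 hk _) (@m_Theta_lin _ _ hk _) iq inv.
  have KX1 := K_Theta_X1 hk (@p_alpha1 R); have KX2 := K_Theta_X2 hk (@p_alpha1 R).
  have KX : K_Theta K [set @alpha1 R] (exp_ad ((pi / 2) *: X1 R)).
    have : lie (K_Theta K [set @alpha1 R]) (X1 R) by apply/lie1; rewrite X1E; split;
      [exact: kvec_frk|apply/in_p_kvec].
    by move=> h; exact: (h (pi / 2)).
  have o1 x w2 z2 w3 z1 : q (ovec 0 x 0 0 0 0) (ovec 0 0 w2 z2 w3 z1) = 0 /\
      q (ovec 0 0 w2 z2 w3 z1) (ovec 0 x 0 0 0 0) = 0.
    by apply: (odd _ _ _ KX1 (mB _ _ _ _ _) (mB _ _ _ _ _)); rewrite ?exp_pi_X1_ovec ?ovecN ?oppr0.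
  have o2 x y w3 z1 : q (ovec 0 0 x y 0 0) (ovec 0 0 0 0 w3 z1) = 0 /\
      q (ovec 0 0 0 0 w3 z1) (ovec 0 0 x y 0 0) = 0.
    by apply: (odd _ _ _ KX2 (mB _ _ _ _ _) (mB _ _ _ _ _)); rewrite ?exp_pi_X2_ovec ?ovecN ?oppr0.
  (* The quarter turn sends W_2 to W_3 and Z_2 to -Z_1, so the Gram matrix of (W_2, Z_2) equals that
     of (W_3, -Z_1). *)
  have turn w2 z2 w2' z2' : q (ovec 0 0 0 0 w2 (- z2)) (ovec 0 0 0 0 w2' (- z2')) =
      q (ovec 0 0 w2 z2 0 0) (ovec 0 0 w2' z2' 0 0).
    rewrite -(inv _ (ovec 0 0 w2 z2 0 0) (ovec 0 0 w2' z2' 0 0) KX (mB _ _ _ _ _) (mB _ _ _ _ _)).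
    by rewrite !exp_X1_ovec !oppr0.
  have t1 := turn 1 0 1 0.
  have t2 := turn 0 1 0 1.
  have t3 := turn 1 0 0 1.
  rewrite !oppr0 in t1 t2 t3.
  have gm := gram_matrix mk hB ho hA iq e.
  apply: (has_matrix_rows gm) => -[|[|[|[|[|i]]]]] [|[|[|[|[|j]]]]] // _ _ /=;
    rewrite !basisE ?ovecN ?oppr0;
    first [by [] | by rewrite (o1 _ _ _ _ _).1 | by rewrite (o1 _ _ _ _ _).2
      | by rewrite (o2 _ _ _ _).1 | by rewrite (o2 _ _ _ _).2 | by rewrite t1 | by rewrite t2
      | by rewrite t3 | by rewrite -t3; exact: gsym | exact: gsym].
move=> [mu1 [mu2 [mu3 [a [[p1 p2 p3] l1 hM]]]]].
apply: (metric_of_matrix mk hB ho hA hM).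
- by move=> -[[|[|[|[|[|i]]]]] // hi] [[|[|[|[|[|j]]]]] // hj]; rewrite !mxE.
- move=> x [i xi].
  have xE k : x k = x (inord k) by rewrite inord_val.
  have : 0 < mu1 * x (inord 0) ^+ 2
    + (mu2 * x (inord 1) ^+ 2 + 2 * a * x (inord 1) * x (inord 3) + mu3 * x (inord 3) ^+ 2)
    + (mu2 * x (inord 2) ^+ 2 + 2 * a * x (inord 2) * x (inord 4) + mu3 * x (inord 4) ^+ 2).
    have Q1 : 0 <= mu1 * x (inord 0) ^+ 2 by rewrite mulr_ge0 ?sqr_ge0 // ltW.
    have Q2 := quad_ge0 (x (inord 1)) (x (inord 3)) p2 (quad_lt l1 p2 p3).
    have Q3 := quad_ge0 (x (inord 2)) (x (inord 4)) p2 (quad_lt l1 p2 p3).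
    have P2 := @quad_gt0 _ _ _ _ (x (inord 1)) (x (inord 3)) p2 (quad_lt l1 p2 p3).
    have P3 := @quad_gt0 _ _ _ _ (x (inord 2)) (x (inord 4)) p2 (quad_lt l1 p2 p3).
    move: xi; rewrite xE; case: i => -[|[|[|[|[|i]]]]] // hi /= xi.
    + have : 0 < mu1 * x (inord 0) ^+ 2 by rewrite mulr_gt0 // exprn_even_gt0.
      by lra.
    + by have := P2; rewrite xi => /(_ isT) P; lra.
    + by have := P3; rewrite xi => /(_ isT) P; lra.
    + by have := P2; rewrite xi orbT => /(_ isT) P; lra.
    + by have := P3; rewrite xi orbT => /(_ isT) P; lra.
  set Q := (X in 0 < X -> _) => Q0; rewrite [ltRHS](_ : _ = Q) //.
  by rewrite sum5 !sum5 !mxE !inordK //= /Q; ring.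
- move=> g Tg; have [Kg _] := Tg; have [lg _ _] := K_aut hK Kg; split=> //.
  + by move=> X; apply: (@K_Theta_m _ _ hK hk true false _ isT (@p_alpha1 R)).
  + by move=> X Y [Xk _] [Yk _]; exact: (K_ip hK hk Kg Xk Yk).
  have [u [v [w [uu aE]]]] := aut_alpha1 Tg.
  have AB := matrix_alpha1 hA hM; move=> j; rewrite !tnth_alpha1 aE !AB aE.
  by rewrite !mxE !inordK //=; congr ovec; ring.
Qed.

End CaseAlpha1.

(** * The case Theta = {alpha_2} *)

Section CaseAlpha2.
Variables (R : realType) (K : set (g2 R -> g2 R)).
Hypothesis hK : is_subgroup K.
Hypothesis hk : forall X : g2 R, lie K X <-> X \in frk R.
Implicit Types (X Y Z : g2 R) (A : g2 R -> g2 R).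
Let m := m_Theta K [set @alpha2 R].
Let lie2 := @lieP _ _ hk false true _ isT (@p_alpha2 R).
Let s : R := (Num.sqrt 2)^-1.
Let t : R := (Num.sqrt 5)^-1.

(** Clearing the inverse square roots leaves polynomial relations for [field] to reduce by. *)
Let st : exists u v : R, [/\ s = u / 2, t = v / 5, u ^+ 2 = 2 & v ^+ 2 = 5].
Proof.
exists (Num.sqrt 2), (Num.sqrt 5); split; rewrite ?sqr_sqrtr //.
- by rewrite -[X in _ / X](@sqr_sqrtr _ 2) // expr2 invfM mulrA divff ?mul1r // gt_eqF // sqrtr_gt0.
- by rewrite -[X in _ / X](@sqr_sqrtr _ 5) // expr2 invfM mulrA divff ?mul1r // gt_eqF // sqrtr_gt0.
Qed.

Lemma ovec_inj w1 z3 w2 z2 w3 z1 w1' z3' w2' z2' w3' z1' :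
  ovec w1 z3 w2 z2 w3 z1 = ovec w1' z3' w2' z2' w3' z1' :> g2 R ->
  [/\ w1 = w1', z3 = z3' & w2 = w2'] /\ [/\ z2 = z2', w3 = w3' & z1 = z1'].
Proof.
move=> e; have h X := congr1 (fun Y => ip Y X) e.
have h1 := h (ovec 1 0 0 0 0 0); have h2 := h (ovec 0 1 0 0 0 0).
have h3 := h (ovec 0 0 1 0 0 0); have h4 := h (ovec 0 0 0 1 0 0).
have h5 := h (ovec 0 0 0 0 1 0); have h6 := h (ovec 0 0 0 0 0 1).
rewrite !ip_ovec in h1 h2 h3 h4 h5 h6.
by split; split; lra.
Qed.

Lemma Y2_ovec y : kvec 0 0 0 0 y 0 = ovec 0 0 (- kappa R * y) (2 * kappa R * y) 0 0.
Proof. by rewrite kvec_ovec; congr ovec; ring. Qed.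

(** Since Y_2 = - kappa W_2 + 2 kappa Z_2, orthogonality to it reads w2 = 2 z2. *)
Lemma m_alpha2 X : m X <-> exists w1 z3 c w3 z1, X = ovec w1 z3 (2 * c) c w3 z1.
Proof.
split=> [[/frk_ovec[w1 [z3 [w2 [z2 [w3 [z1 ->]]]]]] h]|[w1 [z3 [c [w3 [z1 ->]]]]]].
  have : lie (K_Theta K [set @alpha2 R]) (kvec 0 0 0 0 1 0).
    by apply/lie2; split; [exact: kvec_frk|apply/in_p_kvec].
  move=> /h; rewrite Y2_ovec ip_ovec => e; have -> : w2 = 2 * z2.
    by apply: (mulfI (lt0r_neq0 (kappa_gt0 R))); lra.
  by do 5 eexists.
split=> [|Y /lie2[/frkE -> /in_p_kvec[-> -> -> -> [-> // _]]]]; first exact: ovec_frk.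
by rewrite Y2_ovec ip_ovec; ring.
Qed.

Lemma basis_alpha2E : basis_alpha2 R = [tuple ovec 0 0 (2 * t) t 0 0; ovec s s 0 0 0 0;
  ovec 0 0 0 0 s s; ovec s (- s) 0 0 0 0; ovec 0 0 0 0 s (- s)].
Proof.
have e : (Num.sqrt (nu R ^+ 2 + kappa R ^+ 2))^-1 = t / kappa R.
  rewrite nuE (_ : _ + _ = 5 * kappa R ^+ 2); last by ring.
  by rewrite sqrtrM // sqrtr_sqr gtr0_norm ?kappa_gt0 // invfM.
have k0 := lt0r_neq0 (kappa_gt0 R).
apply: eq_from_tnth => i; rewrite !(tnth_nth 0); case: i => -[|[|[|[|[|i]]]]] // hi /=.
- by rewrite e nuE !basisE !ovecZ ovecD ovecZ; congr ovec; field.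
- by rewrite !basisE ovecD ovecZ -/s; congr ovec; ring.
- by rewrite !basisE ovecD ovecZ -/s; congr ovec; ring.
- by rewrite !basisE ovecN ovecD ovecZ -/s; congr ovec; ring.
- by rewrite !basisE ovecN ovecD ovecZ -/s; congr ovec; ring.
Qed.

Lemma sum_alpha2 (c : 'I_5 -> R) : \sum_i c i *: tnth (basis_alpha2 R) i =
  ovec (s * (c (inord 1) + c (inord 3))) (s * (c (inord 1) - c (inord 3)))
    (2 * (t * c (inord 0))) (t * c (inord 0))
    (s * (c (inord 2) + c (inord 4))) (s * (c (inord 2) - c (inord 4))).
Proof.
by rewrite basis_alpha2E sum5 !(tnth_nth 0) !inordK //= !ovecZ !ovecD; congr ovec; ring.
Qed.

Lemma orthonormal_alpha2 : is_orthonormal (basis_alpha2 R).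
Proof.
have [u [v [sE tE u2 v2]]] := st.
move=> i j; rewrite basis_alpha2E !(tnth_nth 0) -val_eqE.
by case: i j => -[|[|[|[|[|n]]]]] // hi [[|[|[|[|[|n]]]]] // hj] /=;
  rewrite ip_ovec ?sE ?tE; field: u2 v2.
Qed.

Lemma basis_alpha2_m : is_basis m (basis_alpha2 R).
Proof.
have [u [v [sE tE u2 v2]]] := st.
apply: orthonormal_basis.
- exact: orthonormal_alpha2.
- move=> i; rewrite basis_alpha2E (tnth_nth 0); case: i => -[|[|[|[|[|n]]]]] //= hi;
  exact: ovec_frk.
- by move=> c; apply/m_alpha2; rewrite sum_alpha2; do 5 eexists.
- move=> X /m_alpha2[w1 [z3 [c [w3 [z1 ->]]]]].
  exists (fun i => nth 0 [:: 5 * t * c; s * (w1 + z3); s * (w3 + z1); s * (w1 - z3);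
    s * (w3 - z1)] i).
  by rewrite sum_alpha2 !inordK //= sE tE; congr ovec; field: u2 v2.
Qed.

Lemma matrix_alpha2 A mu1 mu2 mu3 : is_endo m A ->
  has_matrix A (basis_alpha2 R) (mx_of_rows 5
    [:: [:: mu1; 0; 0; 0; 0]; [:: 0; mu2; 0; 0; 0]; [:: 0; 0; mu2; 0; 0];
        [:: 0; 0; 0; mu3; 0]; [:: 0; 0; 0; 0; mu3]]) ->
  forall w1 z3 c w3 z1, A (ovec w1 z3 (2 * c) c w3 z1) =
  ovec ((mu2 * (w1 + z3) + mu3 * (w1 - z3)) / 2) ((mu2 * (w1 + z3) - mu3 * (w1 - z3)) / 2)
    (2 * (mu1 * c)) (mu1 * c)
    ((mu2 * (w3 + z1) + mu3 * (w3 - z1)) / 2) ((mu2 * (w3 + z1) - mu3 * (w3 - z1)) / 2).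
Proof.
move=> [Am Al] hM w1 z3 c w3 z1; have [u [v [sE tE u2 v2]]] := st.
have -> : ovec w1 z3 (2 * c) c w3 z1 =
    \sum_(i < 5) nth 0 [:: 5 * t * c; s * (w1 + z3); s * (w3 + z1); s * (w1 - z3);
      s * (w3 - z1)] i *: tnth (basis_alpha2 R) i.
  by rewrite sum_alpha2 !inordK //= sE tE; congr ovec; field: u2 v2.
rewrite (lin_on_sum basis_alpha2_m) //.
rewrite sum5 !hM !sum_alpha2 !mxE !inordK //= !ovecZ !ovecD.
by rewrite sE tE; congr ovec; field: u2 v2.
Qed.

Lemma bracket_Y2_ovec w1 z3 w2 z2 w3 z1 :
  bracket (Yk R i2) (ovec w1 z3 w2 z2 w3 z1) =
  ovec (- kappa R * (w3 / 2 + z1)) (- kappa R * (w3 + z1 / 2)) 0 0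
    (kappa R * (w1 / 2 + z3)) (kappa R * (w1 + z3 / 2)).
Proof.
have [r [rE r2]] := kappa_sqrt3 R.
by rewrite YE !ovecE bracket_kvec; congr kvec; rewrite rE; field: r2.
Qed.

(* The automorphism commutes with the square of ad Y_2, whose eigenspaces in m are spanned by
   the first vector, the next two and the last two vectors of the basis. *)
Lemma aut_alpha2 a X : K_Theta K [set @alpha2 R] a -> X \in frk R ->
  bracket (Yk R i2) (bracket (Yk R i2) (a X)) = a (bracket (Yk R i2) (bracket (Yk R i2) X)).
Proof.
move=> Ta Xk; have [Ka _] := Ta; have [la am aB] := K_aut hK Ka.
have [d hY2] : exists d, a (kvec 0 0 0 0 1 0) = kvec 0 0 0 0 d 0.
  have /frkE h : a (kvec 0 0 0 0 1 0) \in frk R by apply/(K_frk hK hk Ka)/kvec_frk.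
  have : in_p false true (a (kvec 0 0 0 0 1 0)).
    by apply: (K_Theta_in_p (@p_alpha2 R) Ta); apply/in_p_kvec.
  by rewrite h => /in_p_kvec[-> -> -> -> [-> // _]]; eexists.
have dd : d * d = 1.
  by have := aB (kvec 0 0 0 0 1 0) (kvec 0 0 0 0 1 0); rewrite hY2 !beta_kvec; lra.
rewrite !am YE hY2 (_ : kvec 0 0 0 0 d 0 = d *: kvec 0 0 0 0 1 0); last first.
  by rewrite !kE; congr kvec; ring.
by rewrite !bracketZl linearZ /= scalerA dd scale1r.
Qed.

Lemma K_Theta_Y2 r : K_Theta K [set @alpha2 R] (exp_ad (r *: Yk R i2)).
Proof.
have h : lie (K_Theta K [set @alpha2 R]) (Yk R i2).
  by apply/lie2; rewrite YE; split; [exact: kvec_frk|apply/in_p_kvec].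
exact: h.
Qed.

Lemma exp_Y2_ovec r x y c x' y' :
  let C3 := cos (3 / 2 * kappa R * r) in let S3 := sin (3 / 2 * kappa R * r) in
  let C := cos (kappa R / 2 * r) in let S := sin (kappa R / 2 * r) in
  exp_ad (r *: Yk R i2) (ovec (x + y) (x - y) (2 * c) c (x' + y') (x' - y')) =
  ovec ((C3 * x - S3 * x') + (C * y + S * y')) ((C3 * x - S3 * x') - (C * y + S * y')) (2 * c) c
    ((C3 * x' + S3 * x) + (C * y' - S * y)) ((C3 * x' + S3 * x) - (C * y' - S * y)).
Proof.
move=> C3 S3 C S; have br := bracket_Y2_ovec; rewrite YE in br; rewrite YE.
have -> : ovec (x + y) (x - y) (2 * c) c (x' + y') (x' - y') =
    ovec 0 0 (2 * c) c 0 0 + (ovec x x 0 0 x' x' + ovec y (- y) 0 0 y' (- y')) :> g2 R.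
  by rewrite !ovecD; congr ovec; ring.
rewrite !linearD /= exp_ad_fix; last first.
  by rewrite br -kvec0 kvec_ovec; congr ovec; ring.
rewrite (@exp_ad_rot _ _ (ovec x x 0 0 x' x') (ovec (- x') (- x') 0 0 x x) (3 / 2 * kappa R)).
- rewrite (@exp_ad_rot _ _ (ovec y (- y) 0 0 y' (- y')) (ovec y' (- y') 0 0 (- y) y) (kappa R / 2)).
  + by rewrite !ovecZ !ovecD -/C3 -/S3 -/C -/S; congr ovec; ring.
  + by rewrite br ovecZ; congr ovec; field.
  + by rewrite br ovecZ; congr ovec; field.
- by rewrite br ovecZ; congr ovec; field.
- by rewrite br ovecZ; congr ovec; field.
Qed.

(** The eigenvalues on m are 0 on 2 W_2 + Z_2 and minus the squared speeds on the two planes, - (3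
    kappa / 2)^2 = -3 and - (kappa / 2)^2 = -1/3. They are distinct, which is what separates the
    three eigenspaces. *)
Lemma sq_Y2_ovec w1 z3 w2 z2 w3 z1 :
  bracket (Yk R i2) (bracket (Yk R i2) (ovec w1 z3 w2 z2 w3 z1)) =
  ovec (- (5 * w1 + 4 * z3) / 3) (- (4 * w1 + 5 * z3) / 3) 0 0
    (- (5 * w3 + 4 * z1) / 3) (- (4 * w3 + 5 * z1) / 3).
Proof.
have [r [rE r2]] := kappa_sqrt3 R.
by rewrite !bracket_Y2_ovec rE; congr ovec; field: r2.
Qed.

(* The planes (x, x') and (y, y') are invariant under ad Y_2, which rotates them with
   speeds 3 kappa / 2 and - kappa / 2. *)
Let pvec x y c x' y' : g2 R := ovec (x + y) (x - y) (2 * c) c (x' + y') (x' - y').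

Lemma exp_Y2_pvec r x y c x' y' :
  let C3 := cos (3 / 2 * kappa R * r) in let S3 := sin (3 / 2 * kappa R * r) in
  let C := cos (kappa R / 2 * r) in let S := sin (kappa R / 2 * r) in
  exp_ad (r *: Yk R i2) (pvec x y c x' y') =
  pvec (C3 * x - S3 * x') (C * y + S * y') c (C3 * x' + S3 * x) (C * y' - S * y).
Proof. exact: exp_Y2_ovec. Qed.

Let k0 := lt0r_neq0 (kappa_gt0 R).

(** The angles 3 pi / 2 and - pi / 2 agree modulo 2 pi, so both planes make the same quarter turn.
    It yields the equal diagonal entries and the orthogonality inside each plane. *)
Lemma exp_Y2_quarter x y c x' y' :
  exp_ad ((pi / kappa R) *: Yk R i2) (pvec x y c x' y') = pvec x' y' c (- x) (- y).
Proof.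
rewrite exp_Y2_pvec (_ : 3 / 2 * kappa R * _ = pi / 2 + pi); last by field.
rewrite (_ : kappa R / 2 * _ = pi / 2); last by field.
by rewrite cosDpi sinDpi cos_pihalf sin_pihalf; congr ovec; ring.
Qed.

(** The angles are 3 pi and - pi: both planes are negated and the first basis vector is fixed, hence
    orthogonal to them. *)
Lemma exp_Y2_half x y c x' y' :
  exp_ad ((2 * pi / kappa R) *: Yk R i2) (pvec x y c x' y') = pvec (- x) (- y) c (- x') (- y').
Proof.
rewrite exp_Y2_pvec (_ : 3 / 2 * kappa R * _ = pi + pi + pi); last by field.
rewrite (_ : kappa R / 2 * _ = pi); last by field.
by rewrite !cosDpi !sinDpi cospi sinpi; congr ovec; ring.
Qed.

(** The faster plane has made a full turn while the slower one has turned by a third. This is the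
    element that makes the two planes orthogonal. *)
Lemma exp_Y2_third x y c x' y' : let C := cos (2 / 3 * pi) in let S := sin (2 / 3 * pi) in
  exp_ad ((4 / 3 * pi / kappa R) *: Yk R i2) (pvec x y c x' y') =
  pvec x (C * y + S * y') c x' (C * y' - S * y).
Proof.
move=> C S; rewrite exp_Y2_pvec (_ : 3 / 2 * kappa R * _ = pi + pi); last by field.
rewrite (_ : kappa R / 2 * _ = 2 / 3 * pi); last by field.
by rewrite cosDpi sinDpi cospi sinpi -/C -/S; congr ovec; ring.
Qed.

Lemma pvec_m x y c x' y' : m (pvec x y c x' y').
Proof. by apply/m_alpha2; do 5 eexists. Qed.

Lemma metric_alpha2 A : is_endo m A ->
  (is_metric_operator K [set @alpha2 R] A <->
   exists mu1 mu2 mu3 : R,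
     [/\ 0 < mu1, 0 < mu2, 0 < mu3 &
         has_matrix A (basis_alpha2 R) (mx_of_rows 5
           [:: [:: mu1; 0; 0; 0; 0];
               [:: 0; mu2; 0; 0; 0];
               [:: 0; 0; mu2; 0; 0];
               [:: 0; 0; 0; mu3; 0];
               [:: 0; 0; 0; 0; mu3]])]).
Proof.
have mk X : m X -> X \in frk R by case.
have ho := orthonormal_alpha2; have hB := basis_alpha2_m.
have bE : basis_alpha2 R = [tuple pvec 0 0 t 0 0; pvec s 0 0 0 0; pvec 0 0 0 s 0;
    pvec 0 s 0 0 0; pvec 0 0 0 0 s].
  rewrite basis_alpha2E; apply: eq_from_tnth => i; rewrite !(tnth_nth 0).
  by case: i => -[|[|[|[|[|i]]]]] // hi /=; congr ovec; ring.
move=> hA; split=> [[q [iq inv e]]|].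
  have pos k := gram_nth_gt0 (k := k) hB ho iq; rewrite bE in pos.
  have m0 := m_Theta_0 hk [set @alpha2 R]; have ml := @m_Theta_lin _ _ hk [set @alpha2 R].
  have gsym x y c x' y' x1 y1 c1 x1' y1' :
      q (pvec x y c x' y') (pvec x1 y1 c1 x1' y1') = _ :=
    q_sym iq (pvec_m x y c x' y') (pvec_m x1 y1 c1 x1' y1').
  have g1 x y c x' y' x1 y1 c1 x1' y1' := inv _ _ _ (K_Theta_Y2 (pi / kappa R))
    (pvec_m x y c x' y') (pvec_m x1 y1 c1 x1' y1').
  have g3 x y c x' y' x1 y1 c1 x1' y1' := inv _ _ _ (K_Theta_Y2 (4 / 3 * pi / kappa R))
    (pvec_m x y c x' y') (pvec_m x1 y1 c1 x1' y1').
  have pN x y c x' y' : - pvec x y c x' y' = pvec (- x) (- y) (- c) (- x') (- y').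
    by rewrite /pvec ovecN; congr ovec; ring.
  have qNr x y c x' y' x1 y1 c1 x1' y1' :=
    qN_r m0 ml iq (pvec_m x y c x' y') (pvec_m x1 y1 c1 x1' y1').
  have e12 : q (pvec 0 0 0 s 0) (pvec 0 0 0 s 0) = q (pvec s 0 0 0 0) (pvec s 0 0 0 0).
    by have := g1 0 0 0 s 0 0 0 0 s 0; rewrite !exp_Y2_quarter !oppr0.
  have e34 : q (pvec 0 0 0 0 s) (pvec 0 0 0 0 s) = q (pvec 0 s 0 0 0) (pvec 0 s 0 0 0).
    by have := g1 0 0 0 0 s 0 0 0 0 s; rewrite !exp_Y2_quarter !oppr0.
  (* The quarter turn exchanges the two vectors up to one sign, so their product equals its own
     opposite. *)
  have z12 : q (pvec s 0 0 0 0) (pvec 0 0 0 s 0) = 0.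
    have := g1 0 0 0 s 0 s 0 0 0 0; rewrite !exp_Y2_quarter !oppr0.
    have := qNr s 0 0 0 0 0 0 0 s 0; rewrite pN !oppr0 => -> .
    by rewrite (gsym 0 0 0 s 0) => ?; lra.
  have z34 : q (pvec 0 s 0 0 0) (pvec 0 0 0 0 s) = 0.
    have := g1 0 0 0 0 s 0 s 0 0 0; rewrite !exp_Y2_quarter !oppr0.
    have := qNr 0 s 0 0 0 0 0 0 0 s; rewrite pN !oppr0 => -> .
    by rewrite (gsym 0 0 0 0 s) => ?; lra.
  have odd x y x' y' : q (pvec 0 0 t 0 0) (pvec x y 0 x' y') = 0 /\
      q (pvec x y 0 x' y') (pvec 0 0 t 0 0) = 0.
    apply: (q_odd m0 ml iq inv (K_Theta_Y2 (2 * pi / kappa R)) (pvec_m _ _ _ _ _)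
      (pvec_m _ _ _ _ _)).
      by rewrite exp_Y2_half !oppr0.
    by rewrite exp_Y2_half pN oppr0.
  have cross x x' : q (pvec 0 s 0 0 0) (pvec x 0 0 x' 0) = 0 /\
      q (pvec 0 0 0 0 s) (pvec x 0 0 x' 0) = 0.
    have h3 := g3 0 s 0 0 0 x 0 0 x' 0; have h4 := g3 0 0 0 0 s x 0 0 x' 0.
    have S0 : 0 < sin (2 / 3 * pi) :> R.
      by apply: sin_gt0_pi; have := pi_gt0 R => p0; apply/andP; split; lra.
    rewrite !exp_Y2_third !mulr0 ?addr0 ?add0r ?subr0 ?sub0r ?oppr0 in h3 h4; move: S0 h3 h4.
    set C := cos _; set S := sin _ => S0 h3 h4.
    have lin y y' : pvec 0 (y * s) 0 0 (y' * s) = y *: pvec 0 s 0 0 0 + y' *: pvec 0 0 0 0 s.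
      by rewrite /pvec !ovecZ ovecD; congr ovec; ring.
    have ql y y' := qD_l m0 ml iq y y' (pvec_m 0 s 0 0 0) (pvec_m 0 0 0 0 s) (pvec_m x 0 0 x' 0).
    rewrite -mulNr lin ql in h3; rewrite lin ql in h4; move: h3 h4.
    set al := q _ _; set be := q _ _ => h3 h4.
    (* The pair (al, be) is fixed by a rotation of angle 2 pi / 3. This is the determinant of the
       identity minus that rotation, and the combinations below are the rows of its adjugate. *)
    have D0 : 0 < (1 - C) ^+ 2 + S ^+ 2 by rewrite ltr_wpDl ?sqr_ge0 // exprn_gt0.
    split; apply: (mulfI (lt0r_neq0 D0)); rewrite mulr0.
    - transitivity ((1 - C) * (al - (C * al + - S * be)) - S * (be - (S * al + C * be))).
        by ring.
      by rewrite h3 h4; ring.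
    - transitivity ((1 - C) * (be - (S * al + C * be)) + S * (al - (C * al + - S * be))).
        by ring.
      by rewrite h3 h4; ring.
  exists (q (pvec 0 0 t 0 0) (pvec 0 0 t 0 0)), (q (pvec s 0 0 0 0) (pvec s 0 0 0 0)),
    (q (pvec 0 s 0 0 0) (pvec 0 s 0 0 0)).
  split; [exact: (pos 0%N isT)|exact: (pos 1%N isT)|exact: (pos 3%N isT)|].
  have gm := gram_matrix mk hB ho hA iq e.
  apply: (has_matrix_rows gm); rewrite bE => -[|[|[|[|[|i]]]]] [|[|[|[|[|j]]]]] // _ _ /=;
    first [by [] | by rewrite (odd _ _ _ _).1 | by rewrite (odd _ _ _ _).2
      | by rewrite (cross _ _).1 | by rewrite (cross _ _).2
      | by rewrite gsym (cross _ _).1 | by rewrite gsym (cross _ _).2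
      | by rewrite e12 | by rewrite e34 | by rewrite z12 | by rewrite z34
      | by rewrite gsym z12 | by rewrite gsym z34].
move=> [mu1 [mu2 [mu3 [p1 p2 p3 hM]]]].
apply: (metric_of_matrix mk hB ho hA hM).
- by move=> -[[|[|[|[|[|i]]]]] // hi] [[|[|[|[|[|j]]]]] // hj]; rewrite !mxE.
- move=> x [i xi].
  have xE k : x k = x (inord k) by rewrite inord_val.
  have ge0 mu k : 0 < mu -> 0 <= mu * x k ^+ 2 by move=> h; rewrite mulr_ge0 ?sqr_ge0 // ltW.
  have gt0 mu k : 0 < mu -> x k != 0 -> 0 < mu * x k ^+ 2.
    by move=> h h'; rewrite mulr_gt0 // exprn_even_gt0.
  have : 0 < mu1 * x (inord 0) ^+ 2 + mu2 * x (inord 1) ^+ 2 + mu2 * x (inord 2) ^+ 2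
    + mu3 * x (inord 3) ^+ 2 + mu3 * x (inord 4) ^+ 2.
    have g0 := ge0 _ (inord 0) p1; have g1 := ge0 _ (inord 1) p2; have g2 := ge0 _ (inord 2) p2.
    have g3 := ge0 _ (inord 3) p3; have g4 := ge0 _ (inord 4) p3.
    move: xi; rewrite xE; case: i => -[|[|[|[|[|i]]]]] // hi /= xi.
    + by have := gt0 _ _ p1 xi; lra.
    + by have := gt0 _ _ p2 xi; lra.
    + by have := gt0 _ _ p2 xi; lra.
    + by have := gt0 _ _ p3 xi; lra.
    + by have := gt0 _ _ p3 xi; lra.
  set Q := (X in 0 < X -> _) => Q0; rewrite [ltRHS](_ : _ = Q) //.
  by rewrite sum5 !sum5 !mxE !inordK //= /Q; ring.
- move=> g Tg; have [Kg _] := Tg; have [lg _ _] := K_aut hK Kg.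
  have gm : forall X, m X -> m (g X).
    by move=> X; apply: (@K_Theta_m _ _ hK hk false true _ isT (@p_alpha2 R)).
  split=> //; first by move=> X Y [Xk _] [Yk _]; exact: (K_ip hK hk Kg Xk Yk).
  have AB := matrix_alpha2 hA hM.
  have g0 : g 0 = 0 by have := lg (-1) 0 0; rewrite scaler0 addr0 scaleN1r addNr.
  have gZ (c : R) X : g (c *: X) = c *: g X by rewrite -[c *: X]addr0 lg g0 addr0.
  (* An eigenvector of the square of ad Y_2 in m is one of A. *)
  have key x y c x' y' mu tau : A (pvec x y c x' y') = mu *: pvec x y c x' y' ->
      bracket (Yk R i2) (bracket (Yk R i2) (pvec x y c x' y')) = tau *: pvec x y c x' y' ->
      [\/ tau = 0 /\ mu = mu1, tau = - 3 /\ mu = mu2 | tau = - 1 / 3 /\ mu = mu3] ->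
      A (g (pvec x y c x' y')) = g (A (pvec x y c x' y')).
    move=> hA1 hT hcase; rewrite hA1 gZ.
    have := aut_alpha2 Tg (mk _ (pvec_m x y c x' y')); rewrite hT gZ.
    have /m_alpha2[w1 [z3 [d [w3 [z1 ->]]]]] := gm _ (pvec_m x y c x' y').
    rewrite sq_Y2_ovec ovecZ AB ovecZ => /ovec_inj[[h1 h2 _] [h4 h5 h6]].
    case: hcase => -[tE muE]; rewrite tE in h1 h2 h4 h5 h6; rewrite muE.
    + have -> : w1 = 0 by lra.
      have -> : z3 = 0 by lra.
      have -> : w3 = 0 by lra.
      have -> : z1 = 0 by lra.
      by congr ovec; ring.
    + have -> : d = 0 by lra.
      have -> : z3 = w1 by lra.
      have -> : z1 = w3 by lra.
      by congr ovec; field.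
    + have -> : d = 0 by lra.
      have -> : z3 = - w1 by lra.
      have -> : z1 = - w3 by lra.
      by congr ovec; field.
  move=> j; rewrite bE (tnth_nth 0); case: j => -[|[|[|[|[|j]]]]] // hj /=.
  + by apply: (key _ _ _ _ _ mu1 0); [rewrite AB|rewrite sq_Y2_ovec|by apply: Or31];
      rewrite ovecZ; congr ovec; field.
  + by apply: (key _ _ _ _ _ mu2 (-3)); [rewrite AB|rewrite sq_Y2_ovec|by apply: Or32];
      rewrite ovecZ; congr ovec; field.
  + by apply: (key _ _ _ _ _ mu2 (-3)); [rewrite AB|rewrite sq_Y2_ovec|by apply: Or32];
      rewrite ovecZ; congr ovec; field.
  + by apply: (key _ _ _ _ _ mu3 (-1 / 3)); [rewrite AB|rewrite sq_Y2_ovec|by apply: Or33];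
      rewrite ovecZ; congr ovec; field.
  + by apply: (key _ _ _ _ _ mu3 (-1 / 3)); [rewrite AB|rewrite sq_Y2_ovec|by apply: Or33];
      rewrite ovecZ; congr ovec; field.
Qed.

End CaseAlpha2.

Theorem theorem3p1 (R : realType) (K : set (g2 R -> g2 R))
    (hK : is_maximal_compact K)
    (hk : forall X : g2 R, lie K X <-> X \in frk R) :
  [/\ [/\ is_basis (m_Theta K set0) (basis_empty R),
          is_orthonormal (basis_empty R) &
          forall A : g2 R -> g2 R, is_endo (m_Theta K set0) A ->
            (is_metric_operator K set0 A <->
             exists mu1 mu2 mu3 mu4 mu5 mu6 a1 a2 a3 : R,
               [/\ [/\ 0 < mu1, 0 < mu2 & 0 < mu3],
                   [/\ 0 < mu4, 0 < mu5 & 0 < mu6],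
                   [/\ - Num.sqrt (mu1 * mu2) < a1 < Num.sqrt (mu1 * mu2),
                       - Num.sqrt (mu3 * mu4) < a2 < Num.sqrt (mu3 * mu4) &
                       - Num.sqrt (mu5 * mu6) < a3 < Num.sqrt (mu5 * mu6)] &
                   has_matrix A (basis_empty R) (mx_of_rows 6
                     [:: [:: mu1; a1; 0; 0; 0; 0];
                         [:: a1; mu2; 0; 0; 0; 0];
                         [:: 0; 0; mu3; a2; 0; 0];
                         [:: 0; 0; a2; mu4; 0; 0];
                         [:: 0; 0; 0; 0; mu5; a3];
                         [:: 0; 0; 0; 0; a3; mu6]])])],
      is_basis (m_Theta K [set @alpha1 R]) (basis_alpha1 R) /\
      forall A : g2 R -> g2 R, is_endo (m_Theta K [set @alpha1 R]) A ->
        (is_metric_operator K [set @alpha1 R] A <->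
         exists mu1 mu2 mu3 a : R,
           [/\ [/\ 0 < mu1, 0 < mu2 & 0 < mu3],
               - Num.sqrt (mu2 * mu3) < a < Num.sqrt (mu2 * mu3) &
               has_matrix A (basis_alpha1 R) (mx_of_rows 5
                 [:: [:: mu1; 0; 0; 0; 0];
                     [:: 0; mu2; 0; a; 0];
                     [:: 0; 0; mu2; 0; a];
                     [:: 0; a; 0; mu3; 0];
                     [:: 0; 0; a; 0; mu3]])]) &
      is_basis (m_Theta K [set @alpha2 R]) (basis_alpha2 R) /\
      forall A : g2 R -> g2 R, is_endo (m_Theta K [set @alpha2 R]) A ->
        (is_metric_operator K [set @alpha2 R] A <->
         exists mu1 mu2 mu3 : R,
           [/\ 0 < mu1, 0 < mu2, 0 < mu3 &
               has_matrix A (basis_alpha2 R) (mx_of_rows 5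
                 [:: [:: mu1; 0; 0; 0; 0];
                     [:: 0; mu2; 0; 0; 0];
                     [:: 0; 0; mu2; 0; 0];
                     [:: 0; 0; 0; mu3; 0];
                     [:: 0; 0; 0; 0; mu3]])])].
Proof.
have hs : is_subgroup K by case: hK => [[]].
split.
- split; [exact: basis_empty_m|exact: orthonormal_empty|exact: metric_empty].
- by split; [exact: basis_alpha1_m|exact: metric_alpha1].
- by split; [exact: basis_alpha2_m|exact: metric_alpha2].
Qed.
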